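(* Let $T=\{\tau(s,\cdot)\}_{s\in P}$ and $S=\{\sigma(s,\cdot)\}_{s\in P}$ be one parameter groups of diffeomorphisms of sharply open sets $T'\subseteq[t_1,t_2]$ and $S'\subseteq\widetilde{\mathbb R}^d$, respectively. If the functional $J$ is invariant under the action of $T$ and $S$, then the quantity $C[q]^m(t)$, defined for all $q\in\mathcal{GC}^\infty([t_1,t_2],S')$ and $t\in T'$ by $$C[q]^m(t):=\sum_{i=1}^m\varphi^i(q,t)\cdot\eta^{i-1}(q,t)+\left(L[q]^m(t)-\sum_{i=1}^m\varphi^i(q,t)\cdot q^{(i)}(t)\right)\frac{\partial\tau}{\partial s}(0,t),$$ is a constant of motion on $T'$, $S'$, i.e. $\frac{d}{dt}C[q]^m(t)=0$ for all $t\in T'$ along every weak extremal $q\in\mathcal{GC}^\infty([t_1,t_2],S')$ of $J$.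
   Context: Ring of scalars. Fix a net $\rho=(\rho_\varepsilon)_{\varepsilon\in(0,1]}$ in $(0,1]$ with $\rho_\varepsilon\to0$ as $\varepsilon\to0^+$. ''For $\varepsilon$ small'' means: for all $\varepsilon\in(0,\varepsilon_0]$, for some $\varepsilon_0\in(0,1]$. A net $(x_\varepsilon)\in\mathbb R^{(0,1]}$ is moderate if there is $N\in\mathbb N$ with $|x_\varepsilon|\le\rho_\varepsilon^{-N}$ for $\varepsilon$ small; $(x_\varepsilon)\sim(y_\varepsilon)$ if for all $n\in\mathbb N$, $|x_\varepsilon-y_\varepsilon|\le\rho_\varepsilon^n$ for $\varepsilon$ small. $\widetilde{\mathbb R}$ is the ring of moderate nets modulo $\sim$ with pointwise operations; classes are written $[x_\varepsilon]$, similarly for $\widetilde{\mathbb R}^n$. Order: $x\le y$ iff there are representatives $x=[x_\varepsilon]$, $y=[y_\varepsilon]$ with $x_\varepsilon\le y_\varepsilon$ for all $\varepsilon$; $x<y$ means $x\le y$ and $y-x$ is invertible; $\widetilde{\mathbb R}_{>0}=\{x: x>0\}$. $[a,b]=\{x\in\widetilde{\mathbb R}: a\le x\le b\}$, $(a,b)=\{x: a<x<b\}$, $|[x_\varepsilon]|=[|x_\varepsilon|]$, $B_r(c)=\{x\in\widetilde{\mathbb R}^n:|x-c|<r\}$ for $r\in\widetilde{\mathbb R}_{>0}$. The sharp topology on $\widetilde{\mathbb R}^n$ has these balls as a base; all topological notions refer to it. Generalized smooth functions (GSF). For $\Omega_\varepsilon\subseteq\mathbb R^n$, $\langle\Omega_\varepsilon\rangle$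 is the set of $[x_\varepsilon]\in\widetilde{\mathbb R}^n$ such that for every representative $(x'_\varepsilon)$ one has $x'_\varepsilon\in\Omega_\varepsilon$ for $\varepsilon$ small. For $X\subseteq\widetilde{\mathbb R}^n$, $Y\subseteq\widetilde{\mathbb R}^k$, a map $f:X\to Y$ is a GSF, $f\in\mathcal{GC}^\infty(X,Y)$, if there is a net $f_\varepsilon\in C^\infty(\Omega_\varepsilon,\mathbb R^k)$, $\Omega_\varepsilon\subseteq\mathbb R^n$ open, with $X\subseteq\langle\Omega_\varepsilon\rangle$, $f([x_\varepsilon])=[f_\varepsilon(x_\varepsilon)]\in Y$ and $(\partial^\alpha f_\varepsilon(x_\varepsilon))$ moderate for all $[x_\varepsilon]\in X$ and all multi-indices $\alpha$ (one may always choose $\Omega_\varepsilon=\mathbb R^n$). Derivatives at sharply interior points are $\partial^\alpha f([x_\varepsilon])=[\partial^\alpha f_\varepsilon(x_\varepsilon)]$ (independent of choices), and at endpoints of intervals they are the sharp limits from interior points. For $f\in\mathcal{GC}^\infty([a,b],\widetilde{\mathbb R})$ and $c=[c_\varepsilon],e=[e_\varepsilon]\in[a,b]$, $\int_c^e f(t)\,dt=[\int_{c_\varepsilon}^{e_\varepsilon}f_\varepsilon(t)\,dt]$ for any $f_\varepsilon\in C^\infty(\mathbb R,\mathbb R)$ defining $f$. Variational setting. Let $t_1<t_2$ in $\widetilde{\mathbb R}$, $d,m\in\mathbb N_{>0}$, $L\in\mathcal{GC}^\infty([t_1,t_2]\times\widetilde{\mathbb R}^{d(m+1)},\widetilde{\mathbb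 R})$. For $q\in\mathcal{GC}^\infty([t_1,t_2],\widetilde{\mathbb R}^d)$ set $L[q]^m(t)=L(t,q(t),\dot q(t),\ldots,q^{(m)}(t))$, $J(q)=\int_{t_1}^{t_2}L[q]^m(t)\,dt$. $\partial_1L$ is the partial derivative in $t$, $\partial_{i+2}L$ ($0\le i\le m$) the gradient with respect to the $\widetilde{\mathbb R}^d$-argument into which $q^{(i)}$ is inserted; $\partial_jL[q]^m(t)$ is $\partial_jL$ evaluated at $(t,q(t),\ldots,q^{(m)}(t))$. $\mathcal{GC}^\infty_0(m)$ is the set of $h\in\mathcal{GC}^\infty([t_1,t_2],\widetilde{\mathbb R}^d)$ with $h^{(i)}(t_1)=h^{(i)}(t_2)=0$ for $i=0,\ldots,m-1$; $\delta J(q;h)=\frac{d}{ds}J(q+sh)|_{s=0}$; $q$ is a weak extremal of $J$ if $\delta J(q;h)=0$ for all $h\in\mathcal{GC}^\infty_0(m)$. For $j=0,\ldots,m$: $\varphi^j(q,t)=\varphi^j(q)(t):=\sum_{i=0}^{m-j}(-1)^i\frac{d^i}{dt^i}\partial_{i+j+2}L[q]^m(t)$. One parameter groups. For a sharply open $D\subseteq\widetilde{\mathbb R}^k$, $\{\psi(s,\cdot)\}_{s\in P}$ is a one parameter group of diffeomorphisms of $D$ if: $P\subseteq\widetilde{\mathbb R}$ is sharply open, $0\in P$, $\psi\in\mathcal{GC}^\infty(P\times D,D)$; for each $s\in P$ the map $\psi(s,\cdot)\in\mathcal{GC}^\infty(D,D)$ is invertible with $\psi(s,\cdot)^{-1}\in\mathcal{GC}^\infty(D,D)$;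 $\psi(0,\cdot)=\mathrm{Id}_D$; and $\psi(s,\cdot)\circ\psi(s',\cdot)=\psi(s+s',\cdot)$ whenever $s,s',s+s'\in P$. Invariance. $J$ is invariant under the action of $T$ and $S$ if for any weak extremal $q\in\mathcal{GC}^\infty([t_1,t_2],S')$, all $s\in P$ and $t\in T'$: $$L[q]^m(t)=L\left(\tau(s,t),\sigma(s,q(t)),\frac{d\sigma(s,q(t))}{d\tau(s,t)},\ldots,\frac{d^m\sigma(s,q(t))}{d\tau^m(s,t)}\right)\frac{\partial\tau}{\partial t}(s,t),$$ where $\frac{d\sigma(s,q(t))}{d\tau(s,t)}:=\frac{\partial_t[\sigma(s,q(t))]}{\partial_t\tau(s,t)}$ and $\frac{d^i\sigma(s,q(t))}{d\tau^i(s,t)}:=\frac{1}{\partial_t\tau(s,t)}\,\partial_t\!\left[\frac{d^{i-1}\sigma(s,q(t))}{d\tau^{i-1}(s,t)}\right]$ for $i=2,\ldots,m$ ($\partial_t\tau(s,t)$ is always invertible). Infinitesimal generators. $\eta^0(q,t):=\frac{\partial\sigma}{\partial s}(0,q(t))$ and $\eta^i(q,t):=\frac{d}{dt}\eta^{i-1}(q,t)-q^{(i)}(t)\frac{d}{dt}\frac{\partial\tau}{\partial s}(0,t)$ for $i=1,\ldots,m$. *)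

(* Defs.v *)
From HB Require Import structures.
From mathcomp Require Import all_boot all_order all_algebra.
From mathcomp Require Import generic_quotient ring_quotient.
From mathcomp Require Import all_classical all_reals all_analysis.

Set Implicit Arguments.
Unset Strict Implicit.
Unset Printing Implicit Defensive.

Import Order.TTheory GRing.Theory Num.Theory.
Import numFieldNormedType.Exports.

Local Open Scope classical_set_scope.
Local Open Scope ring_scope.
Local Open Scope quotient_scope.

(* The index set (0,1]; [eps0 R] is the filter of the sets of indices that
   contain some (0, e0], so [\forall e \near eps0 R, P e] reads "P e for e
   small". *)
Definition idx (R : realType) := {e : R | (0 < e <= 1)%R}.

HB.instance Definition _ (R : realType) := Choice.on (idx R).

Lemma idx1_subproof (R : realType) : (0 < (1 : R) <= 1)%R.
Proof. by rewrite ltr01 lexx. Qed.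

HB.instance Definition _ (R : realType) :=
  isPointed.Build (idx R) (exist _ 1%R (idx1_subproof R)).

Definition eps0 (R : realType) : set_system (idx R) :=
  [set P | exists e0 : idx R, forall e : idx R, \val e <= \val e0 -> P e].

Arguments eps0 R : clear implicits.

#[global] Instance eps0_filter (R : realType) : ProperFilter (eps0 R).
Proof.
split; first by move=> [e0 /(_ e0 (lexx _))].
split.
- by exists point.
- move=> P Q [a Pa] [b Qb]; have [ab|/ltW ba] := leP (\val a) (\val b).
    by exists a => e ea; split; [exact: Pa | exact/Qb/(le_trans ea)].
  by exists b => e eb; split; [exact/Pa/(le_trans eb) | exact: Qb].
- by move=> P Q PQ [a Pa]; exists a => e /Pa /PQ.
Qed.

Record gauge (R : realType) := Gauge {
  gauge_net :> idx R -> R;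
  gauge_itv : forall e, 0 < gauge_net e <= 1;
  gauge_cvg0 : gauge_net @ eps0 R --> (0 : R) }.

Section GeneralizedNumbers.
Context {R : realType} (rho : gauge R).

Definition moderate : {pred idx R -> R} := fun u =>
  `[< exists N : nat, \forall e \near eps0 R, `|u e| <= rho e ^- N >].

Definition net_equiv (u v : idx R -> R) : Prop :=
  forall n : nat, \forall e \near eps0 R, `|u e - v e| <= rho e ^+ n.

Lemma gauge_gt0 e : 0 < rho e.
Proof. by have /andP[] := gauge_itv rho e. Qed.

Lemma gauge_le1 e : rho e <= 1.
Proof. by have /andP[] := gauge_itv rho e. Qed.

Lemma gauge_small (r : R) : 0 < r -> \forall e \near eps0 R, rho e < r.
Proof.
move=> r0; have /cvgrPdist_lt/(_ r r0) := @gauge_cvg0 R rho.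
by apply: filterS => e; rewrite sub0r normrN ger0_norm// ltW// gauge_gt0.
Qed.

Lemma gauge_double n e : rho e < 2^-1 -> rho e ^+ n.+1 *+ 2 <= rho e ^+ n.
Proof.
move=> h; rewrite exprS -mulrnAl ger_pMl ?exprn_gt0 ?gauge_gt0//.
by rewrite -mulr_natr -ler_pdivlMr// mul1r ltW.
Qed.

Lemma gauge_expV_le (N M : nat) e : (N <= M)%N -> rho e ^- N <= rho e ^- M.
Proof.
move=> NM; rewrite lef_pV2 ?posrE ?exprn_gt0 ?gauge_gt0//.
by apply: ler_wiXn2l; rewrite ?gauge_le1// ltW// gauge_gt0.
Qed.

Lemma moderate_subring : subring_closed moderate.
Proof.
split; first by apply/asboolP; exists 0%N; near=> e; rewrite expr0 invr1 normr1.
- move=> u v /asboolP[N uN] /asboolP[M vM]; apply/asboolP.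
  exists (maxn N M).+1; near=> e.
  have uNe : `|u e| <= rho e ^- maxn N M.
    by apply: (@le_trans _ _ (rho e ^- N)); [near: e | rewrite gauge_expV_le ?leq_maxl].
  have vMe : `|v e| <= rho e ^- maxn N M.
    by apply: (@le_trans _ _ (rho e ^- M)); [near: e | rewrite gauge_expV_le ?leq_maxr].
  apply: (le_trans (ler_normB _ _)); apply: (le_trans (lerD uNe vMe)).
  rewrite -mulr2n -mulr_natr -ler_pdivlMl ?invr_gt0 ?exprn_gt0 ?gauge_gt0//.
  rewrite invrK exprS invfM mulrCA mulfV ?gt_eqF ?exprn_gt0 ?gauge_gt0// mulr1.
  rewrite -[leLHS]invrK lef_pV2 ?posrE ?invr_gt0 ?gauge_gt0//.
  by apply/ltW; near: e; apply: gauge_small; rewrite invr_gt0.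
- move=> u v /asboolP[N uN] /asboolP[M vM]; apply/asboolP.
  exists (N + M)%N; near=> e.
  by rewrite normrM exprD invfM ler_pM//; near: e.
Unshelve. all: by end_near. Qed.

HB.instance Definition _ :=
  GRing.isSubringClosed.Build (idx R -> R) moderate moderate_subring.

Definition modnet := {u : idx R -> R | u \in moderate}.

HB.instance Definition _ := SubChoice.on modnet.
HB.instance Definition _ :=
  [SubChoice_isSubComNzRing of modnet by <:].

Definition negligible : {pred modnet} := fun u => `[< net_equiv (\val u) 0 >].

Lemma negligible_ideal : idealr_closed negligible.
Proof.
split.
- apply/asboolP => n; near=> e.
  by rewrite subrr normr0 exprn_ge0 // ltW // gauge_gt0.
- apply/asboolP => /(_ 1%N) h.
  have [e [h1 h2]] := @filter_ex _ _ (eps0_filter R) _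
    (@filterI _ _ _ _ _ h (gauge_small ltr01)).
  by move: h1; rewrite /= subr0 normr1 expr1 leNgt h2.
- move=> a u v /asboolP u0 /asboolP v0; apply/asboolP => n.
  have /asboolP[N aN] := valP a; near=> e.
  rewrite /= subr0; apply: (le_trans (ler_normD _ _)).
  apply: le_trans (gauge_double n _); last first.
    by near: e; apply: gauge_small; rewrite invr_gt0.
  rewrite mulr2n lerD//.
    rewrite normrM; have -> : rho e ^+ n.+1 = rho e ^- N * rho e ^+ (N + n.+1).
      by rewrite exprD mulKf // gt_eqF// exprn_gt0 // gauge_gt0.
    rewrite ler_pM//; first by near: e.
    by rewrite -[X in `|X|]subr0; near: e; apply: u0.
  by rewrite -[X in `|X|]subr0; near: e; apply: v0.
Unshelve. all: by end_near. Qed.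

HB.instance Definition _ := isIdealr.Build modnet negligible negligible_ideal.

(* moderate nets modulo negligible ones; the inverse of a non-invertible
   number is itself, as for any unitRingType *)
Definition gnum : Type := {ideal_quot negligible}.

HB.instance Definition _ := GRing.ComNzRing.on gnum.
HB.instance Definition _ := NzRingQuotient.on gnum.

Definition gnum_unit : {pred gnum} := fun x => `[< exists y, y * x = 1 >].
Definition gnum_inv (x : gnum) : gnum := xget x [set y | y * x = 1].

Lemma gnum_mulVx : {in gnum_unit, left_inverse 1 gnum_inv *%R}.
Proof. by move=> x /asboolP; rewrite /gnum_inv; case: xgetP => // + [y]; move=> /(_ y). Qed.

Lemma gnum_unitPl x y : y * x = 1 -> gnum_unit x.
Proof. by move=> yx; apply/asboolP; exists y. Qed.

Lemma gnum_inv_out : {in [predC gnum_unit], gnum_inv =1 id}.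
Proof.
move=> x /asboolP nx; rewrite /gnum_inv; case: xgetP => // y _ yx.
by case: nx; exists y.
Qed.

HB.instance Definition _ := GRing.ComNzRing_hasMulInverse.Build gnum
  gnum_mulVx gnum_unitPl gnum_inv_out.

End GeneralizedNumbers.

Arguments moderate {R} rho.

Section GSF.
Context {R : realType} {rho : gauge R}.
Local Notation gnum := (gnum rho).

(* [u] is a representative of [x], i.e. x = [u_e] *)
Definition is_rep (u : idx R -> R) (x : gnum) : Prop :=
  exists w : modnet rho, \val w = u /\ \pi_gnum w = x.

(* Moderateness and equivalence of nets in R^n are componentwise, so that
   'rV[gnum]_n is the set of classes of moderate nets in R^n. *)
Definition is_repv n (u : idx R -> 'rV[R]_n) (x : 'rV[gnum]_n) : Prop :=
  forall i, is_rep (fun e => u e 0 i) (x 0 i).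

(* The order of generalized numbers is partial, and [glt] is not the strict
   order associated to [gle]: the difference has to be invertible. *)
Definition gle (x y : gnum) : Prop :=
  exists u v, [/\ is_rep u x, is_rep v y & forall e, u e <= v e].

Definition glt (x y : gnum) : Prop := gle x y /\ y - x \is a GRing.unit.

Definition gitv (a b : gnum) : set gnum := [set x | gle a x /\ gle x b].

Definition enorm n (v : 'rV[R]_n) : R := Num.sqrt (\sum_i v 0 i ^+ 2).

Definition gnorm n (x : 'rV[gnum]_n) : gnum :=
  xget 0 [set y | exists2 u, is_repv u x & is_rep (fun e => enorm (u e)) y].

Definition sball n (c : 'rV[gnum]_n) (r : gnum) : set 'rV[gnum]_n :=
  [set x | glt (gnorm (x - c)) r].

Definition sint n (A : set 'rV[gnum]_n) : set 'rV[gnum]_n :=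
  [set c | exists2 r, glt 0 r & sball c r `<=` A].

Definition sopen n (A : set 'rV[gnum]_n) : Prop := A `<=` sint A.

(* iterated partial derivative; the multi-index alpha is given as the list of
   the coordinates of differentiation, with repetitions *)
Definition pd n k (alpha : seq 'I_n) (f : 'rV[R]_n -> 'rV[R]_k) :
    'rV[R]_n -> 'rV[R]_k :=
  foldr (fun i g => 'D_(delta_mx 0 i) g) f alpha.

Definition smooth_on n k (Om : set 'rV[R]_n) (f : 'rV[R]_n -> 'rV[R]_k) :=
  forall (alpha : seq 'I_n) x, Om x ->
    {for x, continuous (pd alpha f)} /\
    forall i, derivable (pd alpha f) x (delta_mx 0 i).

(* the set <Om_e> *)
Definition strongly_internal n (Om : idx R -> set 'rV[R]_n) :
    set 'rV[gnum]_n :=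
  [set x | forall u, is_repv u x -> \forall e \near eps0 R, Om e (u e)].

(* Maps defined on a subset X of 'rV[gnum]_n are total functions whose values
   outside X are irrelevant. *)
Definition defines n k (X : set 'rV[gnum]_n) (Om : idx R -> set 'rV[R]_n)
    (fe : idx R -> 'rV[R]_n -> 'rV[R]_k) (f : 'rV[gnum]_n -> 'rV[gnum]_k) :=
  [/\ forall e, open (Om e) /\ smooth_on (Om e) (fe e),
      X `<=` strongly_internal Om &
      forall x u, X x -> is_repv u x ->
        is_repv (fun e => fe e (u e)) (f x) /\
        forall alpha, (fun e => enorm (pd alpha (fe e) (u e))) \in moderate rho].

Definition gsf n k (X : set 'rV[gnum]_n) (Y : set 'rV[gnum]_k)
    (f : 'rV[gnum]_n -> 'rV[gnum]_k) : Prop :=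
  (exists Om fe, defines X Om fe f) /\ f @` X `<=` Y.

(* "y is the derivative of order alpha of f : X -> 'rV_k at x".  At sharply
   interior points it is the class [pd alpha f_e (x_e)], for a net f_e defining
   f; at the other points it is the sharp limit from the interior points.
   The total function [gpd] below takes the junk value 0 where there is no such
   y, whereas [is_gpd] also asserts that the derivative exists. *)
Definition is_gpd_int n k (X : set 'rV[gnum]_n) (alpha : seq 'I_n)
    (f : 'rV[gnum]_n -> 'rV[gnum]_k) x y : Prop :=
  exists Om fe u, [/\ defines X Om fe f, is_repv u x &
    is_repv (fun e => pd alpha (fe e) (u e)) y].

Definition is_gpd n k (X : set 'rV[gnum]_n) (alpha : seq 'I_n)
    (f : 'rV[gnum]_n -> 'rV[gnum]_k) (x : 'rV[gnum]_n) (y : 'rV[gnum]_k) :=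
  (sint X x /\ is_gpd_int X alpha f x y) \/
  (~ sint X x /\
   forall r, glt 0 r -> exists2 delta, glt 0 delta &
     forall z, sint X z -> sball x delta z ->
       exists2 w, is_gpd_int X alpha f z w & sball y r w).

Definition gpd n k (X : set 'rV[gnum]_n) (alpha : seq 'I_n)
    (f : 'rV[gnum]_n -> 'rV[gnum]_k) (x : 'rV[gnum]_n) : 'rV[gnum]_k :=
  xget 0 (is_gpd X alpha f x).

(* A scalar t is identified with the vector t%:M of 'rV_1. *)
Definition gset1 (X : set gnum) : set 'rV[gnum]_1 := [set z | X (z 0 0)].

Definition gfun1 T (f : gnum -> T) (z : 'rV[gnum]_1) : T := f (z 0 0).

Definition gscalar T (f : T -> gnum) (z : T) : 'rV[gnum]_1 := (f z)%:M.

Definition is_gder k (X : set gnum) (i : nat) (f : gnum -> 'rV[gnum]_k)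
    (t : gnum) (y : 'rV[gnum]_k) : Prop :=
  is_gpd (gset1 X) (nseq i 0) (gfun1 f) t%:M y.

Definition gder k (X : set gnum) (i : nat) (f : gnum -> 'rV[gnum]_k)
    (t : gnum) : 'rV[gnum]_k :=
  gpd (gset1 X) (nseq i 0) (gfun1 f) t%:M.

(* A product of a set of scalars and a set of vectors lives in 'rV_(1 + n). *)
Definition gprod n (X : set gnum) (Y : set 'rV[gnum]_n) :
    set 'rV[gnum]_(1 + n) :=
  [set z | X (lsubmx z 0 0) /\ Y (rsubmx z)].

Definition gfun2 n T (f : gnum -> 'rV[gnum]_n -> T) (z : 'rV[gnum]_(1 + n)) : T :=
  f (lsubmx z 0 0) (rsubmx z).

Definition oint (a b : R) (f : R -> R) : R :=
  if a <= b then \int[lebesgue_measure]_(x in `[a, b]) f x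
  else - \int[lebesgue_measure]_(x in `[b, a]) f x.

(* integral from c to e of the function f on [a, b]; f_e is smooth on all of R *)
Definition gint (a b : gnum) (f : gnum -> gnum) (c e : gnum) : gnum :=
  xget 0 [set y | exists fe ce ee,
    [/\ defines (gset1 (gitv a b)) (fun=> setT) fe (gfun1 (gscalar f)),
        is_rep ce c, is_rep ee e &
        is_rep (fun k => oint (ce k) (ee k) (fun s => fe k s%:M 0 0)) y]].

Definition one_parameter_group n (P : set gnum) (D : set 'rV[gnum]_n)
    (psi : gnum -> 'rV[gnum]_n -> 'rV[gnum]_n) : Prop :=
  [/\ sopen (gset1 P) /\ P 0,
      gsf (gprod P D) D (gfun2 psi),
      forall s, P s -> gsf D D (psi s) /\ exists2 psiV, gsf D D psiV &
        forall x, D x -> psiV (psi s x) = x /\ psi s (psiV x) = x,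
      forall x, D x -> psi 0 x = x &
      forall s s', P s -> P s' -> P (s + s') ->
        forall x, D x -> psi s (psi s' x) = psi (s + s') x].

End GSF.

Section Variational.
Context {R : realType} {rho : gauge R} {d m : nat}.
Local Notation gnum := (gnum rho).
Implicit Types (s t : gnum) (q h : gnum -> 'rV[gnum]_d).

(* The second argument of a Lagrangian is the matrix whose i-th row is the
   R^d-argument into which the i-th derivative of q is inserted. *)
Definition lagrangian := gnum -> 'M[gnum]_(m.+1, d) -> gnum.

Context (t1 t2 : gnum) (L : lagrangian).

Definition lagr_fun : 'rV[gnum]_(1 + m.+1 * d) -> 'rV[gnum]_1 :=
  gscalar (gfun2 (fun t v => L t (vec_mx v))).

Definition lagr_dom : set 'rV[gnum]_(1 + m.+1 * d) :=
  gprod (gitv t1 t2) setT.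

(* gradient of L in the i-th R^d-argument *)
Definition lagr_grad (i : nat) (t : gnum) (v : 'M[gnum]_(m.+1, d)) :
    'rV[gnum]_d :=
  \row_k gpd lagr_dom [:: rshift 1 (mxvec_index (inord i) k)]
    lagr_fun (row_mx t%:M (mxvec v)) 0 0.

Definition jet q t : 'M[gnum]_(m.+1, d) :=
  \matrix_(i, k) gder (gitv t1 t2) i q t 0 k.

Definition Lq q t : gnum := L t (jet q t).

Definition action q : gnum := gint t1 t2 (Lq q) t1 t2.

Definition phi (j : nat) q t : 'rV[gnum]_d :=
  \sum_(i < (m - j).+1) (-1) ^+ i *:
    gder (gitv t1 t2) i (fun u => lagr_grad (i + j) u (jet q u)) t.

Definition gsf_curve (Y : set 'rV[gnum]_d) q : Prop :=
  gsf (gset1 (gitv t1 t2)) Y (gfun1 q).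

Definition admissible_variation h : Prop :=
  gsf_curve setT h /\
  forall i, (i < m)%N ->
    gder (gitv t1 t2) i h t1 = 0 /\ gder (gitv t1 t2) i h t2 = 0.

Definition first_variation q h : gnum :=
  gder setT 1 (gscalar (fun s => action (fun t => q t + s *: h t)))
    0 0 0.

Definition weak_extremal q : Prop :=
  gsf_curve setT q /\
  forall h, admissible_variation h -> first_variation q h = 0.

Section Symmetry.
Context (P T' : set gnum) (S' : set 'rV[gnum]_d) (tau : gnum -> gnum -> gnum)
  (sigma : gnum -> 'rV[gnum]_d -> 'rV[gnum]_d).

Definition vtau (s : gnum) : 'rV[gnum]_1 -> 'rV[gnum]_1 :=
  gfun1 (gscalar (tau s)).

Definition dtau (i : 'I_(1 + 1)) (s t : gnum) : gnum :=
  gpd (gprod P (gset1 T')) [:: i] (gfun2 vtau) (row_mx s%:M t%:M) 0 0.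

Definition tau_s := dtau (lshift 1 0).
Definition tau_t := dtau (rshift 1 0).

Definition sigma_s (s : gnum) (x : 'rV[gnum]_d) : 'rV[gnum]_d :=
  gpd (gprod P S') [:: lshift d 0] (gfun2 sigma) (row_mx s%:M x).

Fixpoint dsigma_dtau q (i : nat) (s t : gnum) : 'rV[gnum]_d :=
  if i is i'.+1 then (tau_t s t)^-1 *: gder T' 1 (dsigma_dtau q i' s) t
  else sigma s (q t).

Definition invariant_action : Prop :=
  forall q, weak_extremal q -> gsf_curve S' q ->
  forall s t, P s -> T' t ->
    Lq q t =
    L (tau s t) (\matrix_(i, k) dsigma_dtau q i s t 0 k) * tau_t s t.

Fixpoint eta q (i : nat) (t : gnum) : 'rV[gnum]_d :=
  if i is i'.+1 then
    gder T' 1 (eta q i') t -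
    gder T' 1 (gscalar (tau_s 0)) t 0 0 *: gder (gitv t1 t2) i q t
  else sigma_s 0 (q t).

Definition dot (a b : 'rV[gnum]_d) : gnum := \sum_k a 0 k * b 0 k.

Definition noether q (t : gnum) : gnum :=
  \sum_(1 <= i < m.+1) dot (phi i q t) (eta q i.-1 t) +
  (Lq q t -
   \sum_(1 <= i < m.+1) dot (phi i q t) (gder (gitv t1 t2) i q t)) *
  tau_s 0 t.

End Symmetry.
End Variational.

(* Main.v *)
Require Import Defs.
From HB Require Import structures.
From mathcomp Require Import all_boot all_order all_algebra.
From mathcomp Require Import generic_quotient ring_quotient.
From mathcomp Require Import all_classical all_reals all_analysis.
From mathcomp Require Import zify ring lra.

Set Implicit Arguments.
Unset Strict Implicit.
Unset Printing Implicit Defensive.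

Import Order.TTheory GRing.Theory Num.Theory.
Import numFieldNormedType.Exports.

Local Open Scope classical_set_scope.
Local Open Scope ring_scope.
Local Open Scope quotient_scope.

(** The argument is the classical one: Noether's theorem is the Euler-Lagrange
equation combined with the invariance identity differentiated at s = 0.

Euler-Lagrange. The momenta phi^j satisfy
(phi^(j+1))' = d_(j+2) L[q] - phi^j (cder_phi). Hence the derivative of
sum_j phi^j . h^(j-1) telescopes to sum_i d_(i+2) L[q] . h^(i) - phi^0 . h
(cder_phi_sum), and the first variation of J at an admissible h is the integral of
phi^0 . h. Instead of localizing with bump functions, one tests with
h = w^2 phi^0, where w = ((t - t1) (t2 - t))^m: the integrand is then the sum of
squares |w phi^0|^2, and a nonnegative generalized function with integral zero is
zero (gint_eq0). So phi^0 vanishes wherever (t - t1) (t2 - t) is invertible, in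
particular on the open set T' (euler_lagrange).

Invariance. The i-th derivative of sigma(s, q) with respect to tau(s, .) equals
q^(i) at s = 0, and its s-derivative there is eta^i; the latter is an induction on i
that exchanges the s- and t-derivatives (eta_dsigma). Differentiating the
invariance identity at s = 0 gives, with xi = (d tau / ds)(0, .),
d_1 L[q] xi + sum_i d_(i+2) L[q] . eta^i + L[q] xi' = 0 (invariance_derived). The
same telescoping shows that the derivative of C[q] is the left-hand side of this
identity minus phi^0 . (eta^0 - xi q'), hence zero (cder_noether).

What has to be added in the generalized setting is a calculus of derivatives that
does not see nets. It is built on the relation sgrad X f g: one net represents f
on X and its partial derivatives represent the g_i. This relation satisfies all
rules of differentiation, including the chain rule, because moderateness of all
derivatives is a coinductive property (mnet_coind, alg_mnet). Three facts connect
it to the derivatives gpd and to the integral.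
- Uniformity: a bound by some power of the gauge that holds at all points of X
  holds uniformly on suitable nets of sets, since otherwise a diagonal choice of
  bad values would be a point of X violating it (diagonal_net, uniform_bound,
  lipschitz_bound).
- Independence of the net: a net with negligible values on X has negligible
  derivatives in the interior, by a difference quotient with a step that is a high
  power of the gauge (pder_negligible). On an interval, Lipschitz bounds carry the
  derivatives of a net over to the boundary, where they are the sharp limits
  (slab_regular).
- Integrals: up to a negligible error a net on neighbourhoods of [t1, t2] extends
  smoothly to the real line (extension_exists), so that integrals can be computed
  with any net (gintE), and differentiated in a parameter (gint_derive). *)

(** * Representatives of generalized numbers *)

Section NetArithmetic.
Context {R : realType} {rho : gauge R}.
Implicit Types (u v w : idx R -> R) (x y z : gnum rho).

Lemma gexp_gt0 n e : 0 < rho e ^+ n.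
Proof. by rewrite exprn_gt0// gauge_gt0. Qed.

Lemma gexpV_gt0 n e : 0 < rho e ^- n.
Proof. by rewrite invr_gt0 gexp_gt0. Qed.

Lemma gexp_le m n e : (m <= n)%N -> rho e ^+ n <= rho e ^+ m.
Proof. by move=> mn; rewrite ler_wiXn2l// ?gauge_le1// ltW// gauge_gt0. Qed.

Lemma gexp_le1 n e : rho e ^+ n <= 1.
Proof. by rewrite -(expr0 (rho e)) gexp_le. Qed.

(** A constant is dominated by a negative power of the gauge, so every constant
factor in an estimate costs a single power of rho; this is what makes the
powers of rho a convenient currency below. *)
Lemma near_gauge_natr (N : nat) : \forall e \near eps0 R, N%:R <= rho e ^- 1.
Proof.
have h := @gauge_small R rho (N.+1%:R^-1); near=> e.
rewrite (@le_trans _ _ N.+1%:R) ?ler_nat//.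
rewrite expr1 -[leLHS]invrK lef_pV2 ?posrE ?gauge_gt0 ?invr_gt0 ?ltr0n//.
by apply/ltW; near: e; apply: h; rewrite invr_gt0 ltr0n.
Unshelve. all: by end_near. Qed.

Lemma natr_gexp (N : nat) n : \forall e \near eps0 R,
  N%:R * rho e ^+ n.+1 <= rho e ^+ n.
Proof.
near=> e; rewrite exprS mulrA ger_pMl ?gexp_gt0// -ler_pdivlMr ?gauge_gt0//.
by rewrite div1r -[_^-1]/(_ ^- 1); near: e; apply: near_gauge_natr.
Unshelve. all: by end_near. Qed.

Lemma moderateP u :
  u \in moderate rho <-> exists N, \forall e \near eps0 R, `|u e| <= rho e ^- N.
Proof. by split=> [/asboolP//|h]; apply/asboolP. Qed.

Lemma near_moderate u v : (\forall e \near eps0 R, `|v e| <= `|u e|) ->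
  u \in moderate rho -> v \in moderate rho.
Proof.
move=> vu /moderateP[N uN]; apply/moderateP; exists N; near=> e.
by rewrite (@le_trans _ _ `|u e|)//; near: e.
Unshelve. all: by end_near. Qed.

Lemma rep_moderate u x : is_rep u x -> u \in moderate rho.
Proof. by move=> [w [<- _]]; exact: valP. Qed.

Lemma moderate_rep u : u \in moderate rho -> exists x, is_rep u x.
Proof. by move=> mu; exists (\pi_(gnum rho) (exist _ u mu)); exists (exist _ u mu). Qed.

Lemma rep_exists x : exists u, is_rep u x.
Proof.
exists (\val (repr x)); exists (repr x); split => //; exact: reprK.
Qed.

Lemma negligibleP (w : modnet rho) :
  w \in @Defs.negligible R rho <-> net_equiv rho (\val w) 0.
Proof. by split=> [/asboolP//|h]; apply/asboolP. Qed.

Lemma rep_eqP u v x y : is_rep u x -> is_rep v y -> (x = y <-> net_equiv rho u v).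
Proof.
move=> [w [<- <-]] [w' [<- <-]].
have -> : (w = w' %[mod gnum rho]) <-> w - w' \in @Defs.negligible R rho.
  by rewrite Quotient.idealrBE; exact: (rwP eqP).
by rewrite negligibleP; split=> h n; apply: filterS (h n) => e /=; rewrite subr0.
Qed.

Lemma rep_equiv u v x : is_rep u x -> net_equiv rho u v -> is_rep v x.
Proof.
move=> ux uv; have mv : v \in moderate rho.
  rewrite (_ : v = u - (u - v)); last by apply/funext => e /=; rewrite opprB addrC subrK.
  apply: rpredB (rep_moderate ux) _; apply/moderateP; exists 0%N.
  by apply: filterS (uv 0%N) => e; rewrite expr0 invr1.
have [y vy] := moderate_rep mv.
by rewrite ((rep_eqP ux vy).2 uv).
Qed.

Lemma near_rep u v x : (\forall e \near eps0 R, u e = v e) -> is_rep u x -> is_rep v x.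
Proof.
move=> uv ux; apply: (rep_equiv ux) => n; apply: filterS uv => e ->.
by rewrite subrr normr0 ltW// gexp_gt0.
Qed.

Lemma rep_inj u x y : is_rep u x -> is_rep u y -> x = y.
Proof.
move=> ux uy; apply/(rep_eqP ux uy) => n; apply: nearW => e.
by rewrite subrr normr0 ltW// gexp_gt0.
Qed.

Lemma repD u v x y : is_rep u x -> is_rep v y -> is_rep (fun e => u e + v e) (x + y).
Proof. by move=> [w [<- <-]] [w' [<- <-]]; exists (w + w'); split=> //; exact: raddfD. Qed.

Lemma repN u x : is_rep u x -> is_rep (fun e => - u e) (- x).
Proof. by move=> [w [<- <-]]; exists (- w); split=> //; exact: raddfN. Qed.

Lemma repB u v x y : is_rep u x -> is_rep v y -> is_rep (fun e => u e - v e) (x - y).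
Proof. by move=> ux vy; apply: repD => //; apply: repN. Qed.

Lemma repM u v x y : is_rep u x -> is_rep v y -> is_rep (fun e => u e * v e) (x * y).
Proof. by move=> [w [<- <-]] [w' [<- <-]]; exists (w * w'); split=> //; exact: rmorphM. Qed.

Lemma rep0 : is_rep (fun=> 0) (0 : gnum rho).
Proof. by exists 0; split=> //; exact: raddf0. Qed.

Lemma rep1 : is_rep (fun=> 1) (1 : gnum rho).
Proof. by exists 1; split=> //; exact: rmorph1. Qed.

Lemma rep_nat n : is_rep (fun=> n%:R) (n%:R : gnum rho).
Proof.
elim: n => [|n ih]; first exact: rep0.
by rewrite -addn1 !natrD; apply: (repD ih rep1).
Qed.

Lemma repX u x n : is_rep u x -> is_rep (fun e => u e ^+ n) (x ^+ n).
Proof.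
move=> ux; elim: n => [|n ih]; first exact: rep1.
rewrite exprS; under eq_fun do rewrite exprS; exact: repM.
Qed.

Lemma rep_sum (I : Type) (r : seq I) (P : pred I) (F : I -> idx R -> R)
    (f : I -> gnum rho) : (forall i, is_rep (F i) (f i)) ->
  is_rep (fun e => \sum_(i <- r | P i) F i e) (\sum_(i <- r | P i) f i).
Proof.
move=> Ff; elim: r => [|i r ih].
  by rewrite big_nil; under eq_fun do rewrite big_nil; exact: rep0.
rewrite big_cons; under eq_fun do rewrite big_cons.
by case: (P i) => //; exact: repD.
Qed.

Lemma rep_zeroP u x : is_rep u x ->
  (x = 0 <-> forall n, \forall e \near eps0 R, `|u e| <= rho e ^+ n).
Proof.
move=> ux; rewrite (rep_eqP ux rep0).
by split=> h n; apply: filterS (h n) => e; rewrite subr0.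
Qed.

(** A representative cannot be compared with another one pointwise, but only up
to every power of the gauge; conversely, cutting one of the two
representatives off at the other one changes it by a negligible net. *)
Lemma gleP u v x y : is_rep u x -> is_rep v y ->
  (gle x y <-> forall n, \forall e \near eps0 R, u e <= v e + rho e ^+ n).
Proof.
move=> ux vy; split=> [[u' [v' [u'x v'y uv]]] n|h].
  have uu := (rep_eqP ux u'x).1 erefl n.+1.
  have vv := (rep_eqP vy v'y).1 erefl n.+1.
  near=> e; have : `|u e - u' e| <= rho e ^+ n.+1 by near: e.
  have : `|v e - v' e| <= rho e ^+ n.+1 by near: e.
  rewrite !ler_distl => /andP[v1 v2] /andP[u1 u2].
  have := uv e; have : 2%:R * rho e ^+ n.+1 <= rho e ^+ n by near: e; apply: natr_gexp.
  lra.
exists (fun e => Num.min (u e) (v e)), v; split => //; last first.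
  by move=> e; rewrite ge_min lexx orbT.
apply: (rep_equiv ux) => n; apply: filterS (h n) => e.
have [uv _|vu h'] := leP (u e) (v e).
  by rewrite subrr normr0 ltW// gexp_gt0.
by rewrite ger0_norm; lra.
Unshelve. all: by end_near. Qed.

(** If x has an inverse v, then the product of representatives is eventually
larger than rho in absolute value while v is moderate, which bounds x from
below by a power of rho. Conversely such a bound makes the net of inverses
moderate. *)
Lemma unitP u x : is_rep u x ->
  (x \is a GRing.unit <-> exists K, \forall e \near eps0 R, rho e ^+ K <= `|u e|).
Proof.
move=> ux; split=> [xU|[K uK]].
  have [v vx] := rep_exists x^-1.
  have /moderateP[N vN] := rep_moderate vx.
  have := (rep_eqP (repM vx ux) rep1).1 (mulVr xU) 1%N => h.
  exists N.+1; near=> e.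
  have h1 : `|v e * u e - 1| <= rho e ^+ 1 by near: e.
  have h2 : `|v e| <= rho e ^- N by near: e.
  have h3 : rho e < 2^-1 by near: e; apply: gauge_small; rewrite invr_gt0.
  have h4 : rho e <= `|v e * u e|.
    move: h1; rewrite expr1 => h1.
    have : 1 - `|v e * u e - 1| <= `|v e * u e|.
      by have := ler_normD (v e * u e) (- (v e * u e - 1)); rewrite normrN opprB addrC subrK normr1 => ?; lra.
    lra.
  have h5 : rho e <= rho e ^- N * `|u e|.
    by rewrite (le_trans h4)// normrM ler_wpM2r.
  by rewrite exprS mulrC -ler_pdivlMl ?gexp_gt0.
pose v e := (u e)^-1.
have mv : v \in moderate rho.
  apply/moderateP; exists K; near=> e; rewrite /v normfV lef_pV2 ?posrE ?gexp_gt0//.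
    by near: e.
  by rewrite (lt_le_trans (gexp_gt0 K e))//; near: e.
have [y vy] := moderate_rep mv.
suff yx1 : y * x = 1 by apply/unitrP; exists y; rewrite [x * y]mulrC.
apply: (rep_inj (repM vy ux)); apply: near_rep rep1; near=> e.
rewrite /v mulVf// -normr_gt0 (lt_le_trans (gexp_gt0 K e))//; near: e; exact: uK.
Unshelve. all: by end_near. Qed.

Lemma unit_rep_neq0 u x : is_rep u x -> x \is a GRing.unit ->
  \forall e \near eps0 R, u e != 0.
Proof.
move=> ux /(unitP ux)[K uK]; apply: filterS uK => e h.
by rewrite -normr_gt0 (lt_le_trans (gexp_gt0 K e)).
Qed.

Lemma repV u x : is_rep u x -> x \is a GRing.unit -> is_rep (fun e => (u e)^-1) x^-1.
Proof.
move=> ux xU; have [v vx] := rep_exists x^-1.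
have [K uK] := (unitP ux).1 xU.
have mv : (fun e => (u e)^-1) \in moderate rho.
  apply/moderateP; exists K; near=> e; rewrite normfV lef_pV2 ?posrE ?gexp_gt0//.
    by near: e.
  by rewrite (lt_le_trans (gexp_gt0 K e))//; near: e.
have [y uy] := moderate_rep mv.
suff -> : x^-1 = y by [].
apply: (mulrI xU); rewrite divrr//; apply: rep_inj (repM ux uy).
apply: near_rep rep1; near=> e; rewrite mulfV//.
by near: e; exact: unit_rep_neq0 xU.
Unshelve. all: by end_near. Qed.

Lemma gltP u v x y : is_rep u x -> is_rep v y ->
  (glt x y <-> exists K, \forall e \near eps0 R, u e + rho e ^+ K <= v e).
Proof.
move=> ux vy; split=> [[/(gleP ux vy) uv /(unitP (repB vy ux))[K hK]]|[K hK]].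
  exists K; near=> e.
  have h1 : u e <= v e + rho e ^+ K.+1 by near: e.
  have h2 : rho e ^+ K <= `|v e - u e| by near: e.
  have h3 : 2%:R * rho e ^+ K.+1 <= rho e ^+ K by near: e; apply: natr_gexp.
  have h4 := gexp_gt0 K.+1 e; have h5 := gexp_gt0 K e.
  move: h2; rewrite ler_normr => /orP[]; lra.
split.
  apply/(gleP ux vy) => n; near=> e.
  have h : u e + rho e ^+ K <= v e by near: e.
  have h4 := gexp_gt0 K e; have h5 := gexp_gt0 n e; lra.
apply/(unitP (repB vy ux)); exists K; near=> e.
have h : u e + rho e ^+ K <= v e by near: e.
by rewrite ler_normr; apply/orP; left; lra.
Unshelve. all: by end_near. Qed.

Lemma gexp_moderate n : (fun e => rho e ^+ n) \in moderate rho.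
Proof.
apply/moderateP; exists 0%N; apply: nearW => e.
by rewrite expr0 invr1 ger0_norm ?gexp_le1// ltW// gexp_gt0.
Qed.

Lemma gexpV_moderate n : (fun e => rho e ^- n) \in moderate rho.
Proof.
apply/moderateP; exists n; apply: nearW => e.
by rewrite ger0_norm// ltW// gexpV_gt0.
Qed.

Lemma moderate_sum (I : Type) (r : seq I) (P : pred I) (F : I -> idx R -> R) :
  (forall i, F i \in moderate rho) ->
  (fun e => \sum_(i <- r | P i) F i e) \in moderate rho.
Proof.
move=> Fm; elim: r => [|i r ih].
  by rewrite (_ : (fun=> _) = 0) ?rpred0//; apply/funext => e; rewrite big_nil.
under eq_fun do rewrite big_cons.
by case: (P i) => //; apply: rpredD.
Qed.

(** Each square is bounded by the sum of the squares, and the square root of a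
negligible net is negligible. *)
Lemma sqr_eq0_sum (I : finType) (f : I -> gnum rho) :
  \sum_i f i ^+ 2 = 0 -> forall i, f i = 0.
Proof.
have [F Ff] := choice (fun i => rep_exists (f i)).
have S := rep_sum (index_enum I) xpredT (fun i => repX 2 (Ff i)).
move=> /(rep_zeroP S) h i; apply/(rep_zeroP (Ff i)) => n.
apply: filterS (h (n * 2)%N) => e; rewrite exprM ger0_norm; last first.
  by apply: sumr_ge0 => j _; exact: sqr_ge0.
move=> {}h; rewrite -(ler_pXn2r (_ : 0 < 2)%N)// ?nnegrE ?(ltW (gexp_gt0 _ _))//.
rewrite real_normK ?num_real//; apply: le_trans h.
by rewrite (bigD1 i)//= lerDl sumr_ge0// => j _; exact: sqr_ge0.
Qed.

End NetArithmetic.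

(** * Differential calculus on row vectors *)

Section Differential.
Context {R : realType}.

Lemma rv_coord_le n (v : 'rV[R]_n) i : `|v 0 i| <= `|v|.
Proof. by rewrite [leRHS]/Num.Def.normr/= mx_normrE; exact: (le_bigmax _ _ (0, i)). Qed.

Lemma rv_norm_le n (v : 'rV[R]_n) c : 0 <= c -> (forall i, `|v 0 i| <= c) -> `|v| <= c.
Proof.
move=> c0 h; rewrite [leLHS]/Num.Def.normr/= mx_normrE; apply: bigmax_le => //.
by move=> [i j] _ /=; rewrite ord1.
Qed.

Lemma norm_delta n (i : 'I_n) : `|'e_i : 'rV[R]_n| <= 1.
Proof.
by apply: rv_norm_le => // j; rewrite mxE eqxx/=; case: (j == i); rewrite ?normr1 ?normr0.
Qed.

Lemma is_derive_line (V : normedModType R) (f : V -> R) y v t :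
  derivable f (y + t *: v) v ->
  is_derive t (1 : R) (fun t : R => f (y + t *: v)) ('D_v f (y + t *: v)).
Proof.
move=> df.
have E : (fun h : R => h^-1 *: (((fun t : R => f (y + t *: v)) \o shift t) (h *: 1) - f (y + t *: v)))
   = (fun h : R => h^-1 *: ((f \o shift (y + t *: v)) (h *: v) - f (y + t *: v))).
  apply/funext => h /=; congr (_ *: (f _ - _)).
  by rewrite [h *: 1]mulr1 scalerDl addrCA.
by apply: DeriveDef; rewrite /derivable /derive E.
Qed.

(** The increment c may have either sign, which saves a case distinction in each
later use. *)
Lemma mvt_line (V : normedModType R) (f : V -> R) y v (c : R) :
  (forall t : R, `|t| <= `|c| -> derivable f (y + t *: v) v) ->
  exists2 t : R, `|t| <= `|c| & f (y + c *: v) - f y = c * 'D_v f (y + t *: v).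
Proof.
move=> df.
have cts (a b : R) : (forall t : R, t \in `[a, b] -> `|t| <= `|c|) ->
    {within `[a, b], continuous (fun t : R => f (y + t *: v))}.
  move=> h; apply: derivable_within_continuous => t /h/df.
  by move=> /is_derive_line[].
have [c0|/ltW c0] := leP 0 c.
  have hc (t : R) : t \in `[0, c] -> `|t| <= `|c|.
    by rewrite in_itv/= => /andP[t0 tc]; rewrite !ger0_norm.
  have [t tc E] := MVT_segment c0
    (fun t tc => is_derive_line (df t (hc t (subset_itv_oo_cc tc)))) (cts _ _ hc).
  by exists t; [exact: hc|move: E; rewrite scale0r addr0 subr0 mulrC].
have hc (t : R) : t \in `[c, 0] -> `|t| <= `|c|.
  by rewrite in_itv/= => /andP[ct t0]; rewrite !ler0_norm// lerN2.
have [t tc E] := MVT_segment c0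
  (fun t tc => is_derive_line (df t (hc t (subset_itv_oo_cc tc)))) (cts _ _ hc).
exists t; first exact: hc.
move: E; rewrite scale0r addr0 sub0r mulrN => /eqP.
by rewrite -eqr_oppLR opprB => /eqP ->; rewrite mulrC.
Qed.

(** The increment of f between x and x + h is split along the coordinate axes,
through the points whose first k coordinates have already been moved; on
each of these segments the mean value theorem produces a partial derivative
close to the one at x. *)
Lemma C1_differentiable n (f : 'rV[R]_n -> R) x :
  (\forall y \near x, forall i, derivable f y 'e_i) ->
  (forall i, {for x, continuous ('D_('e_i) f)}) -> differentiable f x.
Proof.
move=> df cf.
pose L (h : 'rV[R]_n) : R := \sum_i h 0 i * 'D_('e_i) f x.
have Llin : linear L.
  move=> a u w; rewrite /L scaler_sumr -big_split/=; apply: eq_bigr => i _.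
  by rewrite !mxE mulrDl scalerAl.
pose LL := GRing.isLinear.Build _ _ _ _ L Llin.
pose Lm : {linear 'rV[R]_n -> R} := HB.pack L LL.
have cL : continuous Lm.
  move=> y; apply: differentiable_continuous.
  rewrite (_ : (Lm : _ -> _) = \sum_(i < n) (fun h : 'rV[R]_n => h 0 i *: 'D_('e_i) f x)).
    by apply: differentiable_sum => i; apply/differentiableZl/differentiable_coord.
  by apply/funext => h; rewrite fct_sumE.
have key : f \o shift x = cst (f x) + Lm +o_0 id.
  apply/eqaddoP => _/posnumP[eps].
  have e1 : 0 < eps%:num / (n.+1%:R) by rewrite divr_gt0.
  have : \forall y \near x, (forall i, derivable f y 'e_i) /\
      forall i, `|'D_('e_i) f x - 'D_('e_i) f y| <= eps%:num / n.+1%:R.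
    have c i : \forall y \near x, `|'D_('e_i) f x - 'D_('e_i) f y| <= eps%:num / n.+1%:R.
      by have /cvgrPdist_le := cf i; apply.
    exact: (filterI df (filter_forall _ c)).
  move=> /nbhs_ballP[r /= r0 hr].
  suff H (h : 'rV[R]_n) : `|h| < r ->
      `|(f \o shift x - (cst (f x) + Lm)) h| <= eps%:num * `|h|.
    by apply: filterS (nbhs0_lt r0) => h; exact: H.
  move=> hn.
  (* p k is h with only its first k coordinates kept, so that p 0 = 0 and p n = h. *)
  pose p (k : nat) : 'rV[R]_n := \row_i (if (i < k)%N then h 0 i else 0).
  have p0 : p 0%N = 0 by apply/rowP => i; rewrite !mxE.
  have pn : p n = h by apply/rowP => i; rewrite !mxE ltn_ord.
  have pS (k : 'I_n) : p k.+1 = p k + h 0 k *: 'e_k.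
    apply/rowP => i; rewrite !mxE eqxx/= ltnS leq_eqVlt -val_eqE/=.
    case: eqP => [ik|_] /=; last by rewrite mulr0 addr0.
    by rewrite ik ltnn add0r mulr1; congr (h _ _); exact: val_inj.
  have pin (k : 'I_n) (t : R) : `|t| <= `|h 0 k| -> ball x r (x + p k + t *: 'e_k).
    move=> tk; rewrite -ball_normE /ball_/= -addrA opprD addNKr normrN.
    apply: le_lt_trans hn; apply: rv_norm_le => // i; rewrite !mxE eqxx/=.
    case: (ltnP i k) => ik.
      by rewrite -val_eqE/= (ltn_eqF ik) mulr0 addr0 rv_coord_le.
    rewrite add0r; case: (i == k); last by rewrite mulr0 normr0.
    by rewrite mulr1 (le_trans tk)// rv_coord_le.
  have step (k : 'I_n) : `|f (x + p k.+1) - f (x + p k) - h 0 k * 'D_('e_k) f x|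
      <= eps%:num / n.+1%:R * `|h|.
    rewrite pS addrA.
    have [t tk ->] := @mvt_line _ f (x + p k) 'e_k (h 0 k) (fun t tk => (hr _ (pin k t tk)).1 k).
    rewrite -mulrBr normrM mulrC ler_pM ?rv_coord_le// distrC.
    exact: (hr _ (pin k t tk)).2.
  rewrite !fctE/= -[X in f X]addrC.
  have -> : f (x + h) - (f x + L h) =
      \sum_(k < n) (f (x + p k.+1) - f (x + p k) - h 0 k * 'D_('e_k) f x).
    rewrite big_split/= sumrN.
    have -> : \sum_(i < n) (f (x + p i.+1) - f (x + p i)) = f (x + h) - f x.
      rewrite -(big_mkord xpredT (fun i => f (x + p i.+1) - f (x + p i))).
      by rewrite telescope_sumr// p0 pn addr0.
    by rewrite opprD addrA.
  apply: le_trans (ler_norm_sum _ _ _) _.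
  apply: le_trans (ler_sum _ (fun k _ => step k)) _.
  rewrite sumr_const card_ord -[leLHS]mulr_natl mulrA ler_wpM2r// mulrCA.
  by rewrite ler_piMr// ler_pdivrMr ?mul1r ?ler_nat.
have dE := diff_unique cL key.
apply/diff_locallyP; split; first by rewrite dE.
by rewrite dE.
Qed.

Lemma derive_coords n (f : 'rV[R]_n -> R) x v : differentiable f x ->
  'D_v f x = \sum_i v 0 i * 'D_('e_i) f x.
Proof.
move=> df; rewrite deriveE// {1}(row_sum_delta v) linear_sum; apply: eq_bigr => i _.
by rewrite linearZ/= -deriveE.
Qed.

Lemma differentiable_row n k (g : 'I_k -> 'rV[R]_n -> R) x :
  (forall j, differentiable (g j) x) ->
  differentiable (fun y => \row_j g j y) x.
Proof.
move=> dg; rewrite (_ : (fun y => _) = \sum_(j < k) (fun y => g j y *: ('e_j : 'rV[R]_k))).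
  by apply: differentiable_sum => j; apply: differentiableZl.
apply/funext => y; rewrite fct_sumE [LHS]row_sum_delta; apply: eq_bigr => j _.
by rewrite mxE.
Qed.

Lemma derive_row n k (g : 'I_k -> 'rV[R]_n -> R) x v j :
  (forall j, differentiable (g j) x) ->
  ('D_v (fun y => \row_j g j y) x) 0 j = 'D_v (g j) x.
Proof.
move=> dg; rewrite derive_mx; last exact/diff_derivable/differentiable_row.
rewrite mxE (_ : (fun t => _) = g j)//; apply/funext => y.
by rewrite mxE.
Qed.

Lemma derive_comp_row n k (f : 'rV[R]_k -> R) (g : 'I_k -> 'rV[R]_n -> R) x v :
  (forall j, differentiable (g j) x) -> differentiable f (\row_j g j x) ->
  'D_v (fun y => f (\row_j g j y)) x =
  \sum_j 'D_('e_j) f (\row_j g j x) * 'D_v (g j) x.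
Proof.
move=> dg df; have dG := differentiable_row dg.
have -> : (fun y => f (\row_j g j y)) = f \o (fun y => \row_j g j y) by [].
rewrite deriveE; last exact: differentiable_comp.
rewrite diff_comp//= -[X in 'd f _ X]deriveE// -deriveE// derive_coords//.
by apply: eq_bigr => j _; rewrite mulrC derive_row.
Qed.

Lemma norm_derive_le n (f : 'rV[R]_n -> R) x v M : differentiable f x ->
  (forall i, `|'D_('e_i) f x| <= M) -> `|'D_v f x| <= n%:R * M * `|v|.
Proof.
move=> df hM; rewrite derive_coords//; apply: le_trans (ler_norm_sum _ _ _) _.
rewrite -[n in n%:R]card_ord -mulrA mulr_natl -sumr_const; apply: ler_sum => i _.
by rewrite normrM mulrC ler_pM// rv_coord_le.
Qed.

(** The norm on row vectors is the maximum norm, which is where the factor n comes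
from. *)
Lemma mvt_bound n (f : 'rV[R]_n -> R) (v w : 'rV[R]_n) M :
  (forall t : R, 0 <= t <= 1 -> differentiable f (w + t *: (v - w)) /\
    forall i, `|'D_('e_i) f (w + t *: (v - w))| <= M) ->
  `|f v - f w| <= n%:R * M * `|v - w|.
Proof.
move=> h.
have hc (t : R) : t \in `[0, 1] -> 0 <= t <= 1 by rewrite in_itv.
have dl (t : R) : t \in `[0, 1] ->
   is_derive t (1 : R) (fun t : R => f (w + t *: (v - w))) ('D_(v - w) f (w + t *: (v - w))).
  by move=> /hc/h[dt _]; apply/is_derive_line/diff_derivable.
have cts : {within `[0, 1], continuous (fun t : R => f (w + t *: (v - w)))}.
  by apply: derivable_within_continuous => t /dl[].
have h01 : (0 : R) <= 1 by exact: ler01.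
have [t tc] := MVT_segment h01 (fun t tc => dl t (subset_itv_oo_cc tc)) cts.
rewrite scale1r scale0r addr0 subrKC subr0 mulr1 => ->.
by have [dt ht] := h t (hc _ tc); exact: norm_derive_le.
Qed.

(** The mean value theorem gives the two mixed derivatives at two different
points near x; continuity brings them together. *)
Lemma eq_of_near_matches (V : normedModType R) (a b : V -> R) x :
  {for x, continuous a} -> {for x, continuous b} ->
  (forall d, 0 < d -> exists p p', [/\ `|p - x| < d, `|p' - x| < d & a p = b p']) ->
  a x = b x.
Proof.
move=> c1 c2 half.
apply/eqP; rewrite -subr_eq0 -normr_le0; apply/ler_addgt0Pr => _/posnumP[eps].
rewrite add0r.
have e2 : 0 < eps%:num / 2 by rewrite divr_gt0.
have : \forall y \near x, `|a x - a y| <= eps%:num / 2 /\ `|b x - b y| <= eps%:num / 2.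
  by apply: filterI; [move/cvgrPdist_le : c1; apply|move/cvgrPdist_le : c2; apply].
move=> /nbhs_ballP[d /= d0 hd].
have [p [p' [pr pr' E]]] := half d d0.
have bp q : `|q - x| < d -> ball x d q by rewrite -ball_normE /ball_/= distrC.
have [h1 _] := hd _ (bp _ pr); have [_ h2] := hd _ (bp _ pr').
rewrite E in h1.
rewrite -(subrKA (b p')) (le_trans (ler_normD _ _))// (splitr eps%:num) lerD//.
by rewrite distrC.
Qed.

(** The second difference of f over the parallelogram spanned by h u and h v is
symmetric in u and v; applying the mean value theorem twice, in each of the two
orders, writes it as h^2 times either of the mixed derivatives at a nearby
point. *)
Lemma schwarz n (f : 'rV[R]_n -> R) x (u v : 'rV[R]_n) :
  (\forall y \near x, [/\ derivable f y u, derivable f y v,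
     derivable ('D_u f) y v & derivable ('D_v f) y u]) ->
  {for x, continuous ('D_v ('D_u f))} -> {for x, continuous ('D_u ('D_v f))} ->
  'D_v ('D_u f) x = 'D_u ('D_v f) x.
Proof.
move=> /nbhs_ballP[r /= r0 hr] c1 c2.
have half : forall u v : 'rV[R]_n, (forall y, ball x r y -> [/\ derivable f y u, derivable f y v,
     derivable ('D_u f) y v & derivable ('D_v f) y u]) -> forall h : R, 0 < h ->
   h * (`|u| + `|v|) < r -> exists2 p, `|p - x| <= h * (`|u| + `|v|) &
     f (x + h *: u + h *: v) - f (x + h *: u) - (f (x + h *: v) - f x)
       = h * (h * 'D_v ('D_u f) p).
  move=> {c1 c2 hr} {}u {}v hr h h0 hsmall.
  have inb (s t : R) : `|s| <= h -> `|t| <= h -> `|s *: u + t *: v| <= h * (`|u| + `|v|).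
    move=> sh th; rewrite (le_trans (ler_normD _ _))// mulrDr !normrZ lerD// ler_wpM2r//.
  have inb' (s t : R) : `|s| <= h -> `|t| <= h -> ball x r (x + s *: u + t *: v).
    move=> sh th; rewrite -ball_normE /ball_/= -addrA opprD addNKr normrN.
    exact: le_lt_trans (inb _ _ sh th) hsmall.
  have hh : `|h| = h by rewrite ger0_norm// ltW.
  have hh' : `|h| <= h by rewrite hh.
  pose g y := f (y + h *: v) - f y.
  have dshift (s : R) : `|s| <= `|h| -> is_derive (x + s *: u) u (fun y => f (y + h *: v))
      ('D_u f (x + s *: u + h *: v)).
    rewrite hh => sh.
    have [d _ _ _] := hr _ (inb' s h sh hh').
    have E : (fun k : R => k^-1 *: (((fun y => f (y + h *: v)) \o shift (x + s *: u)) (k *: u)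
         - f (x + s *: u + h *: v))) = (fun k : R => k^-1 *:
         ((f \o shift (x + s *: u + h *: v)) (k *: u) - f (x + s *: u + h *: v))).
      by apply/funext => k /=; rewrite !addrA.
    by apply: DeriveDef; rewrite /derivable /derive E.
  have dg (s : R) : `|s| <= `|h| -> is_derive (x + s *: u) u g
      ('D_u f (x + s *: u + h *: v) - 'D_u f (x + s *: u)).
    move=> sh; apply: is_deriveB; first exact: dshift.
    have z0 : `|0 : R| <= h by rewrite normr0 ltW.
    rewrite hh in sh; have [d _ _ _] := hr _ (inb' s 0 sh z0).
    by rewrite scale0r addr0 in d; exact: DeriveDef d erefl.
  have [s sh E1] := @mvt_line _ g x u h (fun s sh => @ex_derive _ _ _ _ _ _ _ (dg s sh)).
  have sg := sh; rewrite hh in sh.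
  have [t th E2] := @mvt_line _ ('D_u f) (x + s *: u) v h
     (fun t th => let: And4 _ _ d _ := hr _ (inb' s t sh (le_trans th hh')) in d).
  rewrite hh in th.
  exists (x + s *: u + t *: v); first by rewrite -[x + _ + _]addrA [x + _]addrC addrK inb.
  rewrite -E2 -(@derive_val _ _ _ _ _ _ _ (dg s sg)) -E1 /g.
  by [].
have half' h : 0 < h -> h * (`|u| + `|v|) < r -> exists p p',
    [/\ `|p - x| <= h * (`|u| + `|v|), `|p' - x| <= h * (`|u| + `|v|) &
    'D_v ('D_u f) p = 'D_u ('D_v f) p'].
  move=> h0 hs; have [p pr E] := half u v hr h h0 hs.
  have hr' y : ball x r y -> [/\ derivable f y v, derivable f y u,
    derivable ('D_v f) y u & derivable ('D_u f) y v].
    by move=> /hr[a b c d]; exact: And4 b a d c.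
  have hs' : h * (`|v| + `|u|) < r by rewrite addrC.
  have [p' pr' E'] := half v u hr' h h0 hs'.
  rewrite [`|v| + _]addrC in pr'; exists p, p'; split; [exact: pr|exact: pr'|].
  have : h * (h * 'D_v ('D_u f) p) = h * (h * 'D_u ('D_v f) p').
    apply: (etrans (esym E)); apply: etrans E'; rewrite [x + h *: v + h *: u]addrAC.
    by move: (f (_ + _ + _)) (f (x + h *: u)) (f (x + h *: v)) (f x) => a b c e; ring.
  have hn0 : h != 0 by rewrite gt_eqF.
  by move=> /(mulfI hn0)/(mulfI hn0).
apply: (eq_of_near_matches c1 c2) => d d0.
(* The summand 1 keeps c positive when u = v = 0. *)
pose c := `|u| + `|v| + 1.
have c0 : 0 < c by rewrite ltr_wpDl// addr_ge0.
have m0 : 0 < Num.min r d by rewrite lt_min r0 d0.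
pose h := Num.min r d / 2 / c.
have h0 : 0 < h by rewrite !divr_gt0.
have hc : h * (`|u| + `|v|) < Num.min r d.
  apply: (@le_lt_trans _ _ (h * c)); first by rewrite ler_wpM2l ?lerDl ?ler01// ltW.
  by rewrite /h divfK ?gt_eqF// ltr_pdivrMr// ltr_pMr// ltr1n.
have mr : Num.min r d <= r by rewrite ge_min lexx.
have md : Num.min r d <= d by rewrite ge_min lexx orbT.
have [p [p' [pr pr' E]]] := half' h h0 (lt_le_trans hc mr).
have cd := lt_le_trans hc md.
by exists p, p'; exact: And3 (le_lt_trans pr cd) (le_lt_trans pr' cd) E.
Qed.
End Differential.

(** * Smooth functions on open sets *)

Section Smooth.
Context {R : realType}.

Lemma near_eq_continuous (V W : normedModType R) (f g : V -> W) x :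
  (\forall y \near x, f y = g y) -> {for x, continuous f} -> {for x, continuous g}.
Proof.
move=> fg cf; have E := nbhs_singleton fg.
suff : g y @[y --> x] --> g x by [].
rewrite -E; apply: cvg_trans cf; exact: near_eq_cvg.
Qed.

Lemma near_eq_differentiable (V W : normedModType R) (f g : V -> W) x :
  (\forall y \near x, f y = g y) -> differentiable f x -> differentiable g x.
Proof.
move=> fg df; have E := nbhs_singleton fg.
have cd : continuous ('d f x) by apply: diff_continuous.
have key : g \o shift x = cst (g x) + 'd f x +o_0 id.
  apply/eqaddoP => eps e0.
  have /eqaddoP/(_ eps e0) h := diff_locally df.
  have fg0 : \forall h \near 0, f (h + x) = g (h + x).
    by move: fg; rewrite (near_shift 0 x) subr0.
  apply: filterS2 h fg0 => h hh fgh.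
  by rewrite (_ : (_ - _) h = g (h + x) - (g x + 'd f x h))// -E -fgh.
have dE := diff_unique cd key.
by apply/diff_locallyP; split; rewrite dE.
Qed.

Definition pder n (alpha : seq 'I_n) (f : 'rV[R]_n -> R) : 'rV[R]_n -> R :=
  foldr (fun i g => 'D_('e_i) g) f alpha.

Definition smooth n (Om : set 'rV[R]_n) (f : 'rV[R]_n -> R) :=
  forall alpha x, Om x -> differentiable (pder alpha f) x.

Lemma pder_cat n (a b : seq 'I_n) f : pder (a ++ b) f = pder a (pder b f).
Proof. by rewrite /pder foldr_cat. Qed.

Lemma pder_smooth n (Om : set 'rV[R]_n) f alpha :
  smooth Om f -> smooth Om (pder alpha f).
Proof. by move=> sf beta x Ox; rewrite -pder_cat; exact: sf. Qed.

Lemma smoothW n (Om Om' : set 'rV[R]_n) f : Om' `<=` Om -> smooth Om f -> smooth Om' f.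
Proof. by move=> OO sf alpha x /OO; exact: sf. Qed.

Lemma smooth_differentiable n (Om : set 'rV[R]_n) f x :
  smooth Om f -> Om x -> differentiable f x.
Proof. by move=> sf; exact: (sf [::]). Qed.

Lemma eq_near_open n (T : Type) (Om : set 'rV[R]_n) (f g : 'rV[R]_n -> T) x :
  open Om -> (forall y, Om y -> f y = g y) -> Om x -> \forall y \near x, f y = g y.
Proof. by move=> oO fg Ox; apply: filterS (open_nbhs_nbhs (conj oO Ox)). Qed.

(** Partial derivatives that exist and are continuous only yield total
differentiability through the C^1 criterion, and differentiability is the
property that composes; hence the passage to scalar functions all of whose
iterated partial derivatives are differentiable. *)
Lemma smooth_on_coord n k (Om : set 'rV[R]_n) (f : 'rV[R]_n -> 'rV[R]_k) j :
  open Om -> smooth_on Om f ->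
  smooth Om (fun x => f x 0 j) /\
  forall alpha x, Om x -> pder alpha (fun x => f x 0 j) x = pd alpha f x 0 j.
Proof.
move=> oO sf.
have E alpha x : Om x -> pder alpha (fun x => f x 0 j) x = pd alpha f x 0 j.
  elim: alpha x => [//|i alpha ih] x Ox /=.
  rewrite (@near_eq_derive _ _ _ _ (fun y => pd alpha f y 0 j)); last exact: eq_near_open ih Ox.
  by rewrite derive_mx ?mxE//; exact: (sf alpha x Ox).2.
split=> // alpha x Ox.
have Enear y : Om y -> \forall z \near y, pd alpha f z 0 j = pder alpha (fun x => f x 0 j) z.
  by move=> Oy; apply: eq_near_open Oy => // z /E ->.
apply: C1_differentiable.
  apply: filterS (open_nbhs_nbhs (conj oO Ox)) => y Oy i.
  apply: (@near_eq_derivable _ _ _ (fun z => pd alpha f z 0 j) _ y 'e_i (Enear y Oy)).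
  exact: (derivable_mxP _ _ _).1 ((sf alpha y Oy).2 i) 0 j.
move=> i.
apply: (@near_eq_continuous _ _ (fun y => pd (i :: alpha) f y 0 j)).
  by apply: eq_near_open Ox => // z /(E (i :: alpha)) <-.
apply: (@continuous_comp _ _ _ (pd (i :: alpha) f) (fun M : 'rV[R]_k => M 0 j)).
  exact: (sf (i :: alpha) x Ox).1.
exact: coord_continuous.
Qed.

Lemma smooth_on_row n k (Om : set 'rV[R]_n) (F : 'I_k -> 'rV[R]_n -> R) :
  open Om -> (forall j, smooth Om (F j)) ->
  smooth_on Om (fun x => \row_j F j x) /\
  forall alpha x, Om x -> pd alpha (fun x => \row_j F j x) x = \row_j pder alpha (F j) x.
Proof.
move=> oO sF.
have E alpha x : Om x -> pd alpha (fun x => \row_j F j x) x = \row_j pder alpha (F j) x.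
  elim: alpha x => [//|i alpha ih] x Ox /=.
  rewrite (@near_eq_derive _ _ _ _ (fun y => \row_j pder alpha (F j) y)); last first.
    exact: eq_near_open ih Ox.
  apply/rowP => j; rewrite derive_row ?mxE// => l; exact: sF.
split=> // alpha x Ox.
have En : \forall z \near x, \row_j pder alpha (F j) z = pd alpha (fun x => \row_j F j x) z.
  by apply: eq_near_open Ox => // z /E ->.
have dr : differentiable (fun z => \row_j pder alpha (F j) z) x.
  by apply: differentiable_row => j; exact: sF.
split; first exact: near_eq_continuous En (differentiable_continuous dr).
by move=> i; apply: diff_derivable; exact: near_eq_differentiable En dr.
Qed.

Lemma smooth_schwarz n (Om : set 'rV[R]_n) f i j x : open Om -> smooth Om f -> Om x ->
  pder [:: i; j] f x = pder [:: j; i] f x.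
Proof.
move=> oO sf Ox; apply: schwarz.
- apply: filterS (open_nbhs_nbhs (conj oO Ox)) => y Oy.
  split; apply: diff_derivable.
  exact: (sf [::] y Oy). exact: (sf [::] y Oy). exact: (sf [:: j] y Oy). exact: (sf [:: i] y Oy).
- exact: differentiable_continuous (sf [:: i; j] x Ox).
- exact: differentiable_continuous (sf [:: j; i] x Ox).
Qed.

Lemma derive_sqrt_comp n (f : 'rV[R]_n -> R) x v : differentiable f x -> 0 < f x ->
  differentiable (fun y => Num.sqrt (f y)) x /\
  'D_v (fun y => Num.sqrt (f y)) x = (2 * Num.sqrt (f x))^-1 * 'D_v f x.
Proof.
move=> df fx0; have [ds E] := is_derive1_sqrt fx0.
have ds' : differentiable (Num.sqrt : R -> R) (f x) by apply/derivable1_diffP.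
have dc : differentiable ((Num.sqrt : R -> R) \o f) x by exact: differentiable_comp.
split=> //.
have -> : (fun y => Num.sqrt (f y)) = (Num.sqrt : R -> R) \o f by [].
rewrite (deriveE v dc) (diff_comp df ds')/= -(deriveE v df) deriv1E// derive1E E.
exact: mulrC.
Qed.

End Smooth.

(** * Moderate nets of smooth functions *)

Section Nets.
Context {R : realType} {rho : gauge R}.
Local Notation gnum := (gnum rho).
Local Notation net n := (idx R -> 'rV[R]_n -> R).

(** A smooth net all of whose partial derivatives are moderate at the points of
X: this is what a net has to satisfy in order to define a generalized smooth
function on X. *)
Definition mnet n (X : set 'rV[gnum]_n) (Om : idx R -> set 'rV[R]_n) (F : net n) :=
  (forall e, smooth (Om e) (F e)) /\
  forall alpha x u, X x -> is_repv u x ->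
    (fun e => pder alpha (F e) (u e)) \in moderate rho.

Definition domain n (X : set 'rV[gnum]_n) (Om : idx R -> set 'rV[R]_n) :=
  (forall e, open (Om e)) /\ X `<=` strongly_internal Om.

Lemma domainI n (X : set 'rV[gnum]_n) Om Om' :
  domain X Om -> domain X Om' -> domain X (fun e => Om e `&` Om' e).
Proof.
move=> [oO iO] [oO' iO']; split=> [e|x Xx u ux]; first exact: openI.
by apply: filterS2 (iO x Xx u ux) (iO' x Xx u ux) => e.
Qed.

Lemma mnetW n (X : set 'rV[gnum]_n) Om Om' F :
  (forall e, Om' e `<=` Om e) -> mnet X Om F -> mnet X Om' F.
Proof. by move=> OO [sF mF]; split=> // e; apply: smoothW (sF e). Qed.

Lemma mnet_sub n (X Y : set 'rV[gnum]_n) Om F : Y `<=` X -> mnet X Om F -> mnet Y Om F.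
Proof. by move=> YX [sF mF]; split=> // alpha x u /YX; exact: mF. Qed.

Lemma mnet_pder n (X : set 'rV[gnum]_n) Om F alpha :
  mnet X Om F -> mnet X Om (fun e => pder alpha (F e)).
Proof.
move=> [sF mF]; split=> [e|beta x u Xx ux]; first exact: pder_smooth.
by under eq_fun do rewrite -pder_cat; exact: mF Xx ux.
Qed.

(** Smoothness and moderateness of all derivatives follow by coinduction: it is
enough to find a class of nets that contains F, is closed under partial
derivatives and consists of differentiable nets with moderate values. *)
Lemma mnet_coind n (X : set 'rV[gnum]_n) Om (A : net n -> Prop) : domain X Om ->
  (forall F, A F -> forall e x, Om e x -> differentiable (F e) x) ->
  (forall F, A F -> forall x u, X x -> is_repv u x -> (fun e => F e (u e)) \in moderate rho) ->
  (forall F, A F -> forall i, exists G, A G /\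
     forall e x, Om e x -> 'D_('e_i) (F e) x = G e x) ->
  forall F, A F -> mnet X Om F.
Proof.
move=> [oO XO] Adiff Amod Ader F AF.
have key alpha : exists G, A G /\ forall e x, Om e x -> pder alpha (F e) x = G e x.
  elim: alpha => [|i alpha [G [AG E]]]; first by exists F.
  have [H [AH EH]] := Ader G AG i; exists H; split => // e x Ox /=.
  rewrite -EH//; apply: near_eq_derive; apply: eq_near_open Ox => // y; exact: E.
split=> [e alpha x Ox|alpha x u Xx ux].
  have [G [AG E]] := key alpha.
  apply: (@near_eq_differentiable _ _ _ (G e)); last exact: Adiff.
  by apply: eq_near_open Ox => // y /E ->.
have [G [AG E]] := key alpha.
apply: near_moderate (Amod G AG x u Xx ux).
by apply: filterS (XO x Xx u ux) => e /E ->.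
Qed.

Lemma mnet_cst n (X : set 'rV[gnum]_n) Om (c : idx R -> R) : domain X Om ->
  c \in moderate rho -> mnet X Om (fun e _ => c e).
Proof.
move=> dO mc.
pose A (F : net n) := exists2 c : idx R -> R, c \in moderate rho & F = fun e _ => c e.
apply: (@mnet_coind _ _ _ A) => //; last by exists c.
- move=> _ [b _ ->] e x _; exact: differentiable_cst.
- by move=> _ [b mb ->].
- move=> _ [b mb ->] i; exists (fun _ _ => 0); split.
    by exists (fun=> 0) => //; apply: rpred0.
  by move=> e x _; rewrite derive_cst.
Qed.

Lemma derive_coord n (j : 'I_n) (x v : 'rV[R]_n) : 'D_v (fun x : 'rV[R]_n => x 0 j) x = v 0 j.
Proof.
have := @derive_mx R _ 1 n id x v (@derivable_id _ _ x v).
by rewrite derive_id => /rowP/(_ j); rewrite mxE.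
Qed.

Lemma moderate_cst (c : R) : (fun=> c) \in moderate rho.
Proof.
apply/moderateP; exists 1%N.
apply: filterS (near_gauge_natr (Num.bound `|c|)) => e; apply: le_trans.
by rewrite ltW// archi_boundP.
Qed.

Lemma mnet_coord n (X : set 'rV[gnum]_n) Om j : domain X Om ->
  mnet X Om (fun _ x => x 0 j).
Proof.
move=> dO.
pose A (F : net n) := mnet X Om F \/ F = fun _ x => x 0 j.
apply: (@mnet_coind _ _ _ A) => //; last by right.
- move=> F [[sF _]|->] e x Ox; first exact: (sF e [::]).
  exact: differentiable_coord.
- move=> F [[_ mF]|->] x u Xx ux; first exact: mF [::] x u Xx ux.
  by have := ux j => /rep_moderate.
- move=> F [mF|->] i.
    exists (fun e => pder [:: i] (F e)); split; last by [].
    by left; exact: (mnet_pder [:: i] mF).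
  exists (fun _ _ => (j == i)%:R); split.
    by left; apply: mnet_cst => //; exact: moderate_cst.
  by move=> e x _; rewrite derive_coord mxE eqxx.
Qed.

(** The nets generated from moderate smooth nets by the algebraic operations,
inverses and square roots (bounded away from 0 at the points of X) and
composition. By the differentiation rules this class is closed under partial
derivatives, so that mnet_coind applies to it: this replaces formulas for
higher derivatives of products and composites. *)
Inductive alg n (X : set 'rV[gnum]_n) (Om : idx R -> set 'rV[R]_n) : net n -> Prop :=
| alg_base F : mnet X Om F -> alg X Om F
| alg_add F G : alg X Om F -> alg X Om G -> alg X Om (fun e x => F e x + G e x)
| alg_mul F G : alg X Om F -> alg X Om G -> alg X Om (fun e x => F e x * G e x)
| alg_inv F : alg X Om F -> (forall e x, Om e x -> F e x != 0) ->
    (forall x u, X x -> is_repv u x -> (fun e => (F e (u e))^-1) \in moderate rho) ->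
    alg X Om (fun e x => (F e x)^-1)
| alg_sqrt F : alg X Om F -> (forall e x, Om e x -> 0 < F e x) ->
    (forall x u, X x -> is_repv u x -> (fun e => (F e (u e))^-1) \in moderate rho) ->
    alg X Om (fun e x => Num.sqrt (F e x))
| alg_comp k (Y : set 'rV[gnum]_k) Om' (G : net k) (g : 'I_k -> net n) :
    mnet Y Om' G -> (forall j, alg X Om (g j)) ->
    (forall e x, Om e x -> Om' e (\row_j g j e x)) ->
    (forall x u, X x -> is_repv u x -> exists2 y, Y y & is_repv (fun e => \row_j g j e (u e)) y) ->
    alg X Om (fun e x => G e (\row_j g j e x)).

Lemma sqrt_le1D (x : R) : Num.sqrt x <= 1 + `|x|.
Proof.
have [x0|x0] := leP 0 x; last by rewrite ltr0_sqrtr// addr_ge0.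
rewrite -(@ler_pXn2r _ 2)// ?nnegrE ?sqrtr_ge0 ?addr_ge0// sqr_sqrtr// ger0_norm//.
by rewrite expr2; nra.
Qed.

Lemma moderate_sqrt (u : idx R -> R) : u \in moderate rho ->
  (fun e => Num.sqrt (u e)) \in moderate rho.
Proof.
move=> mu; apply: (@near_moderate _ _ (fun e => 1 + `|u e|)).
  apply: nearW => e; rewrite ger0_norm ?sqrtr_ge0// ger0_norm ?addr_ge0//.
  exact: sqrt_le1D.
apply: rpredD; first exact: moderate_cst.
by apply: near_moderate mu; apply: nearW => e; rewrite normr_id.
Qed.

Lemma alg_moderate n (X : set 'rV[gnum]_n) Om F : alg X Om F ->
  forall x u, X x -> is_repv u x -> (fun e => F e (u e)) \in moderate rho.
Proof.
elim=> {F} [F [_ mF]|F G _ mF _ mG|F G _ mF _ mG|F _ _ _ //|F _ mF _ _|k Y Om' G g [_ mG] _ _ _ gY]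
  x u Xx ux.
- exact: mF [::] x u Xx ux.
- by apply: rpredD; [exact: mF Xx ux|exact: mG Xx ux].
- by apply: rpredM; [exact: mF Xx ux|exact: mG Xx ux].
- by apply: moderate_sqrt; exact: mF Xx ux.
- by have [y Yy uy] := gY x u Xx ux; exact: mG [::] y _ Yy uy.
Qed.

Lemma alg_differentiable n (X : set 'rV[gnum]_n) Om F : alg X Om F ->
  forall e x, Om e x -> differentiable (F e) x.
Proof.
elim=> {F} [F [sF _]|F G _ dF _ dG|F G _ dF _ dG|F _ dF F0 _|F _ dF F0 _|k Y Om' G g [sG _] _ dg gO _]
  e x Ox.
- exact: (sF e [::]).
- by apply: (differentiableD (dF e x Ox) (dG e x Ox)).
- by apply: (differentiableM (dF e x Ox) (dG e x Ox)).
- by apply: (differentiableV (dF e x Ox)); exact: F0.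
- exact: (derive_sqrt_comp 0 (dF e x Ox) (F0 e x Ox)).1.
- apply: (@differentiable_comp _ _ _ _ (fun x => \row_j g j e x) (G e)).
    by apply: differentiable_row => j; exact: dg.
  by apply: (sG e [::]); exact: gO.
Qed.

Lemma alg_sum n (X : set 'rV[gnum]_n) Om (I : Type) (r : seq I) (F : I -> net n) :
  domain X Om -> (forall i, alg X Om (F i)) -> alg X Om (fun e x => \sum_(i <- r) F i e x).
Proof.
move=> dO aF; elim: r => [|i r ih].
  under eq_fun do under eq_fun do rewrite big_nil.
  by apply: alg_base; apply: mnet_cst => //; exact: moderate_cst.
under eq_fun do under eq_fun do rewrite big_cons.
exact: alg_add.
Qed.

Lemma alg_cst n (X : set 'rV[gnum]_n) Om (c : idx R -> R) : domain X Om ->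
  c \in moderate rho -> alg X Om (fun e _ => c e).
Proof. by move=> dO mc; apply: alg_base; exact: mnet_cst. Qed.

Lemma alg_derive n (X : set 'rV[gnum]_n) Om F : domain X Om -> alg X Om F ->
  forall i, exists G, alg X Om G /\ forall e x, Om e x -> 'D_('e_i) (F e) x = G e x.
Proof.
move=> dO; elim=> {F} [F mF|F G aF dF aG dG|F G aF dF aG dG|F aF dF F0 mV|F aF dF F0 mV|
  k Y Om' G g mG ag dg gO gY] i.
- exists (fun e => pder [:: i] (F e)); split=> //.
  by apply: alg_base; exact: (mnet_pder [:: i] mF).
- have [F' [aF' EF]] := dF i; have [G' [aG' EG]] := dG i.
  exists (fun e x => F' e x + G' e x); split; first exact: alg_add.
  move=> e x Ox; rewrite -EF// -EG//.
  exact: (deriveD (diff_derivable (alg_differentiable aF Ox)) (diff_derivable (alg_differentiable aG Ox))).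
- have [F' [aF' EF]] := dF i; have [G' [aG' EG]] := dG i.
  exists (fun e x => F e x * G' e x + G e x * F' e x); split.
    by apply: alg_add; apply: alg_mul.
  move=> e x Ox; rewrite -EF// -EG//.
  exact: (deriveM (diff_derivable (alg_differentiable aF Ox)) (diff_derivable (alg_differentiable aG Ox))).
- have [F' [aF' EF]] := dF i.
  exists (fun e x => -1 * ((F e x)^-1 * (F e x)^-1 * F' e x)); split.
    apply: alg_mul; first by apply: alg_cst => //; exact: moderate_cst.
    by apply: alg_mul => //; apply: alg_mul; apply: alg_inv.
  move=> e x Ox; rewrite -EF// mulN1r.
  have /= -> := @deriveV _ _ (F e) x 'e_i (F0 e x Ox) (diff_derivable (alg_differentiable aF Ox)).
  by rewrite -invfM -expr2 scaleNr.
- have [F' [aF' EF]] := dF i.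
  have aS : alg X Om (fun e x => Num.sqrt (F e x)) by exact: alg_sqrt.
  exists (fun e x => (2 * Num.sqrt (F e x))^-1 * F' e x); split.
    apply: alg_mul => //; apply: alg_inv.
    + by apply: alg_mul => //; apply: alg_cst => //; exact: moderate_cst.
    + by move=> e x Ox; rewrite mulf_neq0// gt_eqF// sqrtr_gt0; exact: F0.
    + move=> x u Xx ux.
      apply: (@near_moderate _ _ (fun e => 2^-1 * Num.sqrt (F e (u e))^-1)).
        apply: filterS (dO.2 x Xx u ux) => e Oe.
        by rewrite sqrtrV ?invfM// ltW// F0.
      apply: rpredM; first exact: moderate_cst.
      by apply: moderate_sqrt; exact: mV ux.
  move=> e x Ox; rewrite -EF//.
  exact: (derive_sqrt_comp _ (alg_differentiable aF Ox) (F0 e x Ox)).2.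
- have [g' hg'] := choice (fun j => dg j i).
  exists (fun e x => \sum_j pder [:: j] (G e) (\row_j g j e x) * g' j e x); split.
    apply: alg_sum => // j; apply: alg_mul; last exact: (hg' j).1.
    apply: (@alg_comp _ _ _ _ Y Om' (fun e => pder [:: j] (G e))) => //.
    exact: (mnet_pder [:: j] mG).
  move=> e x Ox; rewrite derive_comp_row.
  + by apply: eq_bigr => j _; rewrite (hg' j).2.
  + by move=> j; exact: alg_differentiable Ox.
  + by apply: (mG.1 e [::]); exact: gO.
Qed.

(** All closure properties of generalized smooth functions come from this. *)
Lemma alg_mnet n (X : set 'rV[gnum]_n) Om F : domain X Om -> alg X Om F -> mnet X Om F.
Proof.
move=> dO; apply: (@mnet_coind _ _ _ (alg X Om)) => //.
- by move=> G aG e x Ox; exact: (alg_differentiable aG Ox).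
- by move=> G aG; exact: (alg_moderate aG).
- by move=> G aG i; exact: (alg_derive dO aG).
Qed.

End Nets.

(** * Uniform bounds along nets of sets *)

Section UniformBounds.
Context {R : realType} {rho : gauge R}.
Local Notation gnum := (gnum rho).
Local Notation net n := (idx R -> 'rV[R]_n -> R).

Lemma repv_exists n (x : 'rV[gnum]_n) : exists u, is_repv u x.
Proof.
have [u ux] := choice (fun i => rep_exists (x 0 i)).
exists (fun e => \row_i u i e) => i.
by under eq_fun do rewrite mxE.
Qed.

Lemma moderate_repv n (u : idx R -> 'rV[R]_n) :
  (forall i, (fun e => u e 0 i) \in moderate rho) -> exists x, is_repv (rho := rho) u x.
Proof.
move=> mu; have [x ux] := choice (fun i => moderate_rep (mu i)).
by exists (\row_i x i) => i; rewrite mxE.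
Qed.

Lemma repv_row n k (F : 'I_k -> net n) (f : 'I_k -> gnum) u :
  (forall j, is_rep (fun e => F j e (u e)) (f j)) ->
  is_repv (fun e => \row_j F j e (u e)) (\row_j f j).
Proof. by move=> h j; rewrite mxE; under eq_fun do rewrite mxE. Qed.

Lemma idx_inv_subproof (k : nat) : 0 < (k.+1%:R^-1 : R) <= 1.
Proof. by rewrite invr_gt0 ltr0n/= invf_le1// ?ltr0n// ler1n. Qed.

Definition idx_inv k : idx R :=
  exist (fun e : R => 0 < e <= 1) _ (idx_inv_subproof k).

(** The filter of small indices has a countable base; diagonal arguments need
this. *)
Lemma near_epsP (P : idx R -> Prop) : (\forall e \near eps0 R, P e) <->
  exists k, forall e : idx R, \val e <= \val (idx_inv k) -> P e.
Proof.
split=> [[e0 h]|[k h]]; last by exists (idx_inv k).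
exists (Num.bound (\val e0)^-1) => e he; apply: h; apply: le_trans he _ => /=.
have /andP[e00 _] := valP e0.
rewrite -[leRHS]invrK lef_pV2 ?posrE ?invr_gt0 ?ltr0n//.
have h0 : 0 <= (\val e0)^-1 by rewrite invr_ge0 ltW.
by rewrite (le_trans (ltW (archi_boundP h0)))// ler_nat leqnSn.
Qed.

Lemma near_idx_lt (r : R) : 0 < r -> \forall e \near eps0 R, \val e < r.
Proof.
move=> r0; apply/near_epsP; exists (Num.bound r^-1) => e /le_lt_trans; apply => /=.
rewrite -[ltRHS]invrK ltf_pV2 ?posrE ?invr_gt0 ?ltr0n//.
have h0 : 0 <= r^-1 by rewrite invr_ge0 ltW.
by rewrite (lt_le_trans (archi_boundP h0))// ler_nat leqnSn.
Qed.

(** If a property that becomes rarer with k fails to be eventually avoidable for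
each k, then one net realizes all these failures. Bad points v_k are chosen at
indices e_k tending to 0, and the net takes the value v_k at e_k (with k maximal
if an index is chosen several times) and the default value c0 elsewhere. *)
Lemma diagonal_net (T : Type) (Bad : nat -> idx R -> T -> Prop) (c0 : idx R -> T) :
  (forall k e v, Bad k.+1 e v -> Bad k e v) ->
  (forall k, ~ \forall e \near eps0 R, forall v, ~ Bad k e v) ->
  exists v : idx R -> T,
    (forall k, \forall e \near eps0 R, v e = c0 e \/ Bad k e (v e)) /\
    (forall k, ~ \forall e \near eps0 R, ~ Bad k e (v e)).
Proof.
move=> mono frq.
have le_mono k l e v : (k <= l)%N -> Bad l e v -> Bad k e v.
  by move=> /subnK <-; elim: (l - k)%N => [//|i ih] /mono.
have H (k : nat) : exists ev : idx R * T, \val ev.1 <= \val (idx_inv k) /\ Bad k ev.1 ev.2.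
  apply: contrapT => nex; apply: (frq k); apply/near_epsP; exists k => e ek v bv.
  by apply: nex; exists (e, v).
have [w hw] := choice H.
pose hit e k := w k = (e, (w k).2).
(* An index can be hit only finitely often, so a last hit exists. *)
pose lst e k := hit e k /\ forall l, hit e l -> (l <= k)%N.
have lstP e k : hit e k -> exists l, lst e l.
  move=> hk.
  have bnd l : hit e l -> (l <= Num.bound (\val e)^-1)%N.
    move=> hl; have [] := hw l; rewrite hl/= => el _.
    have /andP[e0 _] := valP e.
    have : l.+1%:R <= (\val e)^-1 by rewrite -[leLHS]invrK lef_pV2 ?posrE ?invr_gt0 ?ltr0n.
    have h0 : 0 <= (\val e)^-1 by rewrite invr_ge0 ltW.
    by move=> /le_lt_trans/(_ (archi_boundP h0)); rewrite ltr_nat => /ltnW/ltnW.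
  have [l hl ml] := @ex_maxnP (fun l => `[< hit e l >]) _ (ex_intro _ k (asboolT hk))
     (fun l hl => bnd l (asboolW hl)).
  by exists l; split; [exact: asboolW|move=> i hi; apply: ml; exact: asboolT].
pose v e := if pselect (exists k, lst e k) is left h then (w (projT1 (cid h))).2 else c0 e.
have vP e : (v e = c0 e /\ ~ exists k, lst e k) \/ exists2 k, lst e k & Bad k e (v e).
  rewrite /v; case: pselect => [h|nh]; last by left.
  right; case: cid => k lk /=; exists k => //.
  by have [_] := hw k; rewrite {1}lk.1.
exists v; split=> [k|k].
  have fin : \forall e \near eps0 R, forall l : 'I_k, ~ hit e l.
    apply: filter_forall => l.
    have /andP[w0 _] := valP (w l).1.
    apply: filterS (near_idx_lt w0) => e + hl.
    by rewrite hl/= ltxx.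
  apply: filterS fin => e he; case: (vP e) => [[-> _]|[l ll bl]]; first by left.
  right; apply: le_mono bl; rewrite leqNgt; apply/negP => lk.
  exact: (he (Ordinal lk)) ll.1.
move=> /near_epsP[l hl].
pose j := maxn k l.
have [ej bj] := hw j.
have hj : hit (w j).1 j by rewrite /hit; case: (w j).
apply: (hl (w j).1).
  apply: le_trans ej _ => /=.
  by rewrite lef_pV2 ?posrE ?ltr0n// ler_nat ltnS leq_maxr.
case: (vP (w j).1) => [[_ nex]|[i [hi li] bi]].
  by case: nex; exact: lstP hj.
by apply: le_mono bi; rewrite (leq_trans _ (li j hj))// leq_maxl.
Qed.

Lemma repv_inj n u (x y : 'rV[gnum]_n) : is_repv u x -> is_repv u y -> x = y.
Proof. by move=> ux uy; apply/rowP => i; exact: rep_inj (ux i) (uy i). Qed.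

Lemma repv_close n u v (x : 'rV[gnum]_n) : is_repv u x ->
  (forall k, \forall e \near eps0 R, `|v e - u e| <= rho e ^+ k) -> is_repv v x.
Proof.
move=> ux h i; apply: rep_equiv (ux i) _ => k; apply: filterS (h k) => e.
by apply: le_trans; have := rv_coord_le (v e - u e) i; rewrite !mxE distrC.
Qed.

Lemma repv_dist n u v (x : 'rV[gnum]_n) k : is_repv u x -> is_repv v x ->
  \forall e \near eps0 R, `|v e - u e| <= rho e ^+ k.
Proof.
move=> ux vx.
have h i : \forall e \near eps0 R, `|v e 0 i - u e 0 i| <= rho e ^+ k.
  exact: ((rep_eqP (vx i) (ux i)).1 erefl k).
apply: filterS (filter_forall _ h) => e he; apply: rv_norm_le.
  by rewrite ltW// gexp_gt0.
by move=> i; rewrite !mxE.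
Qed.

(** The points of the rho^K-neighbourhood of C. *)
Definition tube n (C : idx R -> set 'rV[R]_n) K e v :=
  exists2 c, C e c & `|v - c| <= rho e ^+ K.

(** All nets that stay in C up to negligible errors represent points of X. For
such C, information about the individual points of X becomes uniform on C. *)
Definition net_inside n (C : idx R -> set 'rV[R]_n) (X : set 'rV[gnum]_n) :=
  forall v, (forall k, \forall e \near eps0 R, tube C k e (v e)) ->
    exists2 y, X y & is_repv v y.

Lemma tube_mono n (C : idx R -> set 'rV[R]_n) k l e v : (k <= l)%N ->
  tube C l e v -> tube C k e v.
Proof. by move=> kl [c Cc h]; exists c => //; apply: le_trans h (gexp_le _ kl). Qed.

Lemma tube_base n (C : idx R -> set 'rV[R]_n) k e c : C e c -> tube C k e c.
Proof. by move=> Cc; exists c => //; rewrite subrr normr0 ltW// gexp_gt0. Qed.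

(** If no exponent K worked, diagonal_net would produce a net that stays close to
C and on which F is not bounded by any power of rho, or leaves Om. This net
represents a point of X, where F is moderate and Om is a neighbourhood. *)
Lemma uniform_bound n (X : set 'rV[gnum]_n) Om F C c0 :
  domain X Om -> mnet X Om F -> (forall e, C e (c0 e)) -> net_inside C X ->
  exists K, \forall e \near eps0 R, forall v, tube C K e v ->
    Om e v /\ `|F e v| <= rho e ^- K.
Proof.
move=> dO mF Cc CX; apply: contrapT => nK.
pose Bad k e v := tube C k e v /\ ~ (Om e v /\ `|F e v| <= rho e ^- k).
have mono k e v : Bad k.+1 e v -> Bad k e v.
  move=> [tv nOF]; split; first exact: tube_mono tv.
  move=> [Ov Fv]; apply: nOF; split=> //; apply: le_trans Fv _.
  exact: gauge_expV_le.
have frq k : ~ \forall e \near eps0 R, forall v, ~ Bad k e v.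
  move=> h; apply: nK; exists k; apply: filterS h => e h v tv.
  by apply: contrapT => nv; exact: (h v).
have [v [vT vB]] := @diagonal_net _ Bad c0 mono frq.
have [y Xy vy] : exists2 y, X y & is_repv v y.
  apply: CX => k; apply: filterS (vT k) => e [->|[]//].
  exact: tube_base.
have /moderateP[N hN] := mF.2 [::] y v Xy vy.
apply: (vB N); apply: filterS2 (dO.2 y Xy v vy) hN => e Ov Fv [_].
by apply; split.
Qed.

Lemma convex_comb_le (t a b r : R) : 0 <= t <= 1 -> a <= r -> b <= r ->
  (1 - t) * a + t * b <= r.
Proof.
move=> /andP[t0 t1] ar br; have t1' : 0 <= 1 - t by rewrite subr_ge0.
have := ler_wpM2l t1' ar; have := ler_wpM2l t0 br; lra.
Qed.

Lemma convex_comb_itv (t a b v w : R) : 0 <= t <= 1 -> a <= v <= b -> a <= w <= b ->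
  a <= w + t * (v - w) <= b.
Proof.
move=> t01 /andP[av vb] /andP[aw wb].
have := convex_comb_le t01 wb vb.
have := @convex_comb_le t (- w) (- v) (- a) t01; rewrite !lerN2 => /(_ aw av).
by move=> h1 h2; apply/andP; split; lra.
Qed.

Lemma convex_comb_dist n (v w c c' : 'rV[R]_n) (t r : R) : 0 <= t <= 1 ->
  `|w - c'| <= r -> `|v - c| <= r -> `|w + t *: (v - w) - (c' + t *: (c - c'))| <= r.
Proof.
move=> t01 wc vc; have /andP[t0 t1] := t01.
rewrite (_ : _ - _ = (1 - t) *: (w - c') + t *: (v - c)).
  rewrite (le_trans (ler_normD _ _))// !normrZ ger0_norm ?subr_ge0// (ger0_norm t0).
  exact: convex_comb_le.
by apply/rowP => i; rewrite !mxE; ring.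
Qed.

Lemma convex_ball_dist n (v w c : 'rV[R]_n) (t r : R) : 0 <= t <= 1 ->
  `|w - c| <= r -> `|v - c| <= r -> `|w + t *: (v - w) - c| <= r.
Proof.
move=> t01 wc vc; have := convex_comb_dist t01 wc vc.
by rewrite subrr scaler0 addr0.
Qed.

Definition convex_net n (C : idx R -> set 'rV[R]_n) := forall e c c' (t : R),
  C e c -> C e c' -> 0 <= t <= 1 -> C e (c' + t *: (c - c')).

Lemma tube_convex n (C : idx R -> set 'rV[R]_n) K e v w (t : R) : convex_net C ->
  tube C K e v -> tube C K e w -> 0 <= t <= 1 -> tube C K e (w + t *: (v - w)).
Proof.
move=> cC [c Cc vc] [c' Cc' wc] t01; exists (c' + t *: (c - c')); first exact: cC.
exact: convex_comb_dist.
Qed.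

(** Uniform bounds for the partial derivatives, together with the mean value
theorem on segments; this is where convexity is used. *)
Lemma lipschitz_bound n (X : set 'rV[gnum]_n) Om F C c0 :
  domain X Om -> mnet X Om F -> (forall e, C e (c0 e)) -> net_inside C X -> convex_net C ->
  exists K, \forall e \near eps0 R, forall v w, tube C K e v -> tube C K e w ->
    `|F e v - F e w| <= rho e ^- K * `|v - w|.
Proof.
move=> dO mF Cc CX cC.
have [K hK] := choice (fun i => uniform_bound dO (mnet_pder [:: i] mF) Cc CX).
have [K0 hK0] := uniform_bound dO mF Cc CX.
pose M := maxn K0 (\max_i K i).
exists M.+1; near=> e.
have h0 : forall v, tube C K0 e v -> Om e v /\ `|F e v| <= rho e ^- K0 by near: e.
have h i v : tube C (K i) e v -> Om e v /\ `|'D_('e_i) (F e) v| <= rho e ^- K i.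
  by move: i v; near: e; exact: filter_forall.
have hn : n%:R * rho e ^+ M.+1 <= rho e ^+ M by near: e; exact: natr_gexp.
move=> v w tv tw.
have M0 : (K0 <= M.+1)%N by rewrite leqW// leq_maxl.
have MK i : (K i <= M)%N by rewrite leq_max leq_bigmax orbT.
apply: (@le_trans _ _ (n%:R * rho e ^- M * `|v - w|)).
  apply: mvt_bound => t t01.
  have tb := tube_convex cC tv tw t01; split.
    by apply: (mF.1 e [::]); exact: (h0 _ (tube_mono M0 tb)).1.
  move=> i; apply: le_trans (h i _ (tube_mono (leqW (MK i)) tb)).2 _.
  exact: gauge_expV_le.
rewrite ler_wpM2r// ler_pdivrMr ?gexp_gt0// ler_pdivlMl ?gexp_gt0//.
by rewrite mulrC.
Unshelve. all: by end_near. Qed.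

(** Same diagonal argument as for uniform_bound, applied to negligible values. *)
Lemma uniform_negligible n (X : set 'rV[gnum]_n) (F : net n) C c0 :
  (forall x u, X x -> is_repv u x -> forall k, \forall e \near eps0 R, `|F e (u e)| <= rho e ^+ k) ->
  (forall e, C e (c0 e)) -> net_inside C X ->
  forall k, \forall e \near eps0 R, forall v, C e v -> `|F e v| <= rho e ^+ k.
Proof.
move=> nF Cc CX k; apply: contrapT => nk.
pose Bad (_ : nat) e v := C e v /\ ~ (`|F e v| <= rho e ^+ k).
have frq l : ~ \forall e \near eps0 R, forall v, ~ Bad l e v.
  move=> h; apply: nk; apply: filterS h => e h v tv.
  by apply: contrapT => nv; exact: (h v).
have [v [vT vB]] := @diagonal_net _ Bad c0 (fun _ _ _ => id) frq.
have [y Xy vy] : exists2 y, X y & is_repv v y.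
  by apply: CX => l; apply: filterS (vT l) => e [->|[]*]; exact: tube_base.
by apply: (vB 0%N); apply: filterS (nF y v Xy vy k) => e Fv [_]; exact.
Qed.

(** Values of a moderate smooth net at two representatives of the same point
differ by a negligible net, by the Lipschitz bound along one representative. *)
Lemma mnet_wd n (X : set 'rV[gnum]_n) Om F x u v : domain X Om -> mnet X Om F -> X x ->
  is_repv u x -> is_repv v x -> net_equiv rho (fun e => F e (u e)) (fun e => F e (v e)).
Proof.
move=> dO mF Xx ux vx.
pose C e := [set u e].
have cC : convex_net C by move=> e c c' t -> -> _; rewrite subrr scaler0 addr0.
have CX : net_inside C X.
  move=> w hw; exists x => //; apply: repv_close ux _ => k; apply: filterS (hw k) => e.
  by move=> [c ->].
have [K hK] := @lipschitz_bound _ _ _ _ C u dO mF (fun e => erefl) CX cC.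
move=> k; near=> e.
have h : forall v w, tube C K e v -> tube C K e w -> `|F e v - F e w| <= rho e ^- K * `|v - w|.
  by near: e.
have d1 : `|v e - u e| <= rho e ^+ K by near: e; exact: repv_dist ux vx.
have d2 : `|v e - u e| <= rho e ^+ (K + k) by near: e; exact: repv_dist ux vx.
apply: le_trans (h (u e) (v e) _ _) _; first exact: tube_base.
  by exists (u e).
by rewrite mulrC ler_pdivrMr ?gexp_gt0// -exprD addnC distrC.
Unshelve. all: by end_near. Qed.

(** The interior of X for the sharp topology, expressed on representatives and with
powers of the gauge as radii (sintE). *)
Definition net_interior n (X : set 'rV[gnum]_n) : set 'rV[gnum]_n := [set x |
  exists K, forall u v, is_repv u x -> (\forall e \near eps0 R, `|v e - u e| <= rho e ^+ K) ->
    exists2 y, X y & is_repv v y].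

Lemma net_interior_sub n (X : set 'rV[gnum]_n) : net_interior X `<=` X.
Proof.
move=> x [K h]; have [u ux] := repv_exists x.
have [|y Xy uy] := h u u ux; last by rewrite (repv_inj ux uy).
by apply: nearW => e; rewrite subrr normr0 ltW// gexp_gt0.
Qed.

Lemma net_interior_idem n (X : set 'rV[gnum]_n) :
  net_interior X `<=` net_interior (net_interior X).
Proof.
move=> x [K h]; exists K.+1 => u v ux uv.
have [|y Xy vy] := h u v ux.
  by apply: filterS uv => e he; apply: le_trans he (gexp_le _ (leqnSn _)).
exists y => //; exists K.+1 => u' v' u'y u'v'.
have d := repv_dist K.+1 u'y vy.
apply: (h u v' ux); near=> e.
have e1 : `|v e - u e| <= rho e ^+ K.+1 by near: e.
have e2 : `|v e - u' e| <= rho e ^+ K.+1 by near: e.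
have e3 : `|v' e - u' e| <= rho e ^+ K.+1 by near: e.
have e4 : 3%:R * rho e ^+ K.+1 <= rho e ^+ K by near: e; exact: natr_gexp.
have := ler_distD (u' e) (v' e) (u e); have := ler_distD (v e) (u' e) (u e).
rewrite (distrC (u' e) (v e)); lra.
Unshelve. all: by end_near. Qed.

(** As in Landau's inequality: with a step rho^p for a large p, the difference
quotient of F is negligible because F is, and it differs from the derivative by
at most the step times a Lipschitz constant of the derivative. *)
Lemma derive_negligible n (X : set 'rV[gnum]_n) Om F i :
  domain X Om -> mnet X Om F ->
  (forall x u, X x -> is_repv u x -> forall k, \forall e \near eps0 R, `|F e (u e)| <= rho e ^+ k) ->
  forall x u, net_interior X x -> is_repv u x ->
    forall k, \forall e \near eps0 R, `|'D_('e_i) (F e) (u e)| <= rho e ^+ k.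
Proof.
move=> dO mF nF x u xI ux k; have [K hK] := xI; have Xx := net_interior_sub xI.
pose C e := [set v | `|v - u e| <= rho e ^+ K.+1].
have Cu e : C e (u e) by rewrite /C/= subrr normr0 ltW// gexp_gt0.
have cC : convex_net C by move=> e c c' t Cc Cc' t01; exact: convex_ball_dist.
have CX : net_inside C X.
  move=> v hv; apply: (hK u) => //; near=> e.
  have [c Cc vc] : tube C K.+1 e (v e) by near: e.
  have e4 : 2%:R * rho e ^+ K.+1 <= rho e ^+ K by near: e; exact: natr_gexp.
  by have := ler_distD c (v e) (u e); rewrite /C/= in Cc; lra.
have [K1 h1] := uniform_bound dO mF Cu CX.
have [K2 h2] := lipschitz_bound dO (mnet_pder [:: i] mF) Cu CX cC.
(* The step rho^p absorbs the Lipschitz constant rho^-K2 and keeps u + rho^p e_i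
   in the region where F is defined. *)
pose p := (k + K + K1 + K2).+1.
pose w e := u e + rho e ^+ p *: 'e_i.
have wu e (t : R) : `|t| <= rho e ^+ p -> `|u e + t *: 'e_i - u e| <= rho e ^+ p.
  move=> tp; rewrite [u e + _]addrC addrK normrZ -[leRHS]mulr1 ler_pM//.
  exact: norm_delta.
have pK : (K <= p)%N by rewrite /p; lia.
have [y Xy wy] : exists2 y, X y & is_repv w y.
  apply: (hK u) => //; apply: nearW => e; apply: le_trans (wu e _ _) (gexp_le _ pK).
  by rewrite ger0_norm// ltW// gexp_gt0.
near=> e.
have n1 : `|F e (u e)| <= rho e ^+ (p + k.+2) by near: e; exact: nF ux _.
have n2 : `|F e (w e)| <= rho e ^+ (p + k.+2) by near: e; exact: nF wy _.
have b1 : forall v, tube C K1 e v -> Om e v /\ `|F e v| <= rho e ^- K1 by near: e.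
have b2 : forall v w, tube C K2 e v -> tube C K2 e w ->
   `|'D_('e_i) (F e) v - 'D_('e_i) (F e) w| <= rho e ^- K2 * `|v - w| by near: e.
have Ct (t : R) : `|t| <= rho e ^+ p -> C e (u e + t *: 'e_i).
  by move=> tp; apply: le_trans (wu e t tp) (gexp_le _ _); rewrite /p; lia.
have rp : `|rho e ^+ p| = rho e ^+ p by rewrite ger0_norm// ltW// gexp_gt0.
have dl (t : R) : `|t| <= `|rho e ^+ p| -> derivable (F e) (u e + t *: 'e_i) 'e_i.
  rewrite rp => tp; apply: diff_derivable; apply: (mF.1 e [::]).
  exact: (b1 _ (tube_base _ (Ct t tp))).1.
have [t tp E] := mvt_line dl; rewrite rp in tp.
have d1 : `|'D_('e_i) (F e) (u e + t *: 'e_i)| <= 2 * rho e ^+ k.+2.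
  rewrite -(ler_pM2l (gexp_gt0 (rho := rho) p e)) -{1}rp -normrM -E.
  rewrite mulrCA -exprD (le_trans (ler_normB _ _))// mulr_natl mulr2n lerD//.
have d2 : `|'D_('e_i) (F e) (u e) - 'D_('e_i) (F e) (u e + t *: 'e_i)| <= rho e ^+ k.+1.
  apply: le_trans (b2 _ _ _ _) _; [exact: tube_base|exact: tube_base (Ct t tp)|].
  rewrite mulrC ler_pdivrMr ?gexp_gt0// -exprD distrC (le_trans (wu e t tp))//.
  by apply: gexp_le; rewrite /p; lia.
have e4 : 3%:R * rho e ^+ k.+1 <= rho e ^+ k by near: e; exact: natr_gexp.
have e5 : rho e ^+ k.+2 <= rho e ^+ k.+1 by exact: gexp_le.
have := ler_normD ('D_('e_i) (F e) (u e) - 'D_('e_i) (F e) (u e + t *: 'e_i))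
  ('D_('e_i) (F e) (u e + t *: 'e_i)).
rewrite subrK; move: d1 d2 e4 e5.
move: (`|'D_('e_i) (F e) (u e)|) (`|_ - _|) (`|'D_('e_i) (F e) (u e + _)|) => a b c; lra.
Unshelve. all: by end_near. Qed.

Lemma domain_sub n (X Y : set 'rV[gnum]_n) Om : Y `<=` X -> domain X Om -> domain Y Om.
Proof. by move=> YX [oO XO]; split=> // x /YX; exact: XO. Qed.

(** Derivatives of generalized functions do not depend on the defining net: the
difference of two defining nets satisfies the hypothesis. *)
Lemma pder_negligible n (X : set 'rV[gnum]_n) Om F alpha :
  domain X Om -> mnet X Om F ->
  (forall x u, X x -> is_repv u x -> forall k, \forall e \near eps0 R, `|F e (u e)| <= rho e ^+ k) ->
  forall x u, net_interior X x -> is_repv u x ->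
    forall k, \forall e \near eps0 R, `|pder alpha (F e) (u e)| <= rho e ^+ k.
Proof.
move=> dO mF nF; elim: alpha => [|i alpha ih] x u xI ux.
  by apply: nF ux; exact: net_interior_sub.
apply: (derive_negligible i (domain_sub (@net_interior_sub n X) dO)
  (mnet_sub (@net_interior_sub n X) (mnet_pder alpha mF)) ih) ux.
exact: net_interior_idem.
Qed.

End UniformBounds.

(** * Gradients of generalized functions *)

Section GradientCalculus.
Context {R : realType} {rho : gauge R}.
Local Notation gnum := (gnum rho).
Local Notation net n := (idx R -> 'rV[R]_n -> R).

(** The net F on Om represents the scalar function f on X. *)
Definition snet n (X : set 'rV[gnum]_n) Om (F : net n) (f : 'rV[gnum]_n -> gnum) :=
  [/\ domain X Om, mnet X Om F &
      forall x u, X x -> is_repv u x -> is_rep (fun e => F e (u e)) (f x)].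

(** The functions g_i are the partial derivatives of f on X, in the sense that one
net representing f has partial derivatives representing the g_i. This is the
working notion of derivative: unlike gpd it does not involve the position of
the point in X, and the usual rules hold for it without further
hypotheses. *)
Definition sgrad n (X : set 'rV[gnum]_n) (f : 'rV[gnum]_n -> gnum)
    (g : 'I_n -> 'rV[gnum]_n -> gnum) :=
  exists Om F, snet X Om F f /\ forall i, snet X Om (fun e => pder [:: i] (F e)) (g i).

Lemma snet_near n (X : set 'rV[gnum]_n) Om F f x u : snet X Om F f -> X x ->
  is_repv u x -> \forall e \near eps0 R, Om e (u e).
Proof. by move=> [[_ XO] _ _] Xx ux; exact: XO ux. Qed.

Lemma snetW n (X : set 'rV[gnum]_n) Om Om' F f : domain X Om' ->
  (forall e, Om' e `<=` Om e) -> snet X Om F f -> snet X Om' F f.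
Proof. by move=> dO OO [_ mF vF]; split=> //; apply: mnetW mF. Qed.

Lemma snet_sub n (X Y : set 'rV[gnum]_n) Om F f : Y `<=` X -> snet X Om F f -> snet Y Om F f.
Proof.
move=> YX [[oO XO] mF vF]; split; first by split=> // x /YX; exact: XO.
  exact: mnet_sub mF.
by move=> x u /YX; exact: vF.
Qed.

Lemma snet_eq n (X : set 'rV[gnum]_n) Om F f f' : (forall x, X x -> f x = f' x) ->
  snet X Om F f -> snet X Om F f'.
Proof. by move=> ff [dO mF vF]; split=> // x u Xx; rewrite -ff//; exact: vF. Qed.

Lemma snet_pder n (X : set 'rV[gnum]_n) Om F f alpha : snet X Om F f ->
  exists g, snet X Om (fun e => pder alpha (F e)) g.
Proof.
move=> [dO mF vF].
have H (x : 'rV[gnum]_n) : exists y : gnum, X x -> forall u, is_repv u x ->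
    is_rep (fun e => pder alpha (F e) (u e)) y.
  have [Xx|nXx] := pselect (X x); last by exists 0.
  have [u ux] := repv_exists x.
  have mFa := mnet_pder alpha mF.
  have [y uy] := moderate_rep (mFa.2 [::] x u Xx ux).
  exists y => _ v vx; apply: rep_equiv uy _; exact: (mnet_wd dO mFa Xx ux vx).
have [g hg] := choice H.
exists g; split=> // [|x u Xx]; first exact: mnet_pder.
exact: hg.
Qed.

Lemma sgrad_snet n (X : set 'rV[gnum]_n) f g i : sgrad X f g ->
  exists Om F, snet X Om F (g i).
Proof. by move=> [Om [F [_ h]]]; exists Om, (fun e => pder [:: i] (F e)); exact: h. Qed.

Lemma sgrad_sub n (X Y : set 'rV[gnum]_n) f g : Y `<=` X -> sgrad X f g -> sgrad Y f g.
Proof.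
move=> YX [Om [F [sF sG]]]; exists Om, F; split; first exact: snet_sub sF.
by move=> i; apply: snet_sub (sG i).
Qed.

Lemma sgrad_eq n (X : set 'rV[gnum]_n) f f' g g' :
  (forall x, X x -> f x = f' x) -> (forall i x, X x -> g i x = g' i x) ->
  sgrad X f g -> sgrad X f' g'.
Proof.
move=> ff gg [Om [F [sF sG]]]; exists Om, F; split; first exact: snet_eq sF.
by move=> i; apply: snet_eq (sG i) => x; exact: gg.
Qed.

(** Each differentiation rule below has this form: an operation on nets, whose
regularity is given by alg, and the rule for the real derivative. *)
Lemma sgrad_alg n (X : set 'rV[gnum]_n) Om F f (G : 'I_n -> net n) g :
  domain X Om -> alg X Om F ->
  (forall x u, X x -> is_repv u x -> is_rep (fun e => F e (u e)) (f x)) ->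
  (forall i e x, Om e x -> 'D_('e_i) (F e) x = G i e x) ->
  (forall i x u, X x -> is_repv u x -> is_rep (fun e => G i e (u e)) (g i x)) ->
  sgrad X f g.
Proof.
move=> dO aF vF EG vG; have mF := alg_mnet dO aF.
exists Om, F; split=> // i; split=> //; first exact: (mnet_pder [:: i] mF).
move=> x u Xx ux; apply: near_rep (vG i x u Xx ux).
by apply: filterS (dO.2 x Xx u ux) => e /EG <-.
Qed.

Lemma snet_alg n (X : set 'rV[gnum]_n) Om F f : snet X Om F f -> alg X Om F.
Proof. by move=> [_ mF _]; exact: alg_base. Qed.

Lemma snet_diff n (X : set 'rV[gnum]_n) Om F f e x : snet X Om F f -> Om e x ->
  differentiable (F e) x.
Proof. by move=> [_ [sF _] _]; exact: (sF e [::]). Qed.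

Lemma domain_setT n (X : set 'rV[gnum]_n) : domain X (fun=> setT).
Proof. by split=> [e|x _ u _]; [exact: openT|exact: nearW]. Qed.

Lemma sgrad_cst n (X : set 'rV[gnum]_n) c : sgrad X (fun=> c) (fun _ _ => 0).
Proof.
have [u uc] := rep_exists c.
apply: (@sgrad_alg _ _ (fun=> setT) (fun e _ => u e) _ (fun _ _ _ => 0)) => //.
- exact: domain_setT.
- by apply: alg_cst; [exact: domain_setT|exact: rep_moderate uc].
- by move=> i e x _; rewrite derive_cst.
- by move=> i x v _ _; exact: rep0.
Qed.

Lemma sgrad_coord n (X : set 'rV[gnum]_n) j :
  sgrad X (fun x => x 0 j) (fun i _ => (j == i)%:R).
Proof.
apply: (@sgrad_alg _ _ (fun=> setT) (fun _ x => x 0 j) _ (fun i _ _ => (j == i)%:R)) => //.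
- exact: domain_setT.
- by apply: alg_base; apply: mnet_coord; exact: domain_setT.
- by move=> i e x _; rewrite derive_coord mxE eqxx.
- by move=> i x v _ _; exact: rep_nat.
Qed.

Lemma sgradD n (X : set 'rV[gnum]_n) f f' g g' : sgrad X f f' -> sgrad X g g' ->
  sgrad X (fun x => f x + g x) (fun i x => f' i x + g' i x).
Proof.
move=> [OmF [F [sF sF']]] [OmG [G [sG sG']]].
have dO : domain X (fun e => OmF e `&` OmG e).
  by apply: domainI; [have [] := sF|have [] := sG].
have {}sF := snetW dO (fun e => @subIsetl _ _ _) sF.
have {}sG := snetW dO (fun e => @subIsetr _ _ _) sG.
apply: (@sgrad_alg _ _ _ (fun e x => F e x + G e x) _
  (fun i e x => pder [:: i] (F e) x + pder [:: i] (G e) x) _ dO).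
- by apply: alg_add; apply: snet_alg; eassumption.
- by move=> x u Xx ux; have [_ _ vF] := sF; have [_ _ vG] := sG; apply: repD; auto.
- move=> i e x Ox.
  exact: (deriveD (diff_derivable (snet_diff sF Ox)) (diff_derivable (snet_diff sG Ox))).
- by move=> i x u Xx ux; have [_ _ vF] := sF' i; have [_ _ vG] := sG' i; apply: repD; auto.
Qed.

Lemma sgradM n (X : set 'rV[gnum]_n) f f' g g' : sgrad X f f' -> sgrad X g g' ->
  sgrad X (fun x => f x * g x) (fun i x => f x * g' i x + g x * f' i x).
Proof.
move=> [OmF [F [sF sF']]] [OmG [G [sG sG']]].
have dO : domain X (fun e => OmF e `&` OmG e).
  by apply: domainI; [have [] := sF|have [] := sG].
have {}sF := snetW dO (fun e => @subIsetl _ _ _) sF.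
have {}sG := snetW dO (fun e => @subIsetr _ _ _) sG.
apply: (@sgrad_alg _ _ _ (fun e x => F e x * G e x) _
  (fun i e x => F e x * pder [:: i] (G e) x + G e x * pder [:: i] (F e) x) _ dO).
- by apply: alg_mul; apply: snet_alg; eassumption.
- by move=> x u Xx ux; have [_ _ vF] := sF; have [_ _ vG] := sG; apply: repM; auto.
- move=> i e x Ox.
  exact: (deriveM (diff_derivable (snet_diff sF Ox)) (diff_derivable (snet_diff sG Ox))).
- move=> i x u Xx ux; have [_ _ vF] := sF; have [_ _ vG] := sG.
  have [_ _ vF'] := sF' i; have [_ _ vG'] := sG' i.
  by apply: repD; apply: repM; auto.
Qed.

Lemma sgrad_sum n (X : set 'rV[gnum]_n) (I : Type) (r : seq I) f f' :
  (forall j, sgrad X (f j) (f' j)) ->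
  sgrad X (fun x => \sum_(j <- r) f j x) (fun i x => \sum_(j <- r) f' j i x).
Proof.
move=> h; elim: r => [|j r ih].
  by apply: sgrad_eq (sgrad_cst X 0) => [x|i x] _; rewrite big_nil.
by apply: sgrad_eq (sgradD (h j) ih) => [x|i x] _; rewrite big_cons.
Qed.

Lemma sgradN n (X : set 'rV[gnum]_n) f f' : sgrad X f f' ->
  sgrad X (fun x => - f x) (fun i x => - f' i x).
Proof.
move=> h; apply: sgrad_eq (sgradM (sgrad_cst X (-1)) h) => [x|i x] _.
  by rewrite mulN1r.
by rewrite mulr0 addr0 mulN1r.
Qed.

Lemma sgradB n (X : set 'rV[gnum]_n) f f' g g' : sgrad X f f' -> sgrad X g g' ->
  sgrad X (fun x => f x - g x) (fun i x => f' i x - g' i x).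
Proof. by move=> hf hg; apply: sgradD hf (sgradN hg). Qed.

Lemma open_preimage_on n k (Om : set 'rV[R]_n) (Om' : set 'rV[R]_k)
    (g : 'rV[R]_n -> 'rV[R]_k) : open Om -> open Om' ->
  (forall x, Om x -> {for x, continuous g}) -> open [set x | Om x /\ Om' (g x)].
Proof.
move=> oO oO' cg; rewrite openE => x [Ox Ogx].
apply: filterS2 (open_nbhs_nbhs (conj oO Ox)) (cg x Ox _ (open_nbhs_nbhs (conj oO' Ogx))).
by move=> y.
Qed.

Lemma open_forall_fin n (I : finType) (A : I -> set 'rV[R]_n) :
  (forall i, open (A i)) -> open [set x | forall i, A i x].
Proof.
move=> oA; rewrite openE => x Ax.
have nA i : \forall y \near x, A i y by exact: open_nbhs_nbhs (conj (oA i) (Ax i)).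
exact: filter_forall nA.
Qed.

Lemma sgrad_comp n k (X : set 'rV[gnum]_n) (Y : set 'rV[gnum]_k) G dG
    (f : 'I_k -> 'rV[gnum]_n -> gnum) df :
  sgrad Y G dG -> (forall j, sgrad X (f j) (df j)) ->
  (forall x, X x -> Y (\row_j f j x)) ->
  sgrad X (fun x => G (\row_j f j x)) (fun i x => \sum_j dG j (\row_j f j x) * df j i x).
Proof.
move=> [OmH [H [sH sH']]] hf XY.
have [Of hf1] := choice hf.
have [F hF] := choice hf1.
pose Om1 e := [set x | forall j, Of j e x].
have d1 : domain X Om1.
  split=> [e|x Xx u ux]; first by apply: open_forall_fin => j; have [[[]]] := hF j.
  exact: filter_forall (fun j => snet_near (hF j).1 Xx ux).
have sF j : snet X Om1 (F j) (f j) by apply: snetW (hF j).1 => // e x; exact.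
have vF x u : X x -> is_repv u x -> is_repv (fun e => \row_j F j e (u e)) (\row_j f j x).
  by move=> Xx ux; apply: repv_row => j; have [_ _] := sF j; apply.
have dF e x : Om1 e x -> differentiable (fun y => \row_j F j e y) x.
  by move=> Ox; apply: differentiable_row => j; exact: snet_diff (sF j) Ox.
pose Om e := [set x | Om1 e x /\ OmH e (\row_j F j e x)].
have dO : domain X Om.
  split=> [e|x Xx u ux].
    apply: open_preimage_on; [exact: d1.1|by have [[]] := sH|].
    by move=> x Ox; exact: differentiable_continuous (dF e x Ox).
  apply: filterS2 (d1.2 x Xx u ux) (snet_near sH (XY x Xx) (vF x u Xx ux)).
  by move=> e.
have {}sF j : snet X Om (F j) (f j) by apply: snetW (sF j) => // e x [].
apply: (@sgrad_alg _ _ Om (fun e x => H e (\row_j F j e x)) _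
  (fun i e x => \sum_j pder [:: j] (H e) (\row_j F j e x) * pder [:: i] (F j e) x)) => //.
- have [_ mH _] := sH.
  apply: (alg_comp mH) => [j|e x []|x u Xx ux] //; first exact: snet_alg (sF j).
  by exists (\row_j f j x); [exact: XY|exact: vF].
- by move=> x u Xx ux; have [_ _ vH] := sH; apply: vH; [exact: XY|exact: vF].
- move=> i e x Ox; rewrite derive_comp_row//.
    by move=> j; exact: snet_diff (sF j) Ox.
  exact: snet_diff sH Ox.2.
- move=> i x u Xx ux; apply: rep_sum => j; apply: repM.
    by have [_ _ vH] := sH' j; apply: vH; [exact: XY|exact: vF].
  by have [_ _] := (hF j).2 i; apply.
Qed.

(** The domains are shrunk to the open sets where the representing functions do
not vanish; invertibility of f x guarantees that representatives of x end up
there. *)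
Lemma sgradV n (X : set 'rV[gnum]_n) f f' : sgrad X f f' ->
  (forall x, X x -> f x \is a GRing.unit) ->
  sgrad X (fun x => (f x)^-1) (fun i x => - ((f x)^-1 * (f x)^-1 * f' i x)).
Proof.
move=> [OmF [F [sF sF']]] fU.
pose Om e := [set x | OmF e x /\ F e x != 0].
have dO : domain X Om.
  split=> [e|x Xx u ux].
    rewrite openE => x [Ox Fx0].
    have [[oO _] _ _] := sF.
    have cF : {for x, continuous (F e)}.
      by apply: differentiable_continuous; exact: snet_diff sF Ox.
    have F0 : nbhs (F e x) [set y | y != 0].
      by apply: open_nbhs_nbhs; split=> //; exact: open_neq.
    by apply: filterS2 (open_nbhs_nbhs (conj (oO e) Ox)) (cF _ F0) => y.
  have [_ _ vF] := sF.
  apply: filterS2 (snet_near sF Xx ux) (unit_rep_neq0 (vF x u Xx ux) (fU x Xx)).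
  by move=> e.
have {}sF : snet X Om F f by apply: snetW sF => // e x [].
have vI x u : X x -> is_repv u x -> is_rep (fun e => (F e (u e))^-1) (f x)^-1.
  by move=> Xx ux; have [_ _ vF] := sF; apply: repV; [exact: vF|exact: fU].
apply: (@sgrad_alg _ _ Om (fun e x => (F e x)^-1) _
  (fun i e x => - ((F e x)^-1 * (F e x)^-1 * pder [:: i] (F e) x))) => //.
- apply: alg_inv; [exact: snet_alg sF|by move=> e x []|].
  by move=> x u Xx ux; exact: rep_moderate (vI x u Xx ux).
- move=> i e x Ox.
  have /= -> := @deriveV _ _ (F e) x 'e_i Ox.2 (diff_derivable (snet_diff sF Ox)).
  by rewrite -invfM -expr2 scaleNr.
- move=> i x u Xx ux; apply: repN; apply: repM; first by apply: repM; exact: vI.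
  by have [_ _] := sF' i; apply.
Qed.

End GradientCalculus.

(** * The sharp topology *)

Section SharpTopology.
Context {R : realType} {rho : gauge R}.
Local Notation gnum := (gnum rho).
Local Notation net n := (idx R -> 'rV[R]_n -> R).

Lemma enorm_ge_coord n (v : 'rV[R]_n) i : `|v 0 i| <= enorm v.
Proof.
rewrite /enorm -sqrtr_sqr ler_wsqrtr// (bigD1 i)//= lerDl sumr_ge0// => j _.
exact: sqr_ge0.
Qed.

Lemma enorm_ge0 n (v : 'rV[R]_n) : 0 <= enorm v.
Proof. exact: sqrtr_ge0. Qed.

Lemma norm_le_enorm n (v : 'rV[R]_n) : `|v| <= enorm v.
Proof. by apply: rv_norm_le; [exact: enorm_ge0|exact: enorm_ge_coord]. Qed.

Lemma enorm_le n (v : 'rV[R]_n) : enorm v <= n%:R * `|v|.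
Proof.
rewrite -[leRHS]ger0_norm ?mulr_ge0// -sqrtr_sqr /enorm ler_wsqrtr//.
have h i : v 0 i ^+ 2 <= `|v| ^+ 2.
  by rewrite -[v 0 i ^+ 2]real_normK ?num_real// lerXn2r ?nnegrE// rv_coord_le.
apply: le_trans (ler_sum _ (fun i _ => h i)) _.
rewrite sumr_const card_ord -[leLHS]mulr_natl exprMn ler_wpM2r ?sqr_ge0//.
by rewrite -natrX ler_nat; case: (n) => // k; rewrite leq_pmulr.
Qed.

Lemma repv_moderate n u (x : 'rV[gnum]_n) : is_repv u x ->
  (fun e => `|u e|) \in moderate rho.
Proof.
move=> ux; apply: (@near_moderate _ _ (fun e => \sum_i `|u e 0 i|)).
  apply: nearW => e; rewrite normr_id [leRHS]ger0_norm ?sumr_ge0//.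
  apply: rv_norm_le; first exact: sumr_ge0.
  by move=> i; rewrite (bigD1 i)//= lerDl sumr_ge0.
apply: moderate_sum => i; apply: near_moderate (rep_moderate (ux i)).
by apply: nearW => e; rewrite normr_id.
Qed.

(** A net at moderate distance of a moderate one is moderate. *)
Lemma repv_nearby n u v (x : 'rV[gnum]_n) (r : idx R -> R) : is_repv u x ->
  r \in moderate rho -> (\forall e \near eps0 R, `|v e - u e| <= r e) ->
  exists y : 'rV[gnum]_n, is_repv v y.
Proof.
move=> ux mr uv; apply: moderate_repv => j.
apply: (@near_moderate _ _ (fun e => r e + `|u e|)); last first.
  exact: rpredD mr (repv_moderate ux).
apply: filterS uv => e uv; apply: le_trans (rv_coord_le _ _) (le_trans _ (ler_norm _)).
by have := ler_normD (v e - u e) (u e); rewrite subrK; lra.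
Qed.

Lemma enorm_moderate n u (x : 'rV[gnum]_n) : is_repv u x ->
  (fun e => enorm (u e)) \in moderate rho.
Proof.
move=> /repv_moderate mu; apply: (@near_moderate _ _ (fun e => n%:R * `|u e|)).
  apply: nearW => e; rewrite !ger0_norm ?enorm_ge0 ?mulr_ge0//; exact: enorm_le.
by apply: rpredM; first exact: moderate_cst.
Qed.

(** The Euclidean norm depends Hoelder-continuously on the coordinates, which is
sufficient for it to be well defined on classes. *)
Lemma sqrt_dist (a b : R) : 0 <= a -> 0 <= b ->
  `|Num.sqrt a - Num.sqrt b| ^+ 2 <= `|a - b|.
Proof.
wlog ab : a b / b <= a.
  by move=> h a0 b0; have [ba|/ltW ba] := leP b a; [|rewrite distrC (distrC a)]; exact: h.
move=> a0 b0; rewrite real_normK ?num_real// ger0_norm ?subr_ge0// sqrrB !sqr_sqrtr//.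
have : b <= Num.sqrt a * Num.sqrt b.
  by rewrite -{1}(sqr_sqrtr b0) expr2 ler_wpM2r ?sqrtr_ge0// ler_wsqrtr.
rewrite mulr2n; lra.
Qed.

Lemma gnormP n u (x : 'rV[gnum]_n) : is_repv u x -> is_rep (fun e => enorm (u e)) (Defs.gnorm x).
Proof.
move=> ux; have [y uy] := moderate_rep (enorm_moderate ux).
rewrite /Defs.gnorm; case: xgetP => [z _ [v vx vz]|/(_ y)]; last by case; exists u.
apply: rep_equiv vz _ => k.
have H : net_equiv rho (fun e => \sum_i v e 0 i ^+ 2) (fun e => \sum_i u e 0 i ^+ 2).
  apply/(rep_eqP (rep_sum _ _ (fun i => repX 2 (vx i))) (rep_sum _ _ (fun i => repX 2 (ux i)))).
  by [].
apply: filterS (H (k * 2)%N) => e he.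
rewrite -(@ler_pXn2r _ 2)// ?nnegrE ?(ltW (gexp_gt0 _ _))// -exprM.
by apply: le_trans he; apply: sqrt_dist; apply: sumr_ge0 => i _; exact: sqr_ge0.
Qed.

Lemma rho_moderate : (fun e => rho e) \in moderate rho.
Proof. exact: (gexp_moderate 1). Qed.

Definition grho : gnum := projT1 (cid (moderate_rep rho_moderate)).

Lemma rep_rho k : is_rep (fun e => rho e ^+ k) (grho ^+ k).
Proof. by apply: repX; rewrite /grho; case: cid. Qed.

Lemma glt0P u (x : gnum) : is_rep u x ->
  (glt 0 x <-> exists K, \forall e \near eps0 R, rho e ^+ K <= u e).
Proof.
move=> ux; rewrite (gltP rep0 ux).
by split=> -[K h]; exists K; apply: filterS h => e; rewrite add0r.
Qed.

Lemma grho_gt0 k : glt 0 (grho ^+ k).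
Proof. by apply/(glt0P (rep_rho k)); exists k; apply: nearW => e. Qed.

Lemma repvB n u v (x y : 'rV[gnum]_n) : is_repv u x -> is_repv v y ->
  is_repv (fun e => u e - v e) (x - y).
Proof.
move=> ux vy i; rewrite !mxE; under eq_fun do rewrite !mxE.
exact: repB.
Qed.

Lemma sball_close n (r : gnum) : glt 0 r -> exists K, forall (c x : 'rV[gnum]_n) cu xu,
  is_repv cu c -> is_repv xu x ->
  (\forall e \near eps0 R, `|xu e - cu e| <= rho e ^+ K) -> sball c r x.
Proof.
have [ru rr] := rep_exists r; move=> /(glt0P rr)[K hK].
exists K.+2 => c x cu xu cc xx h.
apply/(gltP (gnormP (repvB xx cc)) rr); exists K.+1; near=> e.
have h1 : `|xu e - cu e| <= rho e ^+ K.+2 by near: e.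
have h2 : rho e ^+ K <= ru e by near: e.
have h3 : n%:R * rho e ^+ K.+2 <= rho e ^+ K.+1 by near: e; exact: natr_gexp.
have h4 : 2%:R * rho e ^+ K.+1 <= rho e ^+ K by near: e; exact: natr_gexp.
have h5 := enorm_le (xu e - cu e).
have h6 : n%:R * `|xu e - cu e| <= n%:R * rho e ^+ K.+2 by rewrite ler_wpM2l.
lra.
Unshelve. all: by end_near. Qed.

Lemma sball_far n K (c x : 'rV[gnum]_n) cu xu : is_repv cu c -> is_repv xu x ->
  sball c (grho ^+ K) x -> \forall e \near eps0 R, `|xu e - cu e| <= rho e ^+ K.
Proof.
move=> cc xx /(gltP (gnormP (repvB xx cc)) (rep_rho K))[K' h].
apply: filterS h => e h; apply: le_trans (norm_le_enorm _) _.
by have := gexp_gt0 (rho := rho) K' e; lra.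
Qed.

(** Balls of generalized radius and neighbourhoods of size a power of the gauge
are mutually cofinal. *)
Lemma sintE n (X : set 'rV[gnum]_n) : sint X = net_interior X.
Proof.
apply/seteqP; split=> x.
  move=> [r r0 rX]; have [K hK] := @sball_close n r r0.
  exists K.+1 => u v ux uv.
  have [y vy] := repv_nearby ux (gexp_moderate K.+1) uv.
  exists y => //; apply: rX; apply: hK ux vy _; apply: filterS uv => e.
  by move=> /le_trans; apply; exact: gexp_le.
move=> [K h]; exists (grho ^+ K); first exact: grho_gt0.
move=> y hy; have [xu xx] := repv_exists x; have [yu yy] := repv_exists y.
have [z Xz yz] := h xu yu xx (sball_far xx yy hy).
by rewrite (repv_inj yy yz).
Qed.

Lemma sint_sub n (X : set 'rV[gnum]_n) : sint X `<=` X.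
Proof. by rewrite sintE; exact: net_interior_sub. Qed.

End SharpTopology.

(** * Derivatives at interior points *)

Section GeneralizedDerivatives.
Context {R : realType} {rho : gauge R}.
Local Notation gnum := (gnum rho).
Local Notation net n := (idx R -> 'rV[R]_n -> R).

Lemma defines_domain n k (X : set 'rV[gnum]_n) Om fe (f : _ -> 'rV[gnum]_k) :
  defines X Om fe f -> domain X Om.
Proof. by move=> [oO XO _]; split=> // e; have [] := oO e. Qed.

Lemma defines_snet n k (X : set 'rV[gnum]_n) Om fe (f : _ -> 'rV[gnum]_k) j :
  defines X Om fe f -> snet X Om (fun e x => fe e x 0 j) (fun x => f x 0 j).
Proof.
move=> df; have dO := defines_domain df; have [oO XO vf] := df.
split=> //; last by move=> x u Xx ux; have [] := vf x u Xx ux.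
split=> [e|alpha x u Xx ux]; first by have [oe se] := oO e; have [] := smooth_on_coord j oe se.
have [_ /(_ alpha) h] := vf x u Xx ux.
apply: near_moderate h; apply: filterS (XO x Xx u ux) => e Oe.
have [oe se] := oO e; have [_ ->//] := smooth_on_coord j oe se.
by rewrite [leRHS]ger0_norm ?enorm_ge0//; exact: enorm_ge_coord.
Qed.

Lemma defines_pd n k (X : set 'rV[gnum]_n) Om fe (f : _ -> 'rV[gnum]_k) j alpha e x :
  defines X Om fe f -> Om e x -> pder alpha (fun x => fe e x 0 j) x = pd alpha (fe e) x 0 j.
Proof.
move=> [oO _ _] Oe; have [oe se] := oO e.
by have [_] := smooth_on_coord j oe se; apply.
Qed.

Lemma snet_defines n k (X : set 'rV[gnum]_n) Om (F : 'I_k -> net n) (f : _ -> 'rV[gnum]_k) :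
  domain X Om -> (forall j, snet X Om (F j) (fun x => f x 0 j)) ->
  defines X Om (fun e x => \row_j F j e x) f.
Proof.
move=> dO sF; have [oO XO] := dO.
have sFe e j : smooth (Om e) (F j e) by have [_ [] //] := sF j.
have sR e := smooth_on_row (oO e) (sFe e).
split=> // [e|x u Xx ux]; first by split; [exact: oO|exact: (sR e).1].
split.
  by move=> j; under eq_fun do rewrite mxE; have [_ _] := sF j; apply.
move=> alpha.
have [y hy] : exists y, is_repv (rho := rho) (fun e => \row_j pder alpha (F j e) (u e)) y.
  apply: moderate_repv => j; under eq_fun do rewrite mxE.
  by have [_ [_ mF] _] := sF j; exact: mF ux.
apply: near_moderate (enorm_moderate hy).
by apply: filterS (XO x Xx u ux) => e Oe; rewrite (sR e).2.
Qed.

Lemma pderB n (Om : set 'rV[R]_n) f g alpha x : open Om -> smooth Om f -> smooth Om g ->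
  Om x -> pder alpha (fun y => f y - g y) x = pder alpha f x - pder alpha g x.
Proof.
move=> oO sf sg; elim: alpha x => [//|i alpha ih] x Ox /=.
rewrite (@near_eq_derive _ _ _ _ (pder alpha f - pder alpha g)); last first.
  by apply: eq_near_open Ox => // y; exact: ih.
by apply: deriveB; apply: diff_derivable; [exact: sf|exact: sg].
Qed.

(** The difference of the two nets has negligible values on X, hence negligible
derivatives in the interior. *)
Lemma snet_unique n (X : set 'rV[gnum]_n) Om1 F Om2 G f alpha x u :
  snet X Om1 F f -> snet X Om2 G f -> net_interior X x -> is_repv u x ->
  net_equiv rho (fun e => pder alpha (F e) (u e)) (fun e => pder alpha (G e) (u e)).
Proof.
move=> sF sG xI ux.
have dO : domain X (fun e => Om1 e `&` Om2 e).
  by apply: domainI; [have [] := sF|have [] := sG].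
have {}sF := snetW dO (fun e => @subIsetl _ _ _) sF.
have {}sG := snetW dO (fun e => @subIsetr _ _ _) sG.
have [_ mF vF] := sF; have [_ mG vG] := sG.
have aD : alg X (fun e => Om1 e `&` Om2 e) (fun e y => F e y + -1 * G e y).
  apply: alg_add; first exact: alg_base.
  by apply: alg_mul; [apply: alg_cst => //; exact: moderate_cst|exact: alg_base].
have neg y v : X y -> is_repv v y -> forall k, \forall e \near eps0 R,
    `|F e (v e) + -1 * G e (v e)| <= rho e ^+ k.
  move=> Xy vy k; have := (rep_eqP (vF y v Xy vy) (vG y v Xy vy)).1 erefl k.
  by apply: filterS => e; rewrite mulN1r.
move=> k.
have Xx := net_interior_sub xI.
apply: filterS2 (dO.2 x Xx u ux) (pder_negligible alpha dO (alg_mnet dO aD) neg xI ux k) => e Oe.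
have -> : (fun y => F e y + -1 * G e y) = (fun y => F e y - G e y).
  by apply/funext => y; rewrite mulN1r.
by rewrite (pderB alpha (dO.1 e) (mF.1 e) (mG.1 e) Oe).
Qed.

Lemma snet_unique_interior n (X : set 'rV[gnum]_n) Om1 F Om2 G f alpha x u v (y : gnum) :
  snet X Om1 F f -> snet X Om2 G f -> net_interior X x -> is_repv u x -> is_repv v x ->
  is_rep (fun e => pder alpha (F e) (u e)) y -> is_rep (fun e => pder alpha (G e) (v e)) y.
Proof.
move=> sF sG xI ux vx Fy; have Xx := net_interior_sub xI.
have [dF mF _] := sF.
have Fy' := rep_equiv Fy (mnet_wd dF (mnet_pder alpha mF) Xx ux vx).
exact: rep_equiv Fy' (snet_unique alpha sF sG xI vx).
Qed.

Lemma repv_pd n k (X : set 'rV[gnum]_n) Om fe (f : _ -> 'rV[gnum]_k) alpha x u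
    (y : 'rV[gnum]_k) :
  defines X Om fe f -> X x -> is_repv u x ->
  (is_repv (fun e => pd alpha (fe e) (u e)) y <->
   forall j, is_rep (fun e => pder alpha (fun x => fe e x 0 j) (u e)) (y 0 j)).
Proof.
move=> df Xx ux; have [_ XO _] := df.
by split=> h j; apply: near_rep (h j); apply: filterS (XO x Xx u ux) => e Oe;
  rewrite (defines_pd j alpha df Oe).
Qed.

Lemma gpd_int_unique n k (X : set 'rV[gnum]_n) Om fe (f : _ -> 'rV[gnum]_k) alpha x u y :
  defines X Om fe f -> sint X x -> is_repv u x -> is_gpd_int X alpha f x y ->
  is_repv (fun e => pd alpha (fe e) (u e)) y.
Proof.
rewrite sintE => df xI ux [Om' [ge [v [dg vx gy]]]]; have Xx := net_interior_sub xI.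
apply/(repv_pd alpha y df Xx ux) => j; move/(repv_pd alpha y dg Xx vx)/(_ j) : gy.
exact: (snet_unique_interior (defines_snet j dg) (defines_snet j df) xI).
Qed.

Lemma repv_pd_exists n k (X : set 'rV[gnum]_n) Om fe (f : _ -> 'rV[gnum]_k) alpha x u :
  defines X Om fe f -> X x -> is_repv u x ->
  exists y, is_repv (rho := rho) (fun e => pd alpha (fe e) (u e)) y.
Proof.
move=> df Xx ux.
have H j : exists y : gnum, is_rep (fun e => pder alpha (fun x => fe e x 0 j) (u e)) y.
  apply: moderate_rep; have [_ [_ mF] _] := defines_snet j df; exact: mF ux.
have [y hy] := choice H; exists (\row_j y j).
by apply/(repv_pd alpha _ df Xx ux) => j; rewrite mxE.
Qed.

(** The sets on which the derivatives, including those obtained as sharp limits at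
boundary points, are represented by the derivatives of any defining net. All
the sets on which derivatives are taken in the theorem are of this kind: sharply
open sets, the interval and the domain of the Lagrangian. *)
Definition regular n (X : set 'rV[gnum]_n) := forall k Om fe (f : _ -> 'rV[gnum]_k) alpha,
  defines X Om fe f -> forall x u, X x -> is_repv u x ->
  is_repv (fun e => pd alpha (fe e) (u e)) (gpd X alpha f x).

Lemma gpd_interior n k (X : set 'rV[gnum]_n) Om fe (f : _ -> 'rV[gnum]_k) alpha x u :
  defines X Om fe f -> sint X x -> is_repv u x ->
  is_repv (fun e => pd alpha (fe e) (u e)) (gpd X alpha f x).
Proof.
move=> df xI ux; have Xx := sint_sub xI.
have [y hy] := repv_pd_exists alpha df Xx ux.
rewrite /gpd; case: xgetP => [z _ [[_ hz]|[]//]|/(_ y)].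
  exact: (gpd_int_unique df xI ux hz).
by case; left; split=> //; exists Om, fe, u.
Qed.

Lemma sopen_regular n (X : set 'rV[gnum]_n) : sopen X -> regular X.
Proof.
by move=> oX k Om fe f alpha df x u /oX xI ux; exact: (gpd_interior alpha df xI ux).
Qed.

End GeneralizedDerivatives.

(** * Derivatives up to the boundary of a slab *)

Section Slab.
Context {R : realType} {rho : gauge R}.
Local Notation gnum := (gnum rho).
Local Notation net n := (idx R -> 'rV[R]_n -> R).
Variables (t1 t2 : gnum) (a b : idx R -> R).
Hypotheses (at1 : is_rep a t1) (bt2 : is_rep b t2) (ab : forall e, a e <= b e).

(** The interval [t1, t2] (for n = 1) and the domain of the Lagrangian are both of
this form, as is the domain of a function of two variables integrated with
respect to the second one. *)
Definition slab n (i : 'I_n) : set 'rV[gnum]_n := [set x | gitv t1 t2 (x 0 i)].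

Lemma rowBE n (v w : 'rV[R]_n) j : (v - w) 0 j = v 0 j - w 0 j.
Proof. by rewrite mxE [X in _ + X]mxE. Qed.

(** Every point of the slab has a representative whose i-th coordinate stays in
[a_e, b_e] for all e, obtained by cutting off. *)
Definition clip (lo hi x : R) := Num.max lo (Num.min x hi).

Lemma clip_itv lo hi x : lo <= hi -> lo <= clip lo hi x <= hi.
Proof. by move=> lh; rewrite /clip le_max lexx/= ge_max lh ge_min lexx orbT. Qed.

Lemma clip_dist lo hi x r : lo <= hi -> 0 <= r -> lo <= x + r -> x <= hi + r ->
  `|clip lo hi x - x| <= r.
Proof.
move=> lh r0 h1 h2; rewrite /clip.
by have [xh|hx] := leP x hi; [have [lx|xl] := leP lo x|have [lx|xl] := leP lo hi];
  rewrite ler_norml; apply/andP; split; lra.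
Qed.

Definition clipv n (i : 'I_n) (u : idx R -> 'rV[R]_n) e : 'rV[R]_n :=
  \row_j (if j == i then clip (a e) (b e) (u e 0 j) else u e 0 j).

Lemma clipv_itv n (i : 'I_n) u e : a e <= clipv i u e 0 i <= b e.
Proof. by rewrite mxE eqxx; exact: clip_itv. Qed.

Lemma clipv_rep n (i : 'I_n) u x : slab i x -> is_repv u x -> is_repv (clipv i u) x.
Proof.
move=> [/= h1 h2] ux; apply: (repv_close ux) => k.
move/(gleP at1 (ux i))/(_ k) : h1 => h1.
move/(gleP (ux i) bt2)/(_ k) : h2 => h2.
apply: filterS2 h1 h2 => e h1 h2.
apply: rv_norm_le; first by rewrite ltW// gexp_gt0.
move=> j; rewrite !mxE; case: eqP => [->|_]; last by rewrite subrr normr0 ltW// gexp_gt0.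
by apply: clip_dist => //; rewrite ltW// gexp_gt0.
Qed.

Lemma slab_rep n (i : 'I_n) u x : is_repv u x ->
  (forall k, \forall e \near eps0 R, a e - rho e ^+ k <= u e 0 i <= b e + rho e ^+ k) -> slab i x.
Proof.
move=> ux h; split.
  by apply/(gleP at1 (ux i)) => k; apply: filterS (h k) => e /andP[]; rewrite lerBlDr.
by apply/(gleP (ux i) bt2) => k; apply: filterS (h k) => e /andP[].
Qed.

(** A convex piece of the slab around a representative: the uniform bounds hold
on it. *)
Definition box n (i : 'I_n) (c : idx R -> 'rV[R]_n) e : set 'rV[R]_n :=
  [set v : 'rV[R]_n | a e <= v 0 i <= b e /\ `|v - c e| <= 1].

Lemma box_convex n (i : 'I_n) c : convex_net (box i c).
Proof.
move=> e v w t [vi vc] [wi wc] t01; split; last exact: convex_ball_dist.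
by rewrite !mxE; exact: convex_comb_itv.
Qed.

(** Only the i-th coordinate is constrained, so a net that stays close to C and at
moderate distance of c represents a point of the slab. *)
Lemma slab_inside n (i : 'I_n) C c (x : 'rV[gnum]_n) (r : idx R -> R) :
  is_repv c x -> r \in moderate rho ->
  (forall e (w : 'rV[R]_n), C e w -> a e <= w 0 i <= b e /\ `|w - c e| <= r e) ->
  net_inside C (slab i).
Proof.
move=> cx mr hC v hv.
have [|y vy] := @repv_nearby _ _ _ c v x (fun e => 1 + r e) cx (rpredD (moderate_cst 1) mr).
  apply: filterS (hv 0%N) => e [w /hC[_ wc] vw].
  by rewrite -(subrKA w) (le_trans (ler_normD _ _))// lerD.
exists y => //; apply: slab_rep vy _ => k; apply: filterS (hv k) => e [w /hC[/andP[w1 w2] _] vw].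
have := le_trans (rv_coord_le (v e - w) i) vw; rewrite rowBE ler_norml => /andP[h1 h2].
by apply/andP; split; lra.
Qed.

Lemma box_inside n (i : 'I_n) c (x : 'rV[gnum]_n) : is_repv c x ->
  net_inside (box i c) (slab i).
Proof. by move=> cx; apply: (slab_inside cx (moderate_cst 1)) => e w []. Qed.

(** A margin of size a power of rho on both sides leaves room for a sharp
ball. *)
Lemma sint_slab n (i : 'I_n) u x : is_repv u x ->
  (exists K, \forall e \near eps0 R, a e + rho e ^+ K <= u e 0 i <= b e - rho e ^+ K) ->
  sint (slab i) x.
Proof.
move=> ux [K h]; rewrite sintE; exists K.+1 => v w vx vw.
have d := repv_dist K.+1 ux vx.
have [y wy] := repv_nearby vx (gexp_moderate K.+1) vw.
exists y => //; apply: slab_rep wy _ => k; near=> e.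
have h1 : a e + rho e ^+ K <= u e 0 i <= b e - rho e ^+ K by near: e.
have h2 : `|w e - v e| <= rho e ^+ K.+1 by near: e.
have h3 : `|v e - u e| <= rho e ^+ K.+1 by near: e.
have h4 : 2%:R * rho e ^+ K.+1 <= rho e ^+ K by near: e; exact: natr_gexp.
have h5 := gexp_gt0 (rho := rho) k e.
have := le_trans (rv_coord_le (w e - v e) i) h2; rewrite !mxE ler_norml => /andP[].
have := le_trans (rv_coord_le (v e - u e) i) h3; rewrite !mxE ler_norml => /andP[].
move/andP : h1 => [*]; apply/andP; split; lra.
Unshelve. all: by end_near. Qed.

Hypothesis ab_lt : exists K, \forall e \near eps0 R, rho e ^+ K <= b e - a e.

(** Pushing the i-th coordinate inwards by rho^p is possible because t1 < t2 forces
b - a to exceed some power of rho. *)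
Lemma slab_dense n (i : 'I_n) x k : slab i x -> exists z zu xu,
  [/\ sint (slab i) z, is_repv zu z, is_repv xu x &
      \forall e \near eps0 R, `|zu e - xu e| <= rho e ^+ k].
Proof.
move=> Xx; have [u ux] := repv_exists x.
have [K hK] := ab_lt.
pose p := (k + K).+1.
pose zu e : 'rV[R]_n := \row_j (if j == i then
   clip (a e + rho e ^+ p) (b e - rho e ^+ p) (clipv i u e 0 i) else clipv i u e 0 j).
have xx := clipv_rep Xx ux.
have dz : \forall e \near eps0 R, `|zu e - clipv i u e| <= rho e ^+ p /\
    a e + rho e ^+ p <= zu e 0 i <= b e - rho e ^+ p.
  near=> e.
  have h1 : rho e ^+ K <= b e - a e by near: e.
  have h2 : 2%:R * rho e ^+ K.+1 <= rho e ^+ K by near: e; exact: natr_gexp.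
  have h3 : rho e ^+ p <= rho e ^+ K.+1 by apply: gexp_le; rewrite /p; lia.
  have h4 := gexp_gt0 (rho := rho) p e.
  have lh : a e + rho e ^+ p <= b e - rho e ^+ p by lra.
  split; last by rewrite mxE eqxx clip_itv.
  apply: rv_norm_le => [|j]; first exact: ltW.
  rewrite rowBE [zu e 0 j]mxE; case: eqP => [->|_]; last by rewrite subrr normr0 ltW.
  have /andP[c1 c2] := clipv_itv i u e.
  by apply: clip_dist => //; [exact: ltW|lra|lra].
have [z zz] := repv_nearby xx (gexp_moderate p) (filterS (fun e => @proj1 _ _) dz).
exists z, zu, (clipv i u); split=> //.
  apply: sint_slab zz _; exists p; apply: filterS dz => e [_].
  by [].
apply: filterS dz => e [h _]; apply: le_trans h (gexp_le _ _); rewrite /p; lia.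
Unshelve. all: by end_near. Qed.

(** Derivatives of all orders are Lipschitz near a point of the slab, with a
moderate constant. *)
Lemma slab_lipschitz n m (i : 'I_n) Om fe (f : _ -> 'rV[gnum]_m) alpha
    (x : 'rV[gnum]_n) c :
  defines (slab i) Om fe f -> is_repv c x ->
  (forall e, a e <= c e 0 i <= b e) ->
  exists K, \forall e \near eps0 R, forall v : 'rV[R]_n, a e <= v 0 i <= b e -> `|v - c e| <= rho e ^+ K ->
    Om e v /\ forall j, `|pd alpha (fe e) v 0 j - pd alpha (fe e) (c e) 0 j| <= rho e ^- K * `|v - c e|.
Proof.
move=> df cx ci.
have Cc e : box i c e (c e) by split=> //; rewrite subrr normr0 ler01.
have CX := @box_inside n i c x cx; have cC := @box_convex n i c.
have dO := defines_domain df.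
have mD j : mnet (slab i) Om (fun e => pder alpha (fun x => fe e x 0 j)).
  by apply: mnet_pder; have [] := defines_snet j df.
have [K1 hK1] := choice (fun j => lipschitz_bound dO (mD j) Cc CX cC).
have [K3 hK3] := uniform_bound dO (mnet_cst dO (moderate_cst 0)) Cc CX.
exists (\max_j K1 j); near=> e.
have h1 j : forall v w, tube (rho := rho) (box i c) (K1 j) e v -> tube (rho := rho) (box i c) (K1 j) e w ->
   `|pder alpha (fun x => fe e x 0 j) v - pder alpha (fun x => fe e x 0 j) w| <= rho e ^- K1 j * `|v - w|.
  by move: j; near: e; exact: filter_forall.
have h3 : forall v, tube (rho := rho) (box i c) K3 e v -> Om e v /\ `|0 : R| <= rho e ^- K3 by near: e.
move=> v vi vc.
have bv : box i c e v by split=> //; apply: le_trans vc (gexp_le1 _ _).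
have Ov := (h3 v (tube_base _ bv)).1; have Oc := (h3 _ (tube_base _ (Cc e))).1.
split=> // j; rewrite -!(defines_pd j alpha df)//.
apply: le_trans (h1 j v (c e) (tube_base _ bv) (tube_base _ (Cc e))) _.
by rewrite ler_wpM2r// gauge_expV_le// leq_bigmax.
Unshelve. all: by end_near. Qed.

(** At a boundary point the derivative of a defining net is the sharp limit of
the derivatives at interior points, by slab_lipschitz; it is the only possible
limit because interior points are dense. *)
Lemma slab_regular n (i : 'I_n) : regular (slab i).
Proof.
move=> m Om fe f alpha df x u Xx ux.
have [xI|nI] := pselect (sint (slab i) x); first exact: (gpd_interior alpha df xI ux).
have cx := clipv_rep Xx ux.
suff H : is_repv (fun e => pd alpha (fe e) (clipv i u e)) (gpd (slab i) alpha f x).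
  apply/(repv_pd alpha _ df Xx ux) => j.
  move/(repv_pd alpha _ df Xx cx)/(_ j) : H => H.
  have [dO mF _] := defines_snet j df.
  exact: rep_equiv H (mnet_wd dO (mnet_pder alpha mF) Xx cx ux).
set c := clipv i u in cx *.
have ci e : a e <= c e 0 i <= b e by exact: clipv_itv.
have [y hy] := repv_pd_exists alpha df Xx cx.
have [K hK] := slab_lipschitz alpha df cx ci.
have lim k : exists l, forall z zu, sint (slab i) z -> is_repv zu z ->
    (\forall e \near eps0 R, `|zu e - c e| <= rho e ^+ l) ->
    exists2 w, is_gpd_int (slab i) alpha f z w & exists2 wu, is_repv wu w &
    \forall e \near eps0 R, `|wu e - pd alpha (fe e) (c e)| <= rho e ^+ k.
  exists (K + k).+1 => z zu zI zz zc.
  have Xz := sint_sub zI; have zz' := clipv_rep Xz zz.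
  have [w hw] := repv_pd_exists alpha df Xz zz'.
  exists w; first by exists Om, fe, (clipv i zu).
  exists (fun e => pd alpha (fe e) (clipv i zu e)) => //.
  have d := repv_dist (K + k).+1 zz zz'.
  near=> e.
  have h1 : forall v : 'rV[R]_n, a e <= v 0 i <= b e -> `|v - c e| <= rho e ^+ K ->
    Om e v /\ forall j, `|pd alpha (fe e) v 0 j - pd alpha (fe e) (c e) 0 j| <= rho e ^- K * `|v - c e|.
    by near: e.
  have h2 : `|zu e - c e| <= rho e ^+ (K + k).+1 by near: e.
  have h3 : `|clipv i zu e - zu e| <= rho e ^+ (K + k).+1 by near: e.
  have h4 : 2%:R * rho e ^+ (K + k).+1 <= rho e ^+ (K + k) by near: e; exact: natr_gexp.
  have h5 : `|clipv i zu e - c e| <= rho e ^+ (K + k).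
    by have := ler_distD (zu e) (clipv i zu e) (c e); lra.
  have [_ h6] := h1 _ (clipv_itv i zu e) (le_trans h5 (gexp_le _ (leq_addr _ _))).
  apply: rv_norm_le => [|j]; first by rewrite ltW// gexp_gt0.
  rewrite rowBE; apply: le_trans (h6 j) _.
  by rewrite mulrC ler_pdivrMr ?gexp_gt0// -exprD addnC.
have isg : is_gpd (slab i) alpha f x y.
  right; split=> // r r0.
  have [k hk] := @sball_close _ _ m r r0; have [l hl] := lim k.
  exists (grho ^+ l); first exact: grho_gt0.
  move=> z zI zx; have [zu zz] := repv_exists z.
  have [w gw [wu ww hw]] := hl z zu zI zz (sball_far cx zz zx).
  exists w; [exact: gw|exact: hk hy ww hw].
rewrite /gpd; case: xgetP => [y' _ [[xI _]//|[_ lim']]|/(_ y)]; last by case.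
have [yu yy] := repv_exists y'.
suff E : y = y' by rewrite -E.
apply: (repv_inj _ yy); apply: (repv_close hy) => k.
have [l hl] := lim k.+1; have [dl dl0 hd] := lim' _ (grho_gt0 k.+1).
have [k1 hk1] := @sball_close _ _ n dl dl0.
have [z [zu [xu [zI zz xx zx]]]] := slab_dense (maxn k1 l).+1 Xx.
have d := repv_dist (maxn k1 l).+1 cx xx.
have zc : \forall e \near eps0 R, `|zu e - c e| <= rho e ^+ (maxn k1 l).
  near=> e.
  have h1 : `|zu e - xu e| <= rho e ^+ (maxn k1 l).+1 by near: e.
  have h2 : `|xu e - c e| <= rho e ^+ (maxn k1 l).+1 by near: e.
  have h3 : 2%:R * rho e ^+ (maxn k1 l).+1 <= rho e ^+ (maxn k1 l) by near: e; exact: natr_gexp.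
  by have := ler_distD (xu e) (zu e) (c e); lra.
have [w gw [wu ww hw]] : exists2 w, is_gpd_int (slab i) alpha f z w & exists2 wu, is_repv wu w &
    \forall e \near eps0 R, `|wu e - pd alpha (fe e) (c e)| <= rho e ^+ k.+1.
  apply: (hl z zu zI zz); apply: filterS zc => e /le_trans; apply.
  by apply: gexp_le; exact: leq_maxr.
have [w' gw' w'y] : exists2 w, is_gpd_int (slab i) alpha f z w & sball y' (grho ^+ k.+1) w.
  apply: (hd z zI); apply: (hk1 x z c zu cx zz); apply: filterS zc => e /le_trans; apply.
  by apply: gexp_le; exact: leq_maxl.
have Ew := repv_inj (gpd_int_unique df zI zz gw) (gpd_int_unique df zI zz gw').
rewrite -Ew in w'y; have d' := sball_far yy ww w'y.
near=> e.
have h1 : `|wu e - pd alpha (fe e) (c e)| <= rho e ^+ k.+1 by near: e.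
have h2 : `|wu e - yu e| <= rho e ^+ k.+1 by near: e.
have h3 : 2%:R * rho e ^+ k.+1 <= rho e ^+ k by near: e; exact: natr_gexp.
have := ler_distD (wu e) (yu e) (pd alpha (fe e) (c e)); rewrite (distrC (yu e) (wu e)).
by lra.
Unshelve. all: by end_near. Qed.

End Slab.

(** * Smooth maps on regular sets *)

Section RegularCalculus.
Context {R : realType} {rho : gauge R}.
Local Notation gnum := (gnum rho).
Local Notation net n := (idx R -> 'rV[R]_n -> R).

(** Equivalent to being a generalized smooth map (gsf_gsmooth, gsmooth_gsf), but
with a separate net for each coordinate. *)
Definition gsmooth n k (X : set 'rV[gnum]_n) (f : 'rV[gnum]_n -> 'rV[gnum]_k) :=
  forall j, exists Om F, snet X Om F (fun x => f x 0 j).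

Lemma domain_fin n (X : set 'rV[gnum]_n) k (Om : 'I_k -> idx R -> set 'rV[R]_n) :
  (forall j, domain X (Om j)) -> domain X (fun e => [set x | forall j, Om j e x]).
Proof.
move=> dO; split=> [e|x Xx u ux].
  by apply: open_forall_fin => j; exact: (dO j).1.
exact: filter_forall (fun j => (dO j).2 x Xx u ux).
Qed.

Lemma gsmooth_common n k (X : set 'rV[gnum]_n) (f : 'rV[gnum]_n -> 'rV[gnum]_k) :
  gsmooth X f -> exists Om F, domain X Om /\ forall j, snet X Om (F j) (fun x => f x 0 j).
Proof.
move=> sf; have [Om hOm] := choice sf; have [F hF] := choice hOm.
have dO : domain X (fun e => [set x | forall j, Om j e x]).
  by apply: domain_fin => j; have [] := hF j.
exists (fun e => [set x | forall j, Om j e x]), F; split=> // j.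
by apply: snetW (hF j) => // e x; exact.
Qed.

Lemma gsf_gsmooth n k (X : set 'rV[gnum]_n) Y (f : 'rV[gnum]_n -> 'rV[gnum]_k) :
  gsf X Y f -> gsmooth X f.
Proof.
move=> [[Om [fe df]] _] j.
by exists Om, (fun e x => fe e x 0 j); exact: defines_snet.
Qed.

Lemma gsmooth_gsf n k (X : set 'rV[gnum]_n) Y (f : 'rV[gnum]_n -> 'rV[gnum]_k) :
  gsmooth X f -> f @` X `<=` Y -> gsf X Y f.
Proof.
move=> /gsmooth_common[Om [F [dO sF]]] fXY; split=> //.
by exists Om, (fun e x => \row_j F j e x); exact: snet_defines.
Qed.

Lemma snet_gpd n k (X : set 'rV[gnum]_n) Om (F : 'I_k -> net n)
    (f : 'rV[gnum]_n -> 'rV[gnum]_k) alpha j :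
  regular X -> domain X Om -> (forall j, snet X Om (F j) (fun x => f x 0 j)) ->
  snet X Om (fun e => pder alpha (F j e)) (fun x => gpd X alpha f x 0 j).
Proof.
move=> rX dO sF; have [_ mF _] := sF j.
split=> //; first exact: mnet_pder.
move=> x u Xx ux; have df := snet_defines dO sF.
have := rX _ _ _ _ alpha df x u Xx ux.
move/(repv_pd alpha _ df Xx ux)/(_ j).
apply: near_rep; apply: nearW => e; congr (pder alpha _ _).
by apply/funext => y; rewrite mxE.
Qed.

Lemma sgrad_gpd n k (X : set 'rV[gnum]_n) (f : 'rV[gnum]_n -> 'rV[gnum]_k) alpha j :
  regular X -> gsmooth X f ->
  sgrad X (fun x => gpd X alpha f x 0 j) (fun i x => gpd X (i :: alpha) f x 0 j).
Proof.
move=> rX /gsmooth_common[Om [F [dO sF]]].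
exists Om, (fun e => pder alpha (F j e)); split; first exact: snet_gpd.
by move=> i; exact: (snet_gpd (i :: alpha)).
Qed.

Lemma gpd_nil n k (X : set 'rV[gnum]_n) (f : 'rV[gnum]_n -> 'rV[gnum]_k) x :
  regular X -> gsmooth X f -> X x -> gpd X [::] f x = f x.
Proof.
move=> rX /gsmooth_common[Om [F [dO sF]]] Xx; have [u ux] := repv_exists x.
apply/rowP => j; have [_ _ vF] := sF j.
have [_ _ vG] := snet_gpd [::] j rX dO sF.
exact: rep_inj (vG x u Xx ux) (vF x u Xx ux).
Qed.

Lemma gpd_sgrad n k (X : set 'rV[gnum]_n) (f : 'rV[gnum]_n -> 'rV[gnum]_k)
    (g : 'I_k -> 'I_n -> 'rV[gnum]_n -> gnum) x i j :
  regular X -> (forall j, sgrad X (fun x => f x 0 j) (g j)) -> X x ->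
  gpd X [:: i] f x 0 j = g j i x.
Proof.
move=> rX sg Xx; have [Om hOm] := choice sg; have [F hF] := choice hOm.
pose OO e := [set x | forall j, Om j e x].
have dO : domain X OO by apply: domain_fin => l; have [[]] := hF l.
have sF l : snet X OO (F l) (fun x => f x 0 l) by apply: snetW (hF l).1 => // e y; exact.
have [u ux] := repv_exists x.
have [_ _ v1] := snet_gpd [:: i] j rX dO sF.
have [_ _ v2] := (hF j).2 i.
exact: rep_inj (v1 x u Xx ux) (v2 x u Xx ux).
Qed.

(** On a regular set a partial derivative in the sense of sgrad is a value of gpd,
hence it is determined by the function. *)
Lemma sgrad_unique n (X : set 'rV[gnum]_n) f f' g g' x i :
  regular X -> sgrad X f g -> sgrad X f' g' -> (forall y, X y -> f y = f' y) -> X x ->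
  g i x = g' i x.
Proof.
move=> rX sg sg' ff Xx.
have sg1 := sgrad_eq (fun y Xy => esym (ff y Xy)) (fun i y _ => erefl) sg'.
have E (h : 'rV[gnum]_n -> gnum) (dh : 'I_n -> 'rV[gnum]_n -> gnum) : sgrad X h dh -> gpd X [:: i] (gscalar h) x 0 0 = dh i x.
  move=> sh; apply: (@gpd_sgrad _ _ X (gscalar h) (fun _ => dh)) => // j.
  by apply: sgrad_eq sh => // y _; rewrite /gscalar mxE ord1 eqxx.
by rewrite -(E _ _ sg) -(E _ _ sg1).
Qed.

(** Schwarz' theorem for the functions of a representing net. *)
Lemma sgrad_schwarz n k (X : set 'rV[gnum]_n) (f : 'rV[gnum]_n -> 'rV[gnum]_k) i l x j :
  regular X -> gsmooth X f -> X x -> gpd X [:: i; l] f x 0 j = gpd X [:: l; i] f x 0 j.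
Proof.
move=> rX /gsmooth_common[Om [F [dO sF]]] Xx; have [u ux] := repv_exists x.
have [_ _ v1] := snet_gpd [:: i; l] j rX dO sF.
have [_ _ v2] := snet_gpd [:: l; i] j rX dO sF.
apply: rep_inj (v1 x u Xx ux) _; apply: near_rep (v2 x u Xx ux).
apply: filterS (dO.2 x Xx u ux) => e Oe; apply: smooth_schwarz Oe; first exact: dO.1.
by have [_ [+ _] _] := sF j; apply.
Qed.


(** A scalar t is identified with t%:M, so that derivatives of curves are gradients
in dimension one. *)
Definition cder (T : set gnum) (f f' : gnum -> gnum) :=
  sgrad (gset1 T) (fun z => f (z 0 0)) (fun _ z => f' (z 0 0)).

Lemma rv1_scalar (z : 'rV[gnum]_1) : (z 0 0)%:M = z.
Proof. by apply/rowP => i; rewrite mxE !ord1 eqxx. Qed.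

Lemma scalar_rv1 (t : gnum) : (t%:M : 'rV[gnum]_1) 0 0 = t.
Proof. by rewrite mxE eqxx. Qed.

Lemma gset1_scalar (T : set gnum) t : gset1 T t%:M = T t.
Proof. by rewrite /gset1/= scalar_rv1. Qed.

Lemma cder_eq T f f' g g' : (forall t, T t -> f t = g t) ->
  (forall t, T t -> f' t = g' t) -> cder T f f' -> cder T g g'.
Proof. by move=> E E'; apply: sgrad_eq => [z Tz|i z Tz]; [exact: E|exact: E']. Qed.

Lemma cder_sub (T U : set gnum) f f' : U `<=` T -> cder T f f' -> cder U f f'.
Proof. by move=> UT; apply: sgrad_sub => z; exact: UT. Qed.

Lemma cder_cst T c : cder T (fun=> c) (fun=> 0).
Proof. exact: sgrad_cst. Qed.

Lemma cder_id T : cder T id (fun=> 1).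
Proof. by apply: sgrad_eq (sgrad_coord (gset1 T) 0) => // i z _; rewrite ord1 eqxx. Qed.

Lemma cderD T f f' g g' : cder T f f' -> cder T g g' ->
  cder T (fun t => f t + g t) (fun t => f' t + g' t).
Proof. by move=> h1 h2; exact: sgradD h1 h2. Qed.

Lemma cderB T f f' g g' : cder T f f' -> cder T g g' ->
  cder T (fun t => f t - g t) (fun t => f' t - g' t).
Proof. by move=> h1 h2; exact: sgradB h1 h2. Qed.

Lemma cderM T f f' g g' : cder T f f' -> cder T g g' ->
  cder T (fun t => f t * g t) (fun t => f t * g' t + g t * f' t).
Proof. by move=> h1 h2; exact: sgradM h1 h2. Qed.

Lemma cder_sum T (I : Type) (r : seq I) f f' : (forall i, cder T (f i) (f' i)) ->
  cder T (fun t => \sum_(i <- r) f i t) (fun t => \sum_(i <- r) f' i t).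
Proof.
move=> h; exact: (sgrad_sum r h).
Qed.

Lemma cder_comp n T (Y : set 'rV[gnum]_n) G dG (c c' : 'I_n -> gnum -> gnum) :
  sgrad Y G dG -> (forall j, cder T (c j) (c' j)) -> (forall t, T t -> Y (\row_j c j t)) ->
  cder T (fun t => G (\row_j c j t)) (fun t => \sum_j dG j (\row_j c j t) * c' j t).
Proof.
move=> sG hc TY; apply: (sgrad_comp sG hc) => z Tz; exact: TY.
Qed.

Lemma cder_unique T f f' g g' t : regular (gset1 T) -> cder T f f' -> cder T g g' ->
  (forall t, T t -> f t = g t) -> T t -> f' t = g' t.
Proof.
move=> rT hf hg fg Tt.
have := @sgrad_unique _ _ _ _ _ _ t%:M 0 rT hf hg.
rewrite gset1_scalar scalar_rv1; apply=> // z Tz; exact: fg.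
Qed.

Lemma gder_cder n T (f : gnum -> 'rV[gnum]_n) f' t j : regular (gset1 T) ->
  (forall j, cder T (fun t => f t 0 j) (f' j)) -> T t -> gder T 1 f t 0 j = f' j t.
Proof.
move=> rT hf Tt; rewrite /gder /=.
rewrite (@gpd_sgrad _ _ _ _ (fun j _ z => f' j (z 0 0)) _ _ _ rT) ?scalar_rv1//.
by rewrite gset1_scalar.
Qed.

Lemma cder_gder n T (f : gnum -> 'rV[gnum]_n) i j : regular (gset1 T) ->
  gsmooth (gset1 T) (gfun1 f) ->
  cder T (fun t => gder T i f t 0 j) (fun t => gder T i.+1 f t 0 j).
Proof.
move=> rT sf; have := sgrad_gpd (nseq i 0) j rT sf.
apply: sgrad_eq => [z _|l z _].
  exact: (congr1 (fun w => gpd (gset1 T) (nseq i 0) (gfun1 f) w 0 j) (esym (rv1_scalar z))).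
rewrite [l]ord1.
exact: (congr1 (fun w => gpd (gset1 T) (nseq i.+1 0) (gfun1 f) w 0 j) (esym (rv1_scalar z))).
Qed.

Lemma gder0 n T (f : gnum -> 'rV[gnum]_n) t : regular (gset1 T) ->
  gsmooth (gset1 T) (gfun1 f) -> T t -> gder T 0 f t = f t.
Proof.
move=> rT sf Tt; rewrite /gder/= gpd_nil//; first by rewrite /gfun1 scalar_rv1.
by rewrite gset1_scalar.
Qed.

Lemma is_gder_cder T f f' t : sopen (gset1 T) -> cder T f f' -> T t ->
  is_gder T 1 (gscalar f) t (gscalar f' t).
Proof.
move=> oT [Om [F [sF sF']]] Tt; left.
have Tt' : gset1 T t%:M by rewrite gset1_scalar.
split; first exact: oT.
have sF1 (j : 'I_1) : snet (gset1 T) Om F (fun z => gfun1 (gscalar f) z 0 j).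
  by apply: snet_eq sF => z _; rewrite /gfun1 /gscalar ord1 scalar_rv1.
have dO : domain (gset1 T) Om by have [] := sF.
have [u ut] := repv_exists (t%:M : 'rV[gnum]_1).
have df := snet_defines dO sF1.
exists Om, (fun e x => \row_(j < 1) F e x), u; split=> //.
apply/(repv_pd _ _ df Tt' ut) => j.
rewrite ord1 /gscalar scalar_rv1.
have [_ _ v] := sF' 0; have := v _ u Tt' ut; rewrite scalar_rv1.
apply: near_rep; apply: nearW => e; congr (pder _ _ _).
by apply/funext => y; rewrite mxE.
Qed.

End RegularCalculus.

(** * Integrals of continuous real functions *)

Section RealIntegrals.
Context {R : realType}.
Implicit Types (f g H : R -> R) (a b : R).
Local Notation mu := (@lebesgue_measure R).
Local Notation int a b f := (\int[mu]_(x in `[a, b]) f x).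

Definition cts_on a b f := forall x : R, a <= x <= b -> {for x, continuous f}.

Lemma cts_on_within a b f : cts_on a b f -> {within `[a, b], continuous f}.
Proof.
move=> cf; apply: continuous_in_subspaceT => x /set_mem/=; rewrite in_itv/=.
exact: cf.
Qed.

Lemma cts_on_integrable a b f : cts_on a b f -> mu.-integrable `[a, b] (EFin \o f).
Proof.
move=> cf; apply: continuous_compact_integrable; first exact: segment_compact.
exact: cts_on_within.
Qed.

Lemma cts_onB a b f g : cts_on a b f -> cts_on a b g -> cts_on a b (fun x => f x - g x).
Proof. by move=> cf cg x xab; apply: cvgB; [exact: cf|exact: cg]. Qed.

Lemma int_FTC a b f H : a <= b -> cts_on a b f ->
  (forall x, a <= x <= b -> is_derive x (1 : R) H (f x)) -> int a b f = H b - H a.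
Proof.
rewrite le_eqVlt => /predU1P[<-|ab] cf dH.
  by rewrite set_itv1 Rintegral_set1 subrr.
have cH : cts_on a b H.
  by move=> x /dH dHx; apply: differentiable_continuous; apply/derivable1_diffP; have [] := dHx.
rewrite /Rintegral (@continuous_FTC2 _ f H)//; first exact: cts_on_within.
  split.
  - move=> x; rewrite in_itv/= => /andP[/ltW ax /ltW xb].
    by have [] := dH x (introT andP (conj ax xb)).
  - apply: cvg_at_right_filter; apply: cH; by rewrite lexx ltW.
  - apply: cvg_at_left_filter; apply: cH; by rewrite lexx ltW.
move=> x; rewrite in_itv/= => /andP[/ltW ax /ltW xb].
have dHx := dH x (introT andP (conj ax xb)).
by rewrite derive1E derive_val.
Qed.

Lemma int_cst a b (c : R) : a <= b -> int a b (cst c) = c * (b - a).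
Proof.
move=> ab; rewrite mulrBr.
apply: (@int_FTC _ _ _ (fun x => c * x)) => // [x _|x _]; first exact: cst_continuous.
have := @is_deriveZ _ _ _ (id : R -> R) c x 1 1 (is_derive_id x 1).
by rewrite [c *: (1 : R)]mulr1; exact.
Qed.

Lemma int_le a b f g : a <= b -> cts_on a b f -> cts_on a b g ->
  (forall x, a <= x <= b -> f x <= g x) -> int a b f <= int a b g.
Proof.
by move=> ab cf cg fg; apply: le_Rintegral => //; exact: cts_on_integrable.
Qed.

Lemma int_norm_le a b f M : a <= b -> cts_on a b f ->
  (forall x, a <= x <= b -> `|f x| <= M) -> `|int a b f| <= M * (b - a).
Proof.
move=> ab cf fM.
have cc (c : R) : cts_on a b (cst c) by move=> x _; exact: cst_continuous.
rewrite ler_norml -mulNr -!int_cst//; apply/andP; split; apply: int_le => // x /fM;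
  by rewrite ler_norml => /andP[].
Qed.

Lemma intB a b f g : cts_on a b f -> cts_on a b g ->
  int a b (fun x => f x - g x) = int a b f - int a b g.
Proof. by move=> cf cg; apply: RintegralB => //; exact: cts_on_integrable. Qed.

Lemma int_subset a b c d f : cts_on a b f -> (forall x, a <= x <= b -> 0 <= f x) ->
  a <= c -> d <= b -> int c d f <= int a b f.
Proof.
move=> cf f0 ac db.
have sub : `[c, d] `<=` `[a, b].
  by move=> x /=; rewrite !in_itv/= => /andP[cx xd]; rewrite (le_trans ac cx) (le_trans xd db).
have iab := cts_on_integrable cf.
have icd : mu.-integrable `[c, d] (EFin \o f) by apply: integrableS iab.
rewrite /Rintegral fine_le//; [exact: integrable_fin_num..|].
by apply: ge0_subset_integral => //; exact: measurable_int iab.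
Qed.

(** A nonnegative Lipschitz function of value at least r at x0 stays above r/2 on
an interval of length s <= r / (2 N) next to x0; that interval has to be placed
on the side of x0 where [a, b] has room for it. *)
Lemma int_lower a b f (N r s x0 : R) : cts_on a b f -> (forall x, a <= x <= b -> 0 <= f x) ->
  a <= x0 <= b -> 0 < s -> 0 <= N -> s * 2 <= b - a -> N * s * 2 <= r -> r <= f x0 ->
  (forall x, a <= x <= b -> `|f x - f x0| <= N * `|x - x0|) -> r / 2 * s <= int a b f.
Proof.
move=> cf f0 /andP[ax xb] s0 N0 sab Nsr rf fN.
have [c [ac cb cx]] : exists c, [/\ a <= c, c + s <= b & forall x, c <= x <= c + s -> `|x - x0| <= s].
  have [h|h] := leP (x0 + s) b.
    exists x0; split=> // x /andP[h1 h2]; rewrite ger0_norm; lra.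
  exists (x0 - s); split; [lra|lra|].
  move=> x /andP[h1 h2]; rewrite ler0_norm; lra.
apply: le_trans (int_subset cf f0 ac cb).
have cs : c <= c + s by rewrite lerDl ltW.
have -> : r / 2 * s = int c (c + s) (cst (r / 2)) by rewrite int_cst// [c + s]addrC addrK.
apply: int_le => //.
- by move=> x _; exact: cst_continuous.
- move=> x /andP[h1 h2]; apply: cf; apply/andP; split; lra.
move=> x xcs; have /andP[h1 h2] := xcs.
have xab : a <= x <= b by apply/andP; split; lra.
have h3 := fN x xab; have h4 := ler_wpM2l N0 (cx x xcs).
have := le_trans h3 h4; rewrite ler_norml => /andP[h5 h6].
rewrite /cst; lra.
Qed.

Lemma primitive_exists f (L : R) : continuous f ->
  exists H, forall x, L < x -> is_derive x (1 : R) H (f x).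
Proof.
move=> cf; exists (fun x => int L x f) => x Lx.
have ci : mu.-integrable `[L, x + 1] (EFin \o f).
  by apply: cts_on_integrable => y _; exact: cf.
have x1 : x < x + 1 by rewrite ltrDl.
have [d E] := continuous_FTC1_closed x1 ci Lx (cf x).
by rewrite derive1E in E; exact: DeriveDef d E.
Qed.

Lemma oint_primitive f H (L a b : R) : continuous f ->
  (forall x, L < x -> is_derive x (1 : R) H (f x)) -> L < a -> L < b ->
  oint a b f = H b - H a.
Proof.
move=> cf dH La Lb; rewrite /oint; case: leP => [ab|/ltW ba].
  by apply: int_FTC => // [x _|x /andP[ax _]]; [exact: cf|apply: dH; exact: lt_le_trans ax].
rewrite -(opprB (H a)); congr (- _).
apply: int_FTC => // [x _|x /andP[ax _]]; [exact: cf|].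
by apply: dH; exact: lt_le_trans ax.
Qed.

(** Both integrals are differences of values of one primitive, which exists to the
right of any L, so the case distinctions on the order of the endpoints reduce
to the mean value theorem. *)
Lemma oint_move_ends f (a b a' b' M : R) : continuous f ->
  (forall x, Num.min a a' <= x <= Num.max a a' -> `|f x| <= M) ->
  (forall x, Num.min b b' <= x <= Num.max b b' -> `|f x| <= M) ->
  `|oint a b f - oint a' b' f| <= M * (`|a - a'| + `|b - b'|).
Proof.
move=> cf Ma Mb.
pose L := Num.min (Num.min a a') (Num.min b b') - 1.
have [H dH] := primitive_exists L cf.
have hL x : Num.min (Num.min a a') (Num.min b b') <= x -> L < x by rewrite /L; lra.
have La : L < a by apply: hL; rewrite !ge_min lexx.
have La' : L < a' by apply: hL; rewrite !ge_min lexx !orbT.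
have Lb : L < b by apply: hL; rewrite !ge_min lexx !orbT.
have Lb' : L < b' by apply: hL; rewrite !ge_min lexx !orbT.
rewrite (oint_primitive cf dH La Lb) (oint_primitive cf dH La' Lb').
have key u v : L < u -> L < v ->
    (forall x, Num.min u v <= x <= Num.max u v -> `|f x| <= M) -> `|H u - H v| <= M * `|u - v|.
  wlog uv : u v / u <= v.
    move=> h Lu Lv hM; have [uv|/ltW vu] := leP u v; first exact: h.
    by rewrite distrC (distrC u); apply: h => // x; rewrite minC maxC; exact: hM.
  move=> Lu Lv; rewrite (min_idPl uv) (max_idPr uv) => hM.
  have dx x : u <= x -> is_derive x (1 : R) H (f x).
    by move=> ux; apply: dH; exact: lt_le_trans ux.
  have cH : {within `[u, v], continuous H}.
    apply: derivable_within_continuous => x; rewrite in_itv/= => /andP[/dx dHx _].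
    by have [] := dHx.
  have dx' (x : R) : x \in `]u, v[ -> is_derive x (1 : R) H (f x).
    by rewrite in_itv/= => /andP[/ltW ux _]; exact: dx.
  have [c cuv E] := MVT_segment uv dx' cH.
  rewrite distrC (distrC u) E normrM ler_wpM2r//; apply: hM.
  by move: cuv; rewrite in_itv.
rewrite (_ : _ - _ = (H b - H b') - (H a - H a')); last by ring.
by apply: le_trans (ler_normB _ _) _; rewrite mulrDr addrC lerD// key.
Qed.

End RealIntegrals.

(** * The integral over a generalized interval *)

Section GeneralizedIntegral.
Context {R : realType} {rho : gauge R}.
Local Notation gnum := (gnum rho).
Local Notation net n := (idx R -> 'rV[R]_n -> R).
Local Notation mu := (@lebesgue_measure R).
Variables (t1 t2 : gnum) (a b : idx R -> R).
Hypotheses (at1 : is_rep a t1) (bt2 : is_rep b t2) (ab : forall e, a e <= b e).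
Local Notation X := (gset1 (gitv t1 t2)).

Lemma scalar_line (t : R) : t%:M = 0 + t *: 'e_0 :> 'rV[R]_1.
Proof. by apply/rowP => j; rewrite !mxE !ord1 !eqxx add0r mulr1. Qed.

Lemma line_derive (F : 'rV[R]_1 -> R) (s : R) : differentiable F s%:M ->
  is_derive s (1 : R) (fun s => F s%:M) ('D_('e_0) F s%:M).
Proof.
rewrite scalar_line => dF.
have -> : (fun s => F s%:M) = (fun s => F (0 + s *: 'e_0)).
  by apply/funext => t; rewrite scalar_line.
by apply: is_derive_line; exact: diff_derivable.
Qed.

Lemma smooth_cts_line (Om : set 'rV[R]_1) F (c d : R) : smooth Om F ->
  (forall s : R, c <= s <= d -> Om s%:M) -> cts_on c d (fun s => F s%:M).
Proof.
move=> sF hO s /hO Os; have [d1 _] := line_derive (smooth_differentiable sF Os).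
by apply: differentiable_continuous; apply/derivable1_diffP.
Qed.

Lemma repv_scalar u (x : gnum) : is_rep u x -> is_repv (fun e => (u e)%:M) (x%:M : 'rV[gnum]_1).
Proof. by move=> ux i; rewrite !ord1 scalar_rv1; under eq_fun do rewrite mxE eqxx. Qed.

Lemma norm_scalar (s : R) : `|s%:M : 'rV[R]_1| = `|s|.
Proof.
apply/le_anti/andP; split.
  by apply: rv_norm_le => // i; rewrite ord1 mxE eqxx.
by have := rv_coord_le (s%:M : 'rV[R]_1) 0; rewrite mxE eqxx.
Qed.

Lemma between_pad (x y r s : R) : `|x - y| <= r ->
  Num.min x y <= s <= Num.max x y -> y - r <= s <= y + r.
Proof.
rewrite ler_norml ge_min le_max => /andP[h1 h2] /andP[/orP[?|?] /orP[?|?]];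
  apply/andP; split; lra.
Qed.

Lemma triangle_budget (x y r s t : R) : x <= 2 * r -> y <= r -> r <= s -> 3 * s <= t ->
  x + y <= t.
Proof. lra. Qed.

Definition segment e : set 'rV[R]_1 := [set v | a e <= v 0 0 <= b e].

Lemma segment_a e : segment e (a e)%:M.
Proof. by rewrite /segment/= mxE eqxx mulr1n lexx ab. Qed.

Lemma segment_inside : net_inside segment X.
Proof.
have ml : (fun e => b e - a e) \in moderate rho.
  by apply: rpredB; [exact: rep_moderate bt2|exact: rep_moderate at1].
apply: (slab_inside at1 bt2 (repv_scalar at1) ml) => e w wi; split=> //.
move: wi; rewrite /segment/= => /andP[w1 w2].
apply: rv_norm_le => [|j]; first by rewrite subr_ge0 ab.
by rewrite rowBE ord1 [X in _ - X]mxE eqxx mulr1n ger0_norm; lra.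
Qed.

Lemma tube_segment K e (s : R) : a e - rho e ^+ K <= s <= b e + rho e ^+ K ->
  tube (rho := rho) segment K e s%:M.
Proof.
move=> /andP[h1 h2]; have r0 := ltW (gexp_gt0 (rho := rho) K e).
exists (clip (a e) (b e) s)%:M.
  by rewrite /segment/= mxE eqxx mulr1n clip_itv.
rewrite -raddfB/= norm_scalar distrC; apply: clip_dist => //; lra.
Qed.

(** The domains Om_e cover even a rho^K-neighbourhood of [a_e, b_e]: this leaves
room to move the endpoints and to extend the net. *)
Lemma segment_bound Om F : domain X Om -> mnet X Om F ->
  exists K, \forall e \near eps0 R, forall s, a e - rho e ^+ K <= s <= b e + rho e ^+ K ->
    Om e s%:M /\ `|F e s%:M| <= rho e ^- K.
Proof.
move=> dO mF; have [K hK] := uniform_bound dO mF segment_a segment_inside.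
by exists K; apply: filterS hK => e hK s hs; apply: hK; exact: tube_segment.
Qed.

Lemma segment_negligible (F : net 1) :
  (forall x u, X x -> is_repv u x -> forall k, \forall e \near eps0 R, `|F e (u e)| <= rho e ^+ k) ->
  forall k, \forall e \near eps0 R, forall s, a e <= s <= b e -> `|F e s%:M| <= rho e ^+ k.
Proof.
move=> nF k; have := uniform_negligible nF segment_a segment_inside k.
by apply: filterS => e h s hs; apply: h; rewrite /segment/= mxE eqxx.
Qed.

Lemma segment_pad K e (s : R) : a e <= s <= b e -> a e - rho e ^+ K <= s <= b e + rho e ^+ K.
Proof. by have := gexp_gt0 (rho := rho) K e => ? /andP[? ?]; apply/andP; split; lra. Qed.

Lemma segment_cts Om F f : snet X Om F f ->
  \forall e \near eps0 R, cts_on (a e) (b e) (fun s => F e s%:M).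
Proof.
move=> [dO mF _]; have [K hK] := segment_bound dO mF; apply: filterS hK => e hK.
apply: smooth_cts_line (mF.1 e) _ => s hs.
by have [] := hK s (segment_pad K hs).
Qed.

Lemma int_moderate Om F f : snet X Om F f ->
  (fun e => \int[mu]_(s in `[a e, b e]) F e s%:M) \in moderate rho.
Proof.
move=> sF; have [dO mF _] := sF; have [K hK] := segment_bound dO mF.
apply: (@near_moderate _ _ (fun e => rho e ^- K * (b e - a e))); last first.
  apply: rpredM; first exact: gexpV_moderate.
  by apply: rpredB; [exact: rep_moderate bt2|exact: rep_moderate at1].
apply: filterS2 hK (segment_cts sF) => e hK cF.
rewrite [leRHS]ger0_norm; last by rewrite mulr_ge0 ?subr_ge0// ltW// gexpV_gt0.
apply: int_norm_le => // s hs.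
by have [] := hK s (segment_pad K hs).
Qed.

(** A single net that is smaller than every power of the gauge: the exponent
tends to infinity as e tends to 0. *)
Definition tiny (e : idx R) : R := rho e ^+ Num.bound (\val e)^-1.

Lemma tiny_gt0 e : 0 < tiny e.
Proof. exact: gexp_gt0. Qed.

Lemma tiny_small k : \forall e \near eps0 R, tiny e <= rho e ^+ k.
Proof.
have k0 : 0 < (k.+1%:R^-1 : R) by rewrite invr_gt0 ltr0n.
apply: filterS (near_idx_lt k0) => e ek; apply: gexp_le.
have /andP[e0 _] := valP e.
have h0 : 0 <= (\val e)^-1 by rewrite invr_ge0 ltW.
have h1 : k.+1%:R <= (\val e)^-1 by rewrite -[leLHS]invrK lef_pV2 ?posrE ?invr_gt0 ?ltr0n// ltW.
by have := le_lt_trans h1 (archi_boundP h0); rewrite ltr_nat => /ltnW/ltnW.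
Qed.

Lemma sqrt_add_dist (p q m : R) : 0 < m ->
  `|Num.sqrt (p ^+ 2 + m ^+ 2) - Num.sqrt (q ^+ 2 + m ^+ 2)| <= `|p - q|.
Proof.
move=> m0.
have hs (x : R) : `|x| < Num.sqrt (x ^+ 2 + m ^+ 2).
  by rewrite -sqrtr_sqr ltr_sqrt ?ltr_pwDr ?sqr_ge0 ?exprn_gt0// ltrDl exprn_gt0.
have S0 : 0 < Num.sqrt (p ^+ 2 + m ^+ 2) + Num.sqrt (q ^+ 2 + m ^+ 2).
  by rewrite addr_gt0// sqrtr_gt0 ltr_pwDr ?sqr_ge0 ?exprn_gt0.
rewrite -(ler_pM2r S0) -{1}(gtr0_norm S0) -normrM -subr_sqr !sqr_sqrtr ?addr_ge0 ?sqr_ge0//.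
rewrite (_ : _ - _ = (p - q) * (p + q)); last by ring.
rewrite normrM ler_wpM2l//; apply: le_trans (ler_normD _ _) _.
by have := hs p; have := hs q; lra.
Qed.

Lemma sqrt_add_abs (p m : R) : 0 < m -> `|Num.sqrt (p ^+ 2 + m ^+ 2) - `|p| | <= m.
Proof.
move=> m0.
have h1 : `|p| <= Num.sqrt (p ^+ 2 + m ^+ 2).
  by rewrite -sqrtr_sqr ler_wsqrtr// lerDl sqr_ge0.
rewrite ger0_norm ?subr_ge0// lerBlDr.
rewrite -(@ler_pXn2r _ 2)// ?nnegrE ?sqrtr_ge0 ?addr_ge0 ?(ltW m0)//.
rewrite sqr_sqrtr ?addr_ge0 ?sqr_ge0// sqrrD real_normK ?num_real//.
by have := mulr_ge0 (ltW m0) (normr_ge0 p); rewrite mulr2n; lra.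
Qed.

(** Cutting off x at lo and hi is (|x - lo| - |x - hi| + lo + hi) / 2; replacing
the absolute values by sqrt(x^2 + m^2) makes it smooth, moves it by at most
m inside [lo, hi] and keeps its values in [lo, hi]. *)
Definition smooth_clip (lo hi m x : R) : R :=
  2^-1 * (Num.sqrt ((x - lo) ^+ 2 + m ^+ 2) - Num.sqrt ((x - hi) ^+ 2 + m ^+ 2) + (lo + hi)).

Lemma smooth_clip_itv lo hi m x : 0 < m -> lo <= hi -> lo <= smooth_clip lo hi m x <= hi.
Proof.
move=> m0 lh; have := sqrt_add_dist (x - lo) (x - hi) m0.
rewrite (_ : x - lo - (x - hi) = hi - lo); last by ring.
rewrite (ger0_norm (_ : 0 <= hi - lo)) ?subr_ge0// ler_norml /smooth_clip => /andP[h1 h2].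
apply/andP; split; lra.
Qed.

Lemma smooth_clip_dist lo hi m x : 0 < m -> lo <= x <= hi -> `|smooth_clip lo hi m x - x| <= m.
Proof.
move=> m0 /andP[lx xh].
have := sqrt_add_abs (x - lo) m0; have := sqrt_add_abs (x - hi) m0.
rewrite (ger0_norm (_ : 0 <= x - lo)) ?subr_ge0// (ler0_norm (_ : x - hi <= 0)) ?subr_le0//.
rewrite !ler_norml /smooth_clip => /andP[h1 h2] /andP[h3 h4].
apply/andP; split; lra.
Qed.

Lemma segment_range u x k : X x -> is_repv u x ->
  \forall e \near eps0 R, a e - rho e ^+ k <= u e 0 0 <= b e + rho e ^+ k.
Proof.
move=> [/= h1 h2] ux.
have g1 := (gleP at1 (ux 0)).1 h1 k; have g2 := (gleP (ux 0) bt2).1 h2 k.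
by apply: filterS2 g1 g2 => e g1 g2; apply/andP; split; lra.
Qed.

(** The integral is defined through nets on the whole real line. A net F on Om is
extended by composing it with a smooth cut-off onto a slightly larger interval
that is still contained in Om. The cut-off parameter is tiny, so that at points
of the interval the composite has the same class; square roots are moderate with
all their derivatives there, because their arguments stay above a power of rho. *)
Lemma extension_exists Om F f : snet X Om F f -> exists G, snet X (fun=> setT) G f.
Proof.
move=> [dO mF vF]; have [K hK] := segment_bound dO mF.
pose good e := forall s, a e - rho e ^+ K <= s <= b e + rho e ^+ K -> Om e s%:M.
have hgood : \forall e \near eps0 R, good e.
  by apply: filterS hK => e h s hs; have [] := h s hs.
(* Where Om_e does not contain the padded interval the net is replaced by 0; this
   happens outside a neighbourhood of e = 0 only. *)
pose F' e := if pselect (good e) then F e else cst 0.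
pose Om' e := if pselect (good e) then Om e else setT.
have oO' e : open (Om' e) by rewrite /Om'; case: pselect => ? /=; [exact: dO.1|exact: openT].
have mF' : mnet X Om' F'.
  split=> [e|alpha x u Xx ux].
    rewrite /F' /Om'; case: pselect => ? /=; first exact: mF.1.
    have [h _] := @mnet_cst R rho 1 X (fun=> setT) (fun=> 0) (domain_setT _) (moderate_cst 0).
    exact: (h e).
  apply: near_moderate (mF.2 alpha x u Xx ux); apply: filterS hgood => e ge.
  by rewrite /F'; case: pselect.
pose lo e := a e - rho e ^+ K.+1; pose hi e := b e + rho e ^+ K.+1.
pose kap e (v : 'rV[R]_1) := smooth_clip (lo e) (hi e) (tiny e) (v 0 0).
have lohi e : lo e <= hi e.
  by rewrite /lo /hi; have := gexp_gt0 (rho := rho) K.+1 e; have := ab e; lra.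
have dT : domain X (fun=> setT) by exact: domain_setT.
have mlo : lo \in moderate rho by apply: rpredB; [exact: rep_moderate at1|exact: gexp_moderate].
have mhi : hi \in moderate rho by apply: rpredD; [exact: rep_moderate bt2|exact: gexp_moderate].
have mtiny : tiny \in moderate rho.
  apply: near_moderate (gexp_moderate 0); apply: filterS (tiny_small 0) => e.
  by rewrite !ger0_norm// ltW ?tiny_gt0// gexp_gt0.
have aroot (c : idx R -> R) : c \in moderate rho ->
    (forall x u, X x -> is_repv u x -> \forall e \near eps0 R, rho e ^+ K.+2 <= `|u e 0 0 - c e|) ->
    alg X (fun=> setT) (fun e v => Num.sqrt ((v 0 0 + -1 * c e) * (v 0 0 + -1 * c e) + tiny e * tiny e)).
  move=> mc hc.
  have ad : alg X (fun=> setT) (fun e v => v 0 0 + -1 * c e).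
    apply: alg_add; first by apply: alg_base; exact: mnet_coord.
    by apply: alg_mul; apply: alg_cst => //; exact: moderate_cst.
  apply: alg_sqrt.
  - apply: alg_add; first exact: alg_mul.
    by apply: alg_mul; exact: alg_cst.
  - move=> e v _; rewrite -!expr2 ltr_pwDr ?sqr_ge0// exprn_gt0// tiny_gt0//.
  - move=> x u Xx ux; apply/moderateP; exists (K.+2 * 2)%N.
    apply: filterS (hc x u Xx ux) => e h; rewrite mulN1r -!expr2.
    have t0 : 0 < tiny e ^+ 2 by rewrite exprn_gt0// tiny_gt0.
    have s0 : 0 < (u e 0 0 - c e) ^+ 2 + tiny e ^+ 2 by rewrite ltr_pwDr ?sqr_ge0.
    rewrite ger0_norm ?invr_ge0 ?(ltW s0)// lef_pV2 ?posrE ?gexp_gt0// exprM.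
    have : (rho e ^+ K.+2) ^+ 2 <= `|u e 0 0 - c e| ^+ 2.
      by rewrite lerXn2r ?nnegrE// ltW// gexp_gt0.
    by rewrite real_normK ?num_real//; lra.
have far x u : X x -> is_repv u x -> \forall e \near eps0 R,
   rho e ^+ K.+2 <= u e 0 0 - lo e /\ rho e ^+ K.+2 <= hi e - u e 0 0.
  move=> Xx ux; have h := segment_range K.+2 Xx ux; near=> e.
  have /andP[h1 h2] : a e - rho e ^+ K.+2 <= u e 0 0 <= b e + rho e ^+ K.+2 by near: e.
  have h4 : 2%:R * rho e ^+ K.+2 <= rho e ^+ K.+1 by near: e; exact: natr_gexp.
  by rewrite /lo /hi; split; lra.
have akap : alg X (fun=> setT) kap.
  rewrite (_ : kap = fun e v => 2^-1 *
    ((Num.sqrt ((v 0 0 + -1 * lo e) * (v 0 0 + -1 * lo e) + tiny e * tiny e) +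
     -1 * Num.sqrt ((v 0 0 + -1 * hi e) * (v 0 0 + -1 * hi e) + tiny e * tiny e)) + (lo e + hi e))); last first.
    by apply/funext => e; apply/funext => v; rewrite /kap /smooth_clip !mulN1r -!expr2.
  apply: alg_mul; first by apply: alg_cst => //; exact: moderate_cst.
  apply: alg_add; last by apply: alg_cst => //; exact: rpredD.
  apply: alg_add; first by apply: aroot => // x u Xx ux; apply: filterS (far x u Xx ux) => e [h _];
    rewrite ler_normr h.
  apply: alg_mul; first by apply: alg_cst => //; exact: moderate_cst.
  by apply: aroot => // x u Xx ux; apply: filterS (far x u Xx ux) => e [_ h];
    rewrite ler_normr opprB h orbT.
have vkap x u : X x -> is_repv u x -> is_repv (fun e => \row_(j < 1) kap e (u e)) x.
  move=> Xx ux; apply: (repv_close ux) => k.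
  apply: filterS2 (far x u Xx ux) (tiny_small k) => e [h1 h2] h3.
  have r0 := gexp_gt0 (rho := rho) K.+2 e.
  apply: rv_norm_le; first by rewrite ltW// gexp_gt0.
  move=> j; rewrite !mxE ord1; apply: le_trans (smooth_clip_dist (tiny_gt0 e) _) h3.
  by apply/andP; split; lra.
exists (fun e v => F' e (\row_(j < 1) kap e v)).
split=> //; last first.
  move=> x u Xx ux; apply: near_rep (vF x _ Xx (vkap x u Xx ux)).
  by apply: filterS hgood => e ge; rewrite /F'; case: pselect.
apply: alg_mnet => //; apply: (alg_comp mF' (g := fun _ => kap)) => //.
  move=> e v _; rewrite /Om'; case: pselect => // ge /=.
  have -> : \row_(j < 1) kap e v = (kap e v)%:M :> 'rV[R]_1.
    by apply/rowP => j; rewrite !mxE ord1 eqxx.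
  apply: ge; have := smooth_clip_itv (v 0 0) (tiny_gt0 e) (lohi e); rewrite -/(kap e v).
  have := gexp_le (rho := rho) e (leqnSn K); rewrite /lo /hi => h /andP[h1 h2].
  by apply/andP; split; lra.
by move=> x u Xx ux; exists x => //; exact: vkap.
Unshelve. all: by end_near. Qed.

(** An arbitrary choice of defining net and of representatives of the endpoints
leads to the same class: two defining nets are uniformly negligibly close on
[a_e, b_e], and moving the endpoints by a negligible amount is harmless since the
integrand is bounded by a power of rho. *)
Lemma gintE Om F f : snet X Om F (fun z => f (z 0 0)) ->
  is_rep (fun e => \int[mu]_(s in `[a e, b e]) F e s%:M) (gint t1 t2 f t1 t2).
Proof.
move=> sF; have [y hy] := moderate_rep (int_moderate sF).
have uniq (z : gnum) fe ce ee : defines X (fun=> setT) fe (gfun1 (gscalar f)) ->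
    is_rep ce t1 -> is_rep ee t2 -> is_rep (fun k => oint (ce k) (ee k) (fun s => fe k s%:M 0 0)) z ->
    is_rep (fun e => \int[mu]_(s in `[a e, b e]) F e s%:M) z.
  move=> df c1 e2 hz.
  have sG : snet X (fun=> setT) (fun e x => fe e x 0 0) (fun z => f (z 0 0)).
    by apply: snet_eq (defines_snet 0 df) => x _; rewrite /gfun1 /gscalar mxE eqxx.
  set G := fun e x => fe e x 0 0 in sG.
  have [dG mG vG] := sG; have [dF mF vF] := sF.
  have cG e : continuous (fun s => G e s%:M).
    move=> s; have := @smooth_cts_line setT (G e) s s (mG.1 e) (fun _ _ => I) s.
    by apply; rewrite lexx.
  have [K hK'] := segment_bound dG mG.
  have hK : \forall e \near eps0 R, forall s,
      a e - rho e ^+ K <= s <= b e + rho e ^+ K -> `|G e s%:M| <= rho e ^- K.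
    by apply: filterS hK' => e h s hs; have [] := h s hs.
  have d1 k := (rep_eqP c1 at1).1 erefl k; have d2 k := (rep_eqP e2 bt2).1 erefl k.
  have neg := @segment_negligible (fun e v => F e v - G e v).
  have {}neg : forall k, \forall e \near eps0 R, forall s, a e <= s <= b e ->
      `|F e s%:M - G e s%:M| <= rho e ^+ k.
    apply: neg => x u Xx ux; exact: ((rep_eqP (vF x u Xx ux) (vG x u Xx ux)).1 erefl).
  have /moderateP[M hM] : (fun e => b e - a e) \in moderate rho.
    by apply: rpredB; [exact: rep_moderate bt2|exact: rep_moderate at1].
  have cF := segment_cts sF.
  apply: rep_equiv hz _ => k; near=> e.
  have b1 : forall s, a e - rho e ^+ K <= s <= b e + rho e ^+ K -> `|G e s%:M| <= rho e ^- K by near: e.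
  have b2 : `|ce e - a e| <= rho e ^+ (K + k).+2 by near: e; exact: d1.
  have b3 : `|ee e - b e| <= rho e ^+ (K + k).+2 by near: e; exact: d2.
  have b4 : forall s, a e <= s <= b e -> `|F e s%:M - G e s%:M| <= rho e ^+ (M + k).+2 by near: e; exact: neg.
  have b5 : `|b e - a e| <= rho e ^- M by near: e.
  have b6 : cts_on (a e) (b e) (fun s => F e s%:M) by near: e.
  have b7 : 3%:R * rho e ^+ k.+1 <= rho e ^+ k by near: e; exact: natr_gexp.
  have abe := ab e.
  have rK : rho e ^+ (K + k).+2 <= rho e ^+ K by apply: gexp_le; lia.
  have r0 := gexp_gt0 (rho := rho) K e.
  have m1 : `|oint (ce e) (ee e) (fun s => G e s%:M) - oint (a e) (b e) (fun s => G e s%:M)|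
     <= rho e ^- K * (`|ce e - a e| + `|ee e - b e|).
    apply: oint_move_ends; [exact: cG|move=> s hs; apply: b1..].
      have /andP[h1 h2] := between_pad (le_trans b2 rK) hs.
      by rewrite h1 (le_trans h2)// lerD2r.
    have /andP[h1 h2] := between_pad (le_trans b3 rK) hs.
    by rewrite h2 andbT (le_trans _ h1)// lerD2r.
  have m2 : `|\int[mu]_(s in `[a e, b e]) F e s%:M - oint (a e) (b e) (fun s => G e s%:M)|
     <= rho e ^+ (M + k).+2 * (b e - a e).
    rewrite /oint abe -intB//; last by move=> s _; exact: cG.
    apply: int_norm_le => //; apply: cts_onB => // s _; exact: cG.
  have m1' : rho e ^- K * (`|ce e - a e| + `|ee e - b e|) <= 2 * rho e ^+ k.+2.
    rewrite mulrC ler_pdivrMr// -mulrA -exprD (addnC k.+2) !addnS.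
    by rewrite mulr_natl mulr2n lerD.
  have m2' : rho e ^+ (M + k).+2 * (b e - a e) <= rho e ^+ k.+2.
    have h : b e - a e <= rho e ^- M by rewrite (le_trans _ b5)// ler_norm.
    rewrite (le_trans (ler_wpM2l (ltW (gexp_gt0 (rho := rho) _ e)) h))// ler_pdivrMr ?gexp_gt0// -exprD.
    by rewrite (addnC k.+2) !addnS.
  have m3 : rho e ^+ k.+2 <= rho e ^+ k.+1 by exact: gexp_le.
  have := ler_distD (oint (a e) (b e) (fun s => G e s%:M))
    (oint (ce e) (ee e) (fun s => G e s%:M)) (\int[mu]_(s in `[a e, b e]) F e s%:M).
  rewrite [X in _ <= _ + X -> _]distrC => h.
  exact: (le_trans h (triangle_budget (le_trans m1 m1') (le_trans m2 m2') m3 b7)).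
rewrite /gint; case: xgetP => [z _ [fe [ce [ee [df c1 e2 hz]]]]|/(_ y)].
  exact: uniq hz.
case; have [G sG] := extension_exists sF.
have df : defines X (fun=> setT) (fun e x => \row_(j < 1) G e x) (gfun1 (gscalar f)).
  apply: snet_defines; first exact: domain_setT.
  by move=> j; apply: snet_eq sG => x _; rewrite /gfun1 /gscalar mxE ord1 eqxx.
exists (fun e x => \row_(j < 1) G e x), a, b; split=> //.
have mo : (fun k => oint (a k) (b k) (fun s => (\row_(j < 1) G k s%:M) 0 0)) \in moderate rho.
  have -> : (fun k => oint (a k) (b k) (fun s => (\row_(j < 1) G k s%:M) 0 0)) =
     (fun k => \int[mu]_(s in `[a k, b k]) G k s%:M).
    apply/funext => k; rewrite /oint ab; congr (Rintegral _ _ _).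
    by apply/funext => s; rewrite mxE.
  exact: int_moderate sG.
have [z hz] := moderate_rep mo.
by rewrite (rep_inj hy (uniq z _ a b df at1 bt2 hz)).
Unshelve. all: by end_near. Qed.

End GeneralizedIntegral.

(** * Integrals depending on a parameter *)

Section ParametricIntegral.
Context {R : realType}.
Local Notation mu := (@lebesgue_measure R).

Definition row2 (T : Type) (s t : T) : 'rV[T]_2 := \row_(j < 2) (if j == 0 then s else t).

Lemma row2_dist (s t s' t' r : R) : `|s' - s| <= r -> `|t' - t| <= r ->
  `|row2 s' t' - row2 s t| <= r.
Proof.
move=> hs ht; apply: rv_norm_le => [|j]; first exact: le_trans hs.
by rewrite !mxE; case: ifP.
Qed.

Lemma row2_line (s t : R) : row2 s t = row2 0 t + s *: 'e_0.
Proof.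
apply/rowP => j; rewrite !mxE eqxx/=; case: (j == 0); first by rewrite add0r mulr1.
by rewrite mulr0 addr0.
Qed.

Lemma is_derive_row2 (F : 'rV[R]_2 -> R) (s t : R) : differentiable F (row2 s t) ->
  is_derive s (1 : R) (fun s => F (row2 s t)) ('D_('e_0) F (row2 s t)).
Proof.
rewrite row2_line => dF.
have -> : (fun s => F (row2 s t)) = (fun s => F (row2 0 t + s *: 'e_0)).
  by apply/funext => x; rewrite [in LHS]row2_line.
by apply: is_derive_line; exact: diff_derivable.
Qed.

Lemma row2_continuous (F : 'rV[R]_2 -> R) (s t : R) : {for row2 s t, continuous F} ->
  {for t, continuous (fun t => F (row2 s t))}.
Proof.
move=> cF; apply: (@continuous_comp _ _ _ (fun t => row2 s t) F) => //.
suff : row2 s y @[y --> t] --> row2 s t by [].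
apply/cvgrPdist_le => e e0; near=> y.
rewrite distrC; apply: row2_dist; first by rewrite subrr normr0 ltW.
rewrite distrC; near: y.
have : y @[y --> t] --> t by [].
by move/cvgrPdist_le; apply.
Unshelve. all: by end_near. Qed.

(** Tube lemma: compactness of [a, b]. *)
Lemma near_row2_cover (A : set 'rV[R]_2) (a b s : R) : a <= b ->
  (forall t, a <= t <= b -> nbhs (row2 s t) A) ->
  \forall s' \near s, forall t, a <= t <= b -> A (row2 s' t).
Proof.
move=> ab hA.
have cab := (compact_near_coveringP _).1 (@segment_compact R a b).
have := cab R (nbhs s) (fun s' t => A (row2 s' t)) _.
case => [t|e /= e0 he].
  rewrite /= in_itv/= => /hA/nbhs_ballP[r /= r0 rA].
  exists (ball t r, ball s r); first by split; exact: nbhsx_ballx.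
  move=> [t' s'] /= [tt ss]; apply: rA; rewrite -ball_normE /ball_/= distrC.
  move: tt ss; rewrite -!ball_normE /ball_/= => tt ss.
  apply: (@le_lt_trans _ _ (Num.max `|s - s'| `|t - t'|)).
    by apply: row2_dist; rewrite distrC le_max lexx ?orbT.
  by rewrite gt_max ss tt.
exists e => // s' ss t tab; apply: he => //=.
Qed.

Lemma cts_bounded (a b : R) (f : R -> R) : a <= b -> cts_on a b f ->
  exists2 C, 0 <= C & forall t, a <= t <= b -> `|f t| <= C.
Proof.
move=> ab cf.
have cn : cts_on a b (fun t => `|f t|).
  by move=> t /cf cft; apply: (@continuous_comp _ _ _ f Num.norm) => //; exact: norm_continuous.
have [c _ hc] := EVT_max ab (cts_on_within cn).
by exists `|f c| => // t tab; apply: hc; rewrite in_itv.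
Qed.

(** Differentiation under the integral sign with a constant dominating function;
the bound on the partial derivative near {s} x [a, b] comes from continuity and
compactness. *)
Lemma parametric_integral (Om : set 'rV[R]_2) F (a b s : R) : a <= b -> open Om ->
  smooth Om F -> (forall t, a <= t <= b -> Om (row2 s t)) ->
  is_derive s (1 : R) (fun s => \int[mu]_(t in `[a, b]) F (row2 s t))
    (\int[mu]_(t in `[a, b]) 'D_('e_0) F (row2 s t)).
Proof.
move=> ab oO sF hO.
have cD t : a <= t <= b -> {for t, continuous (fun t => 'D_('e_0) F (row2 s t))}.
  move=> /hO Ot; apply: (@row2_continuous ('D_('e_0) F)); apply: differentiable_continuous.
  exact: (sF [:: 0] _ Ot).
have [C C0 hC] := cts_bounded ab cD.
have := @near_row2_cover (fun v => Om v /\ `|'D_('e_0) F v| <= C + 1) a b s ab _.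
case=> [t tab|r /= r0 hr].
  have Ot := hO t tab.
  have cDt : {for row2 s t, continuous ('D_('e_0) F)}.
    by apply: differentiable_continuous; exact: (sF [:: 0] _ Ot).
  have h1 : \forall v \near row2 s t, `|'D_('e_0) F (row2 s t) - 'D_('e_0) F v| <= 1.
    by move/cvgrPdist_le : cDt; apply.
  apply: filterS2 (open_nbhs_nbhs (conj oO Ot)) h1 => v Ov hv; split=> //.
  have := hC t tab; move: hv; rewrite distrC => hv ht.
  have := ler_normD ('D_('e_0) F v - 'D_('e_0) F (row2 s t)) ('D_('e_0) F (row2 s t)).
  rewrite subrK; lra.
have inI x : x \in `]s - r, s + r[ -> forall t, a <= t <= b ->
    Om (row2 x t) /\ `|'D_('e_0) F (row2 x t)| <= C + 1.
  rewrite in_itv/= => /andP[h1 h2]; apply: hr; rewrite /ball_/= ltr_norml.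
  by apply/andP; split; lra.
have itv x : [set` `]s - r, s + r[] x -> x \in `]s - r, s + r[ by [].
have Is : [set` `]s - r, s + r[] s by rewrite /= in_itv/= ltrBlDr ltrDl r0.
have ci (f : 'rV[R]_2 -> R) x : smooth Om f -> [set` `]s - r, s + r[] x ->
    cts_on a b (fun t => f (row2 x t)).
  move=> sf /itv/inI h t tab; apply: row2_continuous; apply: differentiable_continuous.
  exact: (sf [::] _ (h t tab).1).
have intf x : [set` `]s - r, s + r[] x ->
    mu.-integrable `[a, b] (EFin \o (fun t => F (row2 x t))).
  by move=> Ix; apply: cts_on_integrable; exact: ci.
have dd x t : [set` `]s - r, s + r[] x -> [set` `[a, b]] t ->
    is_derive x (1 : R) (fun x => F (row2 x t)) ('D_('e_0) F (row2 x t)).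
  move=> /itv/inI h; rewrite /= in_itv/= => tab; apply: is_derive_row2.
  exact: (sF [::] _ (h t tab).1).
have derf x t (Ix : [set` `]s - r, s + r[] x) (Bt : [set` `[a, b]] t) :
    derivable (fun x => F (row2 x t)) x 1 by have [] := dd x t Ix Bt.
have G0 (t : R) : 0 <= cst (C + 1) t by rewrite /cst addr_ge0.
have iG : mu.-integrable `[a, b] (EFin \o cst (C + 1)).
  by apply: cts_on_integrable => t _; exact: cst_continuous.
have E x t : [set` `]s - r, s + r[] x -> [set` `[a, b]] t ->
    partial1of2 (fun x t => F (row2 x t)) x t = 'D_('e_0) F (row2 x t).
  by move=> Ix Bt; rewrite partial1of2E; have [_] := dd x t Ix Bt.
have Gb x t : [set` `]s - r, s + r[] x -> [set` `[a, b]] t ->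
    `|partial1of2 (fun x t => F (row2 x t)) x t| <= cst (C + 1) t.
  move=> Ix Bt; rewrite E//; apply: (inI x Ix t _).2.
  by move: Bt; rewrite /= in_itv.
have d1 := @derivable_under_integral R _ _ mu (fun x t => F (row2 x t)) [set` `[a, b]]
  (measurable_itv _) s (s - r) (s + r) Is intf derf (cst (C + 1)) G0 iG Gb.
have d2 := @differentiation_under_integral R _ _ mu (fun x t => F (row2 x t)) [set` `[a, b]]
  (measurable_itv _) s (s - r) (s + r) Is intf derf (cst (C + 1)) G0 iG Gb.
rewrite derive1E in d2.
apply: DeriveDef; first exact: d1.
rewrite d2; apply: eq_Rintegral => t /set_mem Bt; exact: E.
Qed.

End ParametricIntegral.

(** * Calculus of the generalized integral *)

Section GintCalculus.
Context {R : realType} {rho : gauge R}.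
Local Notation gnum := (gnum rho).
Local Notation net n := (idx R -> 'rV[R]_n -> R).
Local Notation mu := (@lebesgue_measure R).
Variables (t1 t2 : gnum) (a b : idx R -> R).
Hypotheses (at1 : is_rep a t1) (bt2 : is_rep b t2) (ab : forall e, a e <= b e).
Local Notation X := (gset1 (gitv t1 t2)).

Lemma gitv_t1 : gitv t1 t2 t1.
Proof. by split; [exists a, a; split|exists a, b; split]. Qed.

Lemma gitv_t2 : gitv t1 t2 t2.
Proof. by split; [exists a, b; split|exists b, b; split]. Qed.

Lemma gint_FTC B B' : cder (gitv t1 t2) B B' -> gint t1 t2 B' t1 t2 = B t2 - B t1.
Proof.
move=> [Om [F [sF sF']]].
have hI := gintE at1 bt2 ab (sF' 0).
have [dO mF vF] := sF; have [K hK] := segment_bound at1 bt2 ab dO mF.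
have X1 : X t1%:M by rewrite gset1_scalar; exact: gitv_t1.
have X2 : X t2%:M by rewrite gset1_scalar; exact: gitv_t2.
have r1 := vF _ _ X1 (repv_scalar at1); have r2 := vF _ _ X2 (repv_scalar bt2).
rewrite !scalar_rv1 in r1 r2.
apply: (rep_inj hI); apply: near_rep (repB r2 r1).
apply: filterS2 hK (segment_cts at1 bt2 ab (sF' 0)) => e hK cF.
apply/esym; apply: (@int_FTC _ _ _ _ (fun s => F e s%:M)) => // s hs; apply: line_derive.
by apply: (mF.1 e [::]); have [] := hK s (segment_pad K hs).
Qed.

Lemma gintB f g : (exists Om F, snet X Om F (fun z => f (z 0 0))) ->
  (exists Om F, snet X Om F (fun z => g (z 0 0))) ->
  gint t1 t2 (fun t => f t - g t) t1 t2 = gint t1 t2 f t1 t2 - gint t1 t2 g t1 t2.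
Proof.
move=> [OmF [F sF]] [OmG [G sG]].
have dO : domain X (fun e => OmF e `&` OmG e).
  by apply: domainI; [have [] := sF|have [] := sG].
have {}sF := snetW dO (fun e => @subIsetl _ _ _) sF.
have {}sG := snetW dO (fun e => @subIsetr _ _ _) sG.
have sD : snet X (fun e => OmF e `&` OmG e) (fun e v => F e v + -1 * G e v)
    (fun z => f (z 0 0) - g (z 0 0)).
  split=> //.
    apply: alg_mnet => //; apply: alg_add; first exact: snet_alg sF.
    apply: alg_mul; first by apply: alg_cst => //; exact: moderate_cst.
    exact: snet_alg sG.
  move=> x u Xx ux; have [_ _ vF] := sF; have [_ _ vG] := sG.
  under eq_fun do rewrite mulN1r.
  by apply: repB; [exact: vF|exact: vG].
have hF := gintE at1 bt2 ab sF; have hG := gintE at1 bt2 ab sG.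
apply: (rep_inj (gintE at1 bt2 ab sD)); apply: near_rep (repB hF hG).
apply: filterS2 (segment_cts at1 bt2 ab sF) (segment_cts at1 bt2 ab sG) => e cF cG.
rewrite -intB//; apply: eq_Rintegral => s _.
by rewrite mulN1r.
Qed.

Lemma segment_convex : convex_net (segment a b).
Proof.
by move=> e v w t vi wi t01; rewrite /segment/= !mxE; exact: convex_comb_itv.
Qed.

Hypothesis ab_lt : exists K, \forall e \near eps0 R, rho e ^+ K <= b e - a e.

(** A nonnegative integrand that exceeds rho^k at some point of the interval has,
being Lipschitz with a constant rho^-K, an integral of at least a fixed power of
rho, and this is not negligible. *)
Lemma gint_eq0 Om F f : snet X Om F (fun z => f (z 0 0)) ->
  (forall e v, Om e v -> 0 <= F e v) -> gint t1 t2 f t1 t2 = 0 ->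
  forall t, gitv t1 t2 t -> f t = 0.
Proof.
move=> sF F0 I0 t tI; have [dO mF vF] := sF.
have Xt : X t%:M by rewrite gset1_scalar.
have [u ut] := repv_exists (t%:M : 'rV[gnum]_1).
have ct := clipv_rep at1 bt2 ab (i := 0) Xt ut.
set c := clipv a b 0 u in ct.
have hF := vF _ _ Xt ct; rewrite scalar_rv1 in hF.
apply/(rep_zeroP hF) => k.
have hI := gintE at1 bt2 ab sF; rewrite I0 in hI; move/(rep_zeroP hI) : (erefl (0 : gnum)) => {}hI.
have [K1 h1] := segment_bound at1 bt2 ab dO mF.
have [K2 h2] := lipschitz_bound dO mF (segment_a ab) (segment_inside at1 bt2 ab) segment_convex.
have [K3 h3] := ab_lt.
have cF := segment_cts at1 bt2 ab sF.
(* rho^p is the length of the interval on which F stays above rho^k / 2: it is small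
   compared with rho^k over the Lipschitz constant, and with b - a. *)
pose p := (k + K2 + K3).+3.
near=> e.
have b1 : forall s, a e - rho e ^+ K1 <= s <= b e + rho e ^+ K1 ->
  Om e s%:M /\ `|F e s%:M| <= rho e ^- K1 by near: e.
have b2 : forall v w, tube (rho := rho) (segment a b) K2 e v ->
    tube (rho := rho) (segment a b) K2 e w ->
    `|F e v - F e w| <= rho e ^- K2 * `|v - w| by near: e.
have b3 : rho e ^+ K3 <= b e - a e by near: e.
have b4 : cts_on (a e) (b e) (fun s => F e s%:M) by near: e.
have b5 : `|\int[mu]_(s in `[a e, b e]) F e s%:M| <= rho e ^+ (k + p).+2 by near: e; exact: hI.
have b6 : 3%:R * rho e ^+ (k + p).+1 <= rho e ^+ (k + p) by near: e; exact: natr_gexp.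
have b7 : 2%:R * rho e ^+ p <= rho e ^+ p.-1 by near: e; exact: natr_gexp.
have cab : a e <= c e 0 0 <= b e by exact: clipv_itv.
have sO s : a e <= s <= b e -> Om e s%:M by move=> hs; have [] := b1 s (segment_pad K1 hs).
have Ec : (c e 0 0)%:M = c e by apply/rowP => j; rewrite mxE !ord1 eqxx.
have Fc0 : 0 <= F e (c e) by apply: F0; rewrite -Ec; exact: sO.
rewrite ger0_norm// leNgt; apply/negP => Fc.
have p0 := gexp_gt0 (rho := rho) p e.
have pK3 : rho e ^+ p.-1 <= rho e ^+ K3 by apply: gexp_le; exact: leqW (leqW (leq_addl _ _)).
have pk : rho e ^- K2 * rho e ^+ p * 2 <= rho e ^+ k.
  rewrite -mulrA mulrC ler_pdivrMr ?gexp_gt0// -exprD [_ * 2]mulrC.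
  by apply: le_trans b7 _; apply: gexp_le; exact: leqW (leqW (leq_addr _ _)).
have lip s : a e <= s <= b e -> `|F e s%:M - F e (c e 0 0)%:M| <= rho e ^- K2 * `|s - c e 0 0|.
  move=> hs; apply: le_trans (b2 _ _ _ _) _.
  - by apply: tube_base; rewrite /segment/= mxE eqxx.
  - by apply: tube_base; rewrite /segment/= mxE eqxx.
  by rewrite -raddfB/= norm_scalar.
have := int_lower b4 (fun s hs => F0 e _ (sO s hs)) cab p0 (ltW (gexpV_gt0 K2 e)) _ pk _ lip.
rewrite Ec => /(_ _ (ltW Fc)) H.
have : rho e ^+ k / 2 * rho e ^+ p <= rho e ^+ (k + p).+2.
  apply: le_trans (H _) (le_trans (ler_norm _) b5).
  by rewrite mulrC; lra.
rewrite mulrAC -exprD => h.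
have r0 := gexp_gt0 (rho := rho) (k + p).+1 e.
have := gexp_le (rho := rho) e (leqnSn (k + p).+1).
lra.
Unshelve. all: by end_near. Qed.

Definition slice (T : Type) (U : zmodType) (f : 'rV[U]_2 -> T) (s : U) : 'rV[U]_1 -> T :=
  fun v => f (row2 s (v 0 0)).

Lemma row2E (U : zmodType) (s t : U) : row2 s t 0 0 = s /\ row2 s t 0 1 = t.
Proof. by rewrite !mxE. Qed.

Lemma repv_row2 (s t : idx R -> R) (x y : gnum) : is_rep s x -> is_rep t y ->
  is_repv (fun e => row2 (s e) (t e)) (row2 x y).
Proof.
move=> sx ty j; rewrite !mxE; under eq_fun do rewrite !mxE.
by case: (j == 0).
Qed.

Local Notation strip := (slab t1 t2 (1 : 'I_2)).

Lemma snet_slice Om F g s u : snet strip Om F g -> is_rep u s ->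
  exists Om', snet X Om' (fun e => slice (F e) (u e)) (fun z => g (row2 s (z 0 0))).
Proof.
move=> [dO mF vF] us.
have XS (x : 'rV[gnum]_1) : X x -> strip (row2 s (x 0 0)) by rewrite /slab/= mxE.
have rv (x : 'rV[gnum]_1) v : X x -> is_repv v x ->
    is_repv (fun e => row2 (u e) (v e 0 0)) (row2 s (x 0 0)).
  by move=> Xx vx; apply: repv_row2 => //; exact: vx.
pose c (j : 'I_2) e (v : 'rV[R]_1) : R := if j == 0 then u e else v 0 0.
have dc j e x : differentiable (c j e) x.
  by rewrite /c; case: (j == 0); [exact: differentiable_cst|exact: differentiable_coord].
pose Om' e := [set v : 'rV[R]_1 | setT v /\ Om e (\row_j c j e v)].
have dO' : domain X Om'.
  split=> [e|x Xx v vx].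
    apply: open_preimage_on; [exact: openT|exact: dO.1|].
    move=> x _; apply: differentiable_continuous; apply: differentiable_row => j; exact: dc.
  by apply: filterS (dO.2 _ (XS x Xx) _ (rv x v Xx vx)) => e.
exists Om'; split=> //; last by move=> x v Xx vx; apply: vF; [exact: XS|exact: rv].
apply: alg_mnet => //; apply: (alg_comp mF (g := c)) => [j|e x []//|x v Xx vx].
  rewrite /c; case: (j == 0); first by apply: alg_cst => //; exact: rep_moderate us.
  by apply: alg_base; exact: mnet_coord.
by exists (row2 s (x 0 0)); [exact: XS|exact: rv].
Qed.

Definition pint (F : 'rV[R]_2 -> R) (c d : R) (x : 'rV[R]_1) : R :=
  \int[mu]_(t in `[c, d]) F (row2 (x 0 0) t).

Lemma pint_differentiable (Om : set 'rV[R]_2) F c d (x : 'rV[R]_1) :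
  c <= d -> open Om -> smooth Om F ->
  (forall t, c <= t <= d -> Om (row2 (x 0 0) t)) ->
  differentiable (pint F c d) x /\ 'D_('e_0) (pint F c d) x = pint ('D_('e_0) F) c d x.
Proof.
move=> cd oO sF hO; have [d1 E] := parametric_integral cd oO sF hO.
have ds : differentiable (fun s => \int[mu]_(t in `[c, d]) F (row2 s t)) (x 0 0).
  exact/derivable1_diffP.
have dc : differentiable (fun x : 'rV[R]_1 => x 0 0) x by exact: differentiable_coord.
have dp : differentiable (pint F c d) x.
  exact: (differentiable_comp dc ds).
split=> //; rewrite (deriveE _ dp) (diff_comp dc ds)/= -(deriveE _ dc) deriv1E//.
by rewrite derive_coord mxE !eqxx derive1E E scale1r.
Qed.

(** The net of integrals is a moderate smooth net in the parameter; by mnet_coind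
this follows from moderateness and one differentiation, as the class of such
integrals is closed under differentiation. *)
Lemma gint_param Om F g : snet strip Om F g ->
  snet (setT : set 'rV[gnum]_1)
    (fun e => [set x : 'rV[R]_1 | forall t, a e <= t <= b e -> Om e (row2 (x 0 0) t)])
    (fun e => pint (F e) (a e) (b e)) (fun z => gint t1 t2 (fun t => g (row2 (z 0 0) t)) t1 t2) /\
  forall e (x : 'rV[R]_1), (forall t, a e <= t <= b e -> Om e (row2 (x 0 0) t)) ->
    'D_('e_0) (pint (F e) (a e) (b e)) x = pint (pder [:: 0] (F e)) (a e) (b e) x.
Proof.
move=> sF; have [dO mF vF] := sF.
have bnd (G : net 2) (x : 'rV[gnum]_1) u : mnet strip Om G -> is_repv u x -> exists K, \forall e \near eps0 R,
    forall t, a e <= t <= b e -> Om e (row2 (u e 0 0) t) /\ `|G e (row2 (u e 0 0) t)| <= rho e ^- K.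
  move=> mG ux.
  pose C e : set 'rV[R]_2 := [set v | exists2 t, a e <= t <= b e & v = row2 (u e 0 0) t].
  have Ca e : C e (row2 (u e 0 0) (a e)) by exists (a e) => //; rewrite lexx ab.
  have CX : net_inside C strip.
    have ml : (fun e => b e - a e) \in moderate rho.
      by apply: rpredB; [exact: rep_moderate bt2|exact: rep_moderate at1].
    apply: (slab_inside at1 bt2 (repv_row2 (ux 0) at1) ml) => e w [t tab ->]; split.
      by rewrite mxE.
    have /andP[t1' t2'] := tab; apply: row2_dist; first by rewrite subrr normr0 subr_ge0.
    by rewrite ger0_norm; lra.
  have [K hK] := uniform_bound dO mG Ca CX.
  exists K; apply: filterS hK => e hK t tab; apply: hK; apply: tube_base.
  by exists t.
pose OJ e := [set x : 'rV[R]_1 | forall t, a e <= t <= b e -> Om e (row2 (x 0 0) t)].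
have dJ : domain (setT : set 'rV[gnum]_1) OJ.
  split=> [e|x _ u ux]; last first.
    have [K hK] := bnd F x u mF ux; apply: filterS hK => e hK t tab.
    by have [] := hK t tab.
  rewrite openE => x Ox.
  have h : \forall s \near x 0 0, forall t, a e <= t <= b e -> Om e (row2 s t).
    by apply: near_row2_cover => // t tab; apply: open_nbhs_nbhs; split; [exact: dO.1|exact: Ox].
  exact: (@coord_continuous R 1 1 0 0 x _ h).
pose A (H : net 1) := exists2 G : net 2, mnet strip Om G & H = fun e => pint (G e) (a e) (b e).
have mJ G : mnet strip Om G -> mnet (setT : set 'rV[gnum]_1) OJ (fun e => pint (G e) (a e) (b e)).
  move=> mG; apply: (@mnet_coind _ _ _ _ _ A) => //; last by exists G.
  - move=> _ [H mH ->] e x Ox.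
    exact: (pint_differentiable (ab e) (dO.1 e) (mH.1 e) Ox).1.
  - move=> _ [H mH ->] x u _ ux; have [K hK] := bnd H x u mH ux.
    apply: (@near_moderate _ _ (fun e => rho e ^- K * (b e - a e))); last first.
      apply: rpredM; first exact: gexpV_moderate.
      by apply: rpredB; [exact: rep_moderate bt2|exact: rep_moderate at1].
    apply: filterS hK => e hK.
    rewrite [leRHS]ger0_norm; last by rewrite mulr_ge0 ?subr_ge0// ltW// gexpV_gt0.
    apply: int_norm_le => // [t tab|t tab]; last by have [] := hK t tab.
    apply: row2_continuous; apply: differentiable_continuous; apply: (mH.1 e [::]).
    by have [] := hK t tab.
  - move=> _ [H mH ->] i; exists (fun e => pint (pder [:: 0] (H e)) (a e) (b e)); split.
      by exists (fun e => pder [:: 0] (H e)) => //; exact: mnet_pder.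
    move=> e x Ox; rewrite ord1.
    exact: (pint_differentiable (ab e) (dO.1 e) (mH.1 e) Ox).2.
split; last by move=> e x Ox; exact: (pint_differentiable (ab e) (dO.1 e) (mF.1 e) Ox).2.
split=> //; first exact: mJ.
move=> x u _ ux; have [Om' sl] := snet_slice sF (ux 0).
have := gintE at1 bt2 ab (f := fun t => g (row2 (x 0 0) t)) sl.
apply: near_rep; apply: nearW => e; apply: eq_Rintegral => t _.
by rewrite /slice mxE eqxx mulr1n.
Qed.

Lemma gint_derive g dg : sgrad strip g dg ->
  cder setT (fun s => gint t1 t2 (fun t => g (row2 s t)) t1 t2)
    (fun s => gint t1 t2 (fun t => dg 0 (row2 s t)) t1 t2).
Proof.
move=> [Om [F [sF sF']]].
have [sJ EJ] := gint_param sF; have [sJ' _] := gint_param (sF' 0).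
have [dJ mJ _] := sJ.
have dJ' : domain (gset1 setT : set 'rV[gnum]_1) (fun e => [set x : 'rV[R]_1 | forall t, a e <= t <= b e -> Om e (row2 (x 0 0) t)]).
  exact: domain_sub dJ.
exists (fun e => [set x : 'rV[R]_1 | forall t, a e <= t <= b e -> Om e (row2 (x 0 0) t)]),
  (fun e => pint (F e) (a e) (b e)); split.
  by apply: snet_sub sJ.
move=> i; rewrite ord1; split=> //.
  by apply: mnet_sub (mnet_pder [:: 0] mJ).
move=> x u _ ux; have [_ _ vJ] := sJ'.
apply: near_rep (vJ x u I ux).
by apply: filterS (dJ.2 x I u ux) => e Oe; rewrite /= EJ.
Qed.

End GintCalculus.

(** * Smooth curves *)

Section SmoothCurves.
Context {R : realType} {rho : gauge R}.
Local Notation gnum := (gnum rho).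

Lemma snet_sgrad n (X : set 'rV[gnum]_n) Om F f : snet X Om F f -> exists g, sgrad X f g.
Proof.
move=> sF; have [g hg] := choice (fun i => snet_pder [:: i] sF).
by exists g, Om, F.
Qed.

Definition csmooth (T : set gnum) f := exists f', cder T f f'.

Lemma csmooth_cder T f f' : cder T f f' -> csmooth T f.
Proof. by exists f'. Qed.

Lemma csmooth_snet T f : (exists Om F, snet (gset1 T) Om F (fun z => f (z 0 0))) <-> csmooth T f.
Proof.
split=> [[Om [F sF]]|[f' [Om [F [sF _]]]]]; last by exists Om, F.
have [g hg] := snet_sgrad sF; exists (fun t => g 0 t%:M).
by apply: sgrad_eq hg => // i z _; rewrite ord1 rv1_scalar.
Qed.

Lemma csmooth_derive T f f' : cder T f f' -> csmooth T f'.
Proof. by move=> h; apply/csmooth_snet; exact: (sgrad_snet 0 h). Qed.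

Lemma csmoothM T f g : csmooth T f -> csmooth T g -> csmooth T (fun t => f t * g t).
Proof. by move=> [f' hf] [g' hg]; exact: csmooth_cder (cderM hf hg). Qed.

Lemma csmoothD T f g : csmooth T f -> csmooth T g -> csmooth T (fun t => f t + g t).
Proof. by move=> [f' hf] [g' hg]; exact: csmooth_cder (cderD hf hg). Qed.

Lemma csmooth_cst T c : csmooth T (fun=> c).
Proof. exact: csmooth_cder (cder_cst T c). Qed.

Lemma csmooth_sub_cst T c : csmooth T (fun t => t - c).
Proof. exact: csmooth_cder (cderB (cder_id T) (cder_cst T c)). Qed.

Lemma csmoothX T f n : csmooth T f -> csmooth T (fun t => f t ^+ n).
Proof.
move=> hf; elim: n => [|n ih]; first exact: csmooth_cst.
under eq_fun do rewrite exprS; exact: csmoothM.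
Qed.

Lemma csmooth_sum T (I : Type) (r : seq I) f : (forall i, csmooth T (f i)) ->
  csmooth T (fun t => \sum_(i <- r) f i t).
Proof.
by move=> h; have [f' hf] := choice h; exact: csmooth_cder (cder_sum r hf).
Qed.

Lemma csmooth_eq T f g : (forall t, T t -> f t = g t) -> csmooth T f -> csmooth T g.
Proof. by move=> fg [f' hf]; exists f'; exact: cder_eq hf. Qed.

Lemma csmooth_gsmooth n T (f : gnum -> 'rV[gnum]_n) :
  (forall j, csmooth T (fun t => f t 0 j)) <-> gsmooth (gset1 T) (gfun1 f).
Proof.
by split=> h j;
  [exact: ((csmooth_snet _ _).2 (h j))|exact: ((csmooth_snet _ _).1 (h j))].
Qed.

Lemma gder_scalar (T : set gnum) f f' t : regular (gset1 T) -> cder T f f' -> T t ->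
  gder T 1 (gscalar f) t 0 0 = f' t.
Proof.
move=> rT hf Tt; apply: (gder_cder (f' := fun _ => f')) => // j.
by apply: cder_eq hf => // u _; rewrite /gscalar ord1 scalar_rv1.
Qed.

Lemma cder_subX (T : set gnum) c n :
  cder T (fun t => (t - c) ^+ n.+1) (fun t => n.+1%:R * (t - c) ^+ n).
Proof.
have d1 : cder T (fun t => t - c) (fun=> 1).
  by apply: cder_eq (cderB (cder_id T) (cder_cst T c)) => // t _; rewrite subr0.
elim: n => [|n ih].
  by apply: cder_eq d1 => t _; rewrite ?expr1// expr0 mulr1.
apply: cder_eq (cderM d1 ih) => t _; first by rewrite -exprS.
by rewrite mulrCA -exprS mulr1 -{2}[_ ^+ n.+1]mul1r -mulrDl natr1.
Qed.

(** Differentiation lowers the order of vanishing at c by at most one. *)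
Lemma cder_ord_vanish T c n g f f' : regular (gset1 T) -> csmooth T g ->
  (forall t, T t -> f t = (t - c) ^+ n.+1 * g t) -> cder T f f' ->
  exists2 g1, csmooth T g1 & forall t, T t -> f' t = (t - c) ^+ n * g1 t.
Proof.
move=> rT [g' hg] fE hf.
exists (fun t => n.+1%:R * g t + (t - c) * g' t).
  apply: csmoothD; first by apply: csmoothM; [exact: csmooth_cst|exact: csmooth_cder hg].
  by apply: csmoothM; [exact: csmooth_sub_cst|exact: csmooth_derive hg].
move=> t Tt.
rewrite (cder_unique rT hf (cderM (cder_subX T c n) hg) fE Tt) exprS.
by ring.
Qed.

Lemma gder_vanish k T c n g (f : gnum -> 'rV[gnum]_k) j : regular (gset1 T) ->
  gsmooth (gset1 T) (gfun1 f) -> csmooth T g -> T c ->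
  (forall t, T t -> f t 0 j = (t - c) ^+ n * g t) ->
  forall i, (i < n)%N -> gder T i f c 0 j = 0.
Proof.
move=> rT sf sg Tc fE i lt_in.
suff [g1 _ E] : exists2 g1, csmooth T g1 &
    forall t, T t -> gder T i f t 0 j = (t - c) ^+ (n - i) * g1 t.
  by rewrite E// subrr expr0n subn_eq0 leqNgt lt_in mul0r.
elim: i lt_in => [|i ih] lt_in.
  by exists g => // t Tt; rewrite gder0// subn0 fE.
have [g1 sg1 E1] := ih (ltnW lt_in).
have Ei : (n - i = (n - i.+1).+1)%N by rewrite subnS prednK// subn_gt0 ltnW.
rewrite Ei in E1.
exact: cder_ord_vanish rT sg1 E1 (cder_gder i j rT sf).
Qed.

Lemma gder_lincomb k T (f h : gnum -> 'rV[gnum]_k) s i j t : regular (gset1 T) ->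
  gsmooth (gset1 T) (gfun1 f) -> gsmooth (gset1 T) (gfun1 h) -> T t ->
  gder T i (fun t => f t + s *: h t) t 0 j = gder T i f t 0 j + s * gder T i h t 0 j.
Proof.
move=> rT sf sh Tt.
have sfh : gsmooth (gset1 T) (gfun1 (fun t => f t + s *: h t)).
  apply/csmooth_gsmooth => l.
  apply: (@csmooth_eq _ (fun t => f t 0 l + s * h t 0 l)).
    by move=> u _; rewrite !mxE.
  apply: csmoothD; first by move/csmooth_gsmooth : sf; apply.
  by apply: csmoothM; [exact: csmooth_cst|move/csmooth_gsmooth : sh; apply].
elim: i t Tt => [|i ih] t Tt; first by rewrite !gder0// !mxE.
have c1 := cder_gder i j rT sfh.
have c2 := cderD (cder_gder i j rT sf) (cderM (cder_cst T s) (cder_gder i j rT sh)).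
rewrite (cder_unique rT c1 c2 ih Tt).
by rewrite mulr0 addr0.
Qed.

Lemma sgrad_curve n (X : set 'rV[gnum]_n) T f f' c dc : cder T f f' -> sgrad X c dc ->
  (forall z, X z -> T (c z)) -> sgrad X (fun z => f (c z)) (fun l z => f' (c z) * dc l z).
Proof.
move=> hf hc XT.
have := @sgrad_comp _ _ _ 1 X (gset1 T) _ _ (fun _ => c) (fun _ => dc) hf (fun _ => hc).
move=> H; apply: sgrad_eq (H _) => [z Xz|l z Xz|z Xz]; rewrite ?big_ord1 /gset1/= ?mxE//.
exact: XT.
Qed.

Lemma gint_eq (t1 t2 : gnum) f g : glt t1 t2 -> csmooth (gitv t1 t2) f ->
  (forall t, gitv t1 t2 t -> f t = g t) -> gint t1 t2 f t1 t2 = gint t1 t2 g t1 t2.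
Proof.
move=> [[a [b [at1 bt2 ab]]] _] /csmooth_snet[Om [F sF]] fg.
have sG : snet (gset1 (gitv t1 t2)) Om F (fun z => g (z 0 0)).
  by apply: snet_eq sF => z Xz; exact: fg.
exact: rep_inj (gintE at1 bt2 ab sF) (gintE at1 bt2 ab sG).
Qed.

Lemma sopen_setT n : sopen (setT : set 'rV[gnum]_n).
Proof. by move=> x _; exists (grho ^+ 0); [exact: grho_gt0|]. Qed.

(** Summation by parts, with p_j playing the part of the momenta, A_j of the
partial gradients of L and u_j of successive derivatives of a variation: the terms
u_j p_j cancel up to the defect of u' from being the shift of u. *)
Lemma telescope_phi (V : comPzRingType) (n : nat) (p A u u' : nat -> V) :
  p n = A n ->
  \sum_(j < n) (p j.+1 * u' j + u j * (A j - p j)) =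
  \sum_(j < n.+1) A j * u j - p 0%N * u 0%N + \sum_(j < n) p j.+1 * (u' j - u j.+1).
Proof.
move=> pA; rewrite big_ord_recr/= -pA.
suff -> : \sum_(j < n) (p j.+1 * u' j + u j * (A j - p j)) =
    p n * u n - p 0%N * u 0%N + \sum_(j < n) A j * u j +
    \sum_(j < n) p j.+1 * (u' j - u j.+1) by ring.
elim: n {pA} => [|n ih]; first by rewrite !big_ord0; ring.
by rewrite !big_ord_recr/= ih; ring.
Qed.

End SmoothCurves.

(** * Derivatives of the Lagrangian along a curve *)

Section Lagrangian.
Context {R : realType} {rho : gauge R} {d m : nat}.
#[local] Opaque gpd gint.
Local Notation gnum := (gnum rho).

Lemma glt_reps (t1 t2 : gnum) : glt t1 t2 -> exists a b : idx R -> R,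
  [/\ is_rep a t1, is_rep b t2, forall e, a e <= b e &
      exists K, \forall e \near eps0 R, rho e ^+ K <= b e - a e].
Proof.
move=> t12; have [[a [b [at1 bt2 ab]]] _] := t12; exists a, b; split=> //.
have [K hK] := (gltP at1 bt2).1 t12; exists K.
by apply: filterS hK => e; rewrite lerBrDl.
Qed.

Context (t1 t2 : gnum) (t12 : glt t1 t2).
Local Notation I := (gitv t1 t2).

Lemma gitv_regular : regular (gset1 I).
Proof.
have [a [b [at1 bt2 ab ab_lt]]] := glt_reps t12.
exact: (slab_regular (i := 0 : 'I_1) at1 bt2 ab ab_lt).
Qed.

Lemma lagr_regular : regular (lagr_dom (d := d) (m := m) t1 t2).
Proof.
have [a [b [at1 bt2 ab ab_lt]]] := glt_reps t12.
have -> : lagr_dom t1 t2 = slab t1 t2 (lshift (m.+1 * d) (0 : 'I_1)).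
  apply/seteqP; split=> z; first by case; rewrite /slab/= mxE.
  by rewrite /slab/= => h; split; rewrite ?mxE.
exact: (slab_regular at1 bt2 ab ab_lt).
Qed.

Context (L : gnum -> 'M[gnum]_(m.+1, d) -> gnum).
Hypothesis L_gsf : gsf (lagr_dom (d := d) (m := m) t1 t2) setT (lagr_fun L).

Definition lagr_arg (t : gnum) (v : 'M[gnum]_(m.+1, d)) : 'rV[gnum]_(1 + m.+1 * d) :=
  row_mx t%:M (mxvec v).

Definition lagr_pd alpha t v : gnum :=
  gpd (lagr_dom t1 t2) alpha (lagr_fun L) (lagr_arg t v) 0 0.

Definition lagr_t t v : gnum := lagr_pd [:: lshift (m.+1 * d) 0] t v.

Lemma lagr_arg_dom t v : I t -> lagr_dom t1 t2 (lagr_arg t v).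
Proof. by move=> It; split=> //; rewrite row_mxKl scalar_rv1. Qed.

Lemma lagr_pd_nil t v : I t -> lagr_pd [::] t v = L t v.
Proof.
move=> It; rewrite /lagr_pd (gpd_nil lagr_regular (gsf_gsmooth L_gsf)); last exact: lagr_arg_dom.
by rewrite /lagr_fun /gscalar /gfun2 scalar_rv1 row_mxKl row_mxKr mxvecK scalar_rv1.
Qed.

(** The chain rule, for L and its partial derivatives of every order, with the
entries of the argument of L regrouped as time and the rows of the jet. *)
Lemma lagr_chain n (X : set 'rV[gnum]_n) c dc
    (M : 'I_m.+1 -> 'I_d -> 'rV[gnum]_n -> gnum) dM alpha :
  sgrad X c dc -> (forall i k, sgrad X (M i k) (dM i k)) -> (forall x, X x -> I (c x)) ->
  sgrad X (fun x => lagr_pd alpha (c x) (\matrix_(i, k) M i k x))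
    (fun l x => lagr_pd (lshift (m.+1 * d) 0 :: alpha) (c x) (\matrix_(i, k) M i k x) * dc l x +
      \sum_i \sum_k
        lagr_pd (rshift 1 (mxvec_index i k) :: alpha) (c x) (\matrix_(i, k) M i k x) * dM i k l x).
Proof.
move=> hc hM XI.
pose f (j : 'I_(1 + m.+1 * d)) x := lagr_arg (c x) (\matrix_(i, k) M i k x) 0 j.
pose df (j : 'I_(1 + m.+1 * d)) l x := lagr_arg (dc l x) (\matrix_(i, k) dM i k l x) 0 j.
have hf j : sgrad X (f j) (df j).
  have [j0 ->|j1 ->] := split_ordP j.
    by apply: sgrad_eq hc => [x|l x] _; rewrite /f /df /lagr_arg row_mxEl ord1 scalar_rv1.
  case/mxvec_indexP: j1 => i k.
  by apply: sgrad_eq (hM i k) => [x|l x] _; rewrite /f /df /lagr_arg row_mxEr mxvecE mxE.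
have fE x : \row_j f j x = lagr_arg (c x) (\matrix_(i, k) M i k x) by apply/rowP => j; rewrite mxE.
have := sgrad_comp (sgrad_gpd alpha 0 lagr_regular (gsf_gsmooth L_gsf)) hf.
move=> H; apply: sgrad_eq (H _) => [x Xx|l x Xx|x Xx]; rewrite fE//; last first.
  by apply: lagr_arg_dom; exact: XI.
rewrite (@big_split_ord _ _ _ 1 (m.+1 * d))/= big_ord1; congr (_ + _).
  by rewrite /df /lagr_arg row_mxEl scalar_rv1.
rewrite pair_bigA/= (reindex _ (curry_mxvec_bij m.+1 d)).
by apply: eq_bigr => -[i k] _; rewrite /df /lagr_arg row_mxEr mxvecE mxE.
Qed.

Lemma lagr_gradE (i : 'I_m.+1) t v k :
  lagr_grad t1 t2 L i t v 0 k = lagr_pd [:: rshift 1 (mxvec_index i k)] t v.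
Proof. by rewrite mxE inord_val. Qed.

Section AlongCurve.
Context (q : gnum -> 'rV[gnum]_d).
Hypothesis q_smooth : gsmooth (gset1 I) (gfun1 q).

Lemma cder_jet (i : nat) k : cder I (fun t => gder I i q t 0 k) (fun t => gder I i.+1 q t 0 k).
Proof. exact: cder_gder gitv_regular q_smooth. Qed.

Lemma lagr_pd_jet alpha : csmooth I (fun t => lagr_pd alpha t (jet (m := m) t1 t2 q t)).
Proof.
have [Om [F [sF _]]] :=
  lagr_chain alpha (cder_id I) (fun i k => cder_jet (i : 'I_m.+1) k) (fun _ h => h).
by apply/csmooth_snet; exists Om, F; exact: sF.
Qed.

Lemma lagr_grad_jet i k :
  csmooth I (fun t => lagr_grad t1 t2 L i t (jet t1 t2 q t) 0 k).
Proof.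
by under eq_fun do rewrite mxE; exact: lagr_pd_jet.
Qed.

Lemma cder_Lq : cder I (Lq t1 t2 L q) (fun t => lagr_t t (jet t1 t2 q t) +
  \sum_(i < m.+1) dot (lagr_grad t1 t2 L i t (jet t1 t2 q t)) (gder I i.+1 q t)).
Proof.
have := lagr_chain [::] (cder_id I) (fun i k => cder_jet (i : 'I_m.+1) k) (fun _ h => h).
apply: sgrad_eq => [z Iz|l z Iz]; first by rewrite lagr_pd_nil.
rewrite [X in X + _]mulr1; congr (_ + _); apply: eq_bigr => i _; apply: eq_bigr => k _.
by rewrite lagr_gradE.
Qed.

Local Notation A i t := (lagr_grad t1 t2 L i t (jet t1 t2 q t)).

Lemma lagr_grad_gsmooth i : gsmooth (gset1 I) (gfun1 (fun t => A i t)).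
Proof. by apply/csmooth_gsmooth => k; exact: lagr_grad_jet. Qed.

Lemma phiE j t k : phi t1 t2 L j q t 0 k =
  \sum_(i < (m - j).+1) (-1) ^+ i * gder I i (fun u => A (i + j) u) t 0 k.
Proof. by rewrite summxE; apply: eq_bigr => i _; rewrite mxE. Qed.

Lemma phi_csmooth j k : csmooth I (fun t => phi t1 t2 L j q t 0 k).
Proof.
apply: csmooth_eq (fun t _ => esym (phiE j t k)) _.
apply: csmooth_sum => i; apply: csmoothM; first exact: csmooth_cst.
exact: csmooth_cder (cder_gder i k gitv_regular (lagr_grad_gsmooth _)).
Qed.

Lemma phi_recl j t k : (j < m)%N -> I t ->
  phi t1 t2 L j q t 0 k = A j t 0 k -
    \sum_(i < (m - j.+1).+1) (-1) ^+ i * gder I i.+1 (fun u => A (i + j.+1) u) t 0 k.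
Proof.
move=> jm It; rewrite phiE -(subnSK jm) big_ord_recl expr0 mul1r.
rewrite (gder0 gitv_regular (lagr_grad_gsmooth _) It) -sumrN; congr (_ + _).
by apply: eq_bigr => i _; rewrite /= exprS mulN1r mulNr addnS.
Qed.

(** The recursion behind the definition of the momenta: taking the derivative
shifts the alternating sum by one, and the missing first term is the partial
gradient of L. *)
Lemma cder_phi j k : (j < m)%N ->
  cder I (fun t => phi t1 t2 L j.+1 q t 0 k) (fun t => A j t 0 k - phi t1 t2 L j q t 0 k).
Proof.
move=> jm.
have h := cder_sum (index_enum 'I_(m - j.+1).+1) (fun i : 'I_(m - j.+1).+1 =>
  cderM (cder_cst I ((-1) ^+ i)) (cder_gder i k gitv_regular (lagr_grad_gsmooth (i + j.+1)))).
apply: cder_eq h => t It; first by rewrite phiE.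
rewrite (phi_recl k jm It) opprB addrCA subrr addr0; apply: eq_bigr => i _.
by rewrite [X in _ + X]mulr0 addr0.
Qed.

Lemma phi_last t k : I t -> phi t1 t2 L m q t 0 k = A m t 0 k.
Proof.
move=> It; rewrite phiE subnn big_ord1 mul1r.
by rewrite (gder0 gitv_regular (lagr_grad_gsmooth _) It).
Qed.

(** The integration by parts used both for the Euler-Lagrange equation (u_j the
derivatives of a variation) and for the conservation law (u_j the generators
eta^j, or the derivatives of q). *)
Lemma cder_phi_sum T (u u' : nat -> gnum -> 'rV[gnum]_d) : T `<=` I ->
  (forall j k, (j < m)%N -> cder T (fun t => u j t 0 k) (fun t => u' j t 0 k)) ->
  cder T (fun t => \sum_(1 <= j < m.+1) dot (phi t1 t2 L j q t) (u j.-1 t))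
    (fun t => \sum_(j < m.+1) dot (A j t) (u j t) - dot (phi t1 t2 L 0 q t) (u 0%N t) +
      \sum_(1 <= j < m.+1) dot (phi t1 t2 L j q t) (u' j.-1 t - u j t)).
Proof.
move=> TI hu.
have h := cder_sum (index_enum 'I_d) (fun k => cder_sum (index_enum 'I_m) (fun j : 'I_m =>
  cderM (cder_sub TI (cder_phi k (ltn_ord j))) (hu j k (ltn_ord j)))).
apply: cder_eq h => t Tt; rewrite !big_add1/= !big_mkord.
  by rewrite exchange_big.
have E n (v w : nat -> 'rV[gnum]_d) :
    \sum_(j < n) dot (v j) (w j) = \sum_k \sum_(j < n) v j 0 k * w j 0 k.
  by rewrite exchange_big.
rewrite (E _ (fun j => A j t) (fun j => u j t)).
rewrite (E _ (fun j => phi t1 t2 L j.+1 q t) (fun j => u' j t - u j.+1 t)).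
rewrite /dot -sumrB -big_split/=.
apply: eq_bigr => k _.
rewrite (@telescope_phi _ m (fun j => phi t1 t2 L j q t 0 k) (fun j => A j t 0 k)
  (fun j => u j t 0 k) (fun j => u' j t 0 k)); last by rewrite phi_last//; exact: TI.
by congr (_ + _); apply: eq_bigr => j _; rewrite !mxE.
Qed.

End AlongCurve.
End Lagrangian.

(** * The Euler-Lagrange equation *)

Section EulerLagrange.
Context {R : realType} {rho : gauge R} {d m : nat}.
#[local] Opaque gpd gint.
Local Notation gnum := (gnum rho).
Context (t1 t2 : gnum) (t12 : glt t1 t2).
Local Notation I := (gitv t1 t2).

(** A sum of squares has a representing net of sums of squares, to which gint_eq0
applies. *)
Lemma gint_sqr_eq0 (f : gnum -> 'rV[gnum]_d) : gsmooth (gset1 I) (gfun1 f) ->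
  gint t1 t2 (fun t => dot (f t) (f t)) t1 t2 = 0 -> forall t, I t -> f t = 0.
Proof.
move=> sf I0 t It; have [a [b [at1 bt2 ab ab_lt]]] := glt_reps t12.
have [Om [F [dO sF]]] := gsmooth_common sf.
have sS : snet (gset1 I) Om (fun e x => \sum_k F k e x * F k e x)
    (fun z => dot (f (z 0 0)) (f (z 0 0))).
  split=> //.
    apply: alg_mnet => //; apply: alg_sum => // k.
    by apply: alg_mul; exact: snet_alg (sF k).
  move=> x u Ix ux; apply: rep_sum => k.
  by have [_ _ vF] := sF k; apply: repM; exact: vF.
have h := gint_eq0 at1 bt2 ab ab_lt sS _ I0 It.
apply/rowP => k; rewrite mxE; apply: (@sqr_eq0_sum _ _ _ (fun k => f t 0 k)).
rewrite -[RHS]h; last by move=> e v _; apply: sumr_ge0 => l _; exact: sqr_ge0.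
by apply: eq_bigr => l _; rewrite expr2.
Qed.

(** Both t - rho^K and t + rho^K belong to the interval for some K. *)
Lemma open_sub_gitv_units (T : set gnum) t : sopen (gset1 T) -> T `<=` I -> T t ->
  t - t1 \is a GRing.unit /\ t2 - t \is a GRing.unit.
Proof.
move=> oT TI Tt; have [a [b [at1 bt2 _ _]]] := glt_reps t12.
have [u ut] := rep_exists t.
have : sint (gset1 T) t%:M by apply: oT; rewrite gset1_scalar.
rewrite sintE => -[K hK].
have shift (c : R) : `|c| <= 1 -> exists2 y, I y & is_rep (fun e => u e + c * rho e ^+ K) y.
  move=> c1.
  have [||y Ty uy] := hK (fun e => (u e)%:M) (fun e => (u e + c * rho e ^+ K)%:M).
  - exact: repv_scalar.
  - apply: nearW => e; apply: rv_norm_le => [|j]; first exact: ltW (gexp_gt0 K e).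
    rewrite ord1 mxE [X in X + _]mxE [X in _ + X]mxE [X in - X]mxE eqxx/= !mulr1n addrAC subrr add0r.
    by rewrite normrM [`|rho e ^+ K|]ger0_norm ?ler_piMl// ltW ?gexp_gt0.
  exists (y 0 0); first exact: TI.
  by have := uy 0; under eq_fun do rewrite mxE eqxx mulr1n.
have dbl : \forall e \near eps0 R, rho e ^+ K.+1 *+ 2 <= rho e ^+ K.
  have := gauge_small rho (r := 2^-1); rewrite invr_gt0 ltr0n => /(_ isT).
  by apply: filterS => e; exact: gauge_double.
split.
  have [|y [/(gleP at1 _) h _] uy] := shift (-1); first by rewrite normrN1.
  apply/(unitP (repB ut at1)); exists K.+1; apply: filterS2 dbl (h _ uy K.+1) => e.
  by move: (rho e ^+ K.+1) (rho e ^+ K) => x y'; rewrite mulr2n => h1 h2; apply: le_trans (ler_norm _); lra.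
have [|y [_ /(gleP _ bt2) h] uy] := shift 1; first by rewrite normr1.
apply/(unitP (repB bt2 ut)); exists K.+1; apply: filterS2 dbl (h _ uy K.+1) => e.
by move: (rho e ^+ K.+1) (rho e ^+ K) => x y'; rewrite mulr2n => h1 h2; apply: le_trans (ler_norm _); lra.
Qed.

Context (L : gnum -> 'M[gnum]_(m.+1, d) -> gnum).
Hypothesis L_gsf : gsf (lagr_dom (d := d) (m := m) t1 t2) setT (lagr_fun L).
Local Notation A q i t := (lagr_grad t1 t2 L i t (jet t1 t2 q t)).

Lemma csmooth_dot_jet q h : gsmooth (gset1 I) (gfun1 q) -> gsmooth (gset1 I) (gfun1 h) ->
  csmooth I (fun t => \sum_(i < m.+1) dot (A q i t) (gder I i h t)).
Proof.
move=> sq sh; apply: csmooth_sum => i; apply: csmooth_sum => k.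
apply: csmoothM; first exact: (lagr_grad_jet t12 L_gsf).
exact: csmooth_cder (cder_jet t12 sh i k).
Qed.

(** L along q + s h is a function of (s, t) whose s-derivative at s = 0 is given
by the chain rule, and the integral may be differentiated in s. *)
Lemma first_variationE q h : gsmooth (gset1 I) (gfun1 q) -> gsmooth (gset1 I) (gfun1 h) ->
  first_variation t1 t2 L q h =
  gint t1 t2 (fun t => \sum_(i < m.+1) dot (A q i t) (gder I i h t)) t1 t2.
Proof.
move=> sq sh; have [a [b [at1 bt2 ab ab_lt]]] := glt_reps t12.
have rI := gitv_regular t12.
have r0 (s t : gnum) : row2 s t 0 0 = s := (row2E s t).1.
have r1 (s t : gnum) : row2 s t 0 1 = t := (row2E s t).2.
pose M (i : 'I_m.+1) (k : 'I_d) (z : 'rV[gnum]_2) :=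
  gder I i q (z 0 1) 0 k + z 0 0 * gder I i h (z 0 1) 0 k.
pose g (z : 'rV[gnum]_2) := lagr_pd t1 t2 L [::] (z 0 1) (\matrix_(i, k) M i k z).
have c0 := sgrad_coord (slab t1 t2 (1 : 'I_2)) 0.
have c1 := sgrad_coord (slab t1 t2 (1 : 'I_2)) 1.
have hM i k := sgradD (sgrad_curve (cder_jet t12 sq (i : 'I_m.+1) k) c1 (fun _ h => h))
  (sgradM c0 (sgrad_curve (cder_jet t12 sh (i : 'I_m.+1) k) c1 (fun _ h => h))).
have hg := lagr_chain t12 L_gsf [::] c1 hM (fun _ h => h).
have D := gint_derive at1 bt2 ab hg.
have sqh (s : gnum) : gsmooth (gset1 I) (gfun1 (fun t => q t + s *: h t)).
  apply/csmooth_gsmooth => k; have [q' hq] := (csmooth_gsmooth _ _).2 sq k.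
  have [h' hh] := (csmooth_gsmooth _ _).2 sh k.
  apply: (@csmooth_eq _ _ _ (fun t => q t 0 k + s * h t 0 k)).
    by move=> t _; rewrite !mxE.
  exact: csmooth_cder (cderD hq (cderM (cder_cst I s) hh)).
have E s : gint t1 t2 (fun t => g (row2 s t)) t1 t2 = action t1 t2 L (fun t => q t + s *: h t).
  symmetry; apply: (gint_eq t12); first exact: csmooth_cder (cder_Lq t12 L_gsf (sqh s)).
  move=> t It; rewrite /g !r1 (lagr_pd_nil t12 L_gsf) //; congr (L t _).
  by apply/matrixP => i k; rewrite mxE [RHS]mxE /M r0 r1 (gder_lincomb s i k rI sq sh It).
have D' := cder_eq (fun s _ => E s) (fun s _ => erefl) D.
rewrite /first_variation.
rewrite (gder_scalar (sopen_regular (@sopen_setT _ _ 1)) D' Logic.I).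
symmetry; apply: (gint_eq t12); first exact: csmooth_dot_jet.
move=> t It.
have jE : \matrix_(i, k) M i k (row2 0 t) = jet t1 t2 q t.
  by apply/matrixP => i k; rewrite mxE [RHS]mxE /M r0 r1 mul0r addr0.
rewrite jE r0 r1 [X in _ = X + _]mulr0 add0r.
apply: eq_bigr => i _; apply: eq_bigr => k _.
rewrite (lagr_gradE t1 t2 L); congr (_ * _).
by rewrite mul0r add0r [X in _ = X + _]mulr0 add0r [RHS]mulr1.
Qed.

(** The variation h = w^2 phi^0, with w = ((t - t1) (t2 - t))^m, is admissible
since w vanishes to order m at both ends. Integration by parts turns the first
variation at h into the integral of the sum of squares of the components of
w phi^0, so that w phi^0 = 0. A single global test function thus replaces the
localization by bump functions of the fundamental lemma. *)
Theorem euler_lagrange q t : weak_extremal t1 t2 L q -> I t ->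
  t - t1 \is a GRing.unit -> t2 - t \is a GRing.unit -> phi t1 t2 L 0 q t = 0.
Proof.
move=> [qS q0] It u1 u2; have [a [b [at1 bt2 ab ab_lt]]] := glt_reps t12.
have rI := gitv_regular t12; have sq := gsf_gsmooth qS.
pose w1 u := (u - t1) ^+ m; pose w2 u := (t2 - u) ^+ m.
(* f = w phi^0 and h = w f, so that phi^0 . h is the sum of squares f . f. *)
pose f u := (w1 u * w2 u) *: phi t1 t2 L 0 q u.
pose h u := (w1 u * w2 u) *: f u.
have sw1 : csmooth I w1 by apply: csmoothX; exact: csmooth_sub_cst.
have sw2 : csmooth I w2.
  by apply: csmoothX; exact: csmooth_cder (cderB (cder_cst I t2) (cder_id I)).
have sp k := phi_csmooth t12 L_gsf sq 0 k.
have sfk k : csmooth I (fun u => f u 0 k).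
  apply: (@csmooth_eq _ _ _ (fun u => w1 u * w2 u * phi t1 t2 L 0 q u 0 k)).
    by move=> u _; rewrite mxE.
  by apply: csmoothM => //; exact: csmoothM.
have shk k : csmooth I (fun u => h u 0 k).
  apply: (@csmooth_eq _ _ _ (fun u => w1 u * w2 u * f u 0 k)).
    by move=> u _; rewrite [RHS]mxE.
  by apply: csmoothM => //; exact: csmoothM.
have sf : gsmooth (gset1 I) (gfun1 f) by apply/csmooth_gsmooth.
have sh : gsmooth (gset1 I) (gfun1 h) by apply/csmooth_gsmooth.
have It1 := gitv_t1 at1 bt2 ab; have It2 := gitv_t2 at1 bt2 ab.
have h1 i : (i < m)%N -> gder I i h t1 = 0.
  move=> im; apply/rowP => k; rewrite [RHS]mxE.
  apply: (gder_vanish rI sh (csmoothM sw2 (sfk k)) It1 _ im) => u _.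
  by rewrite [LHS]mxE -mulrA.
have h2 i : (i < m)%N -> gder I i h t2 = 0.
  move=> im; apply/rowP => k; rewrite [RHS]mxE.
  apply: (gder_vanish rI sh (csmoothM (csmooth_cst I ((-1) ^+ m)) (csmoothM sw1 (sfk k))) It2 _ im) => u _.
  rewrite [LHS]mxE /w2 -(opprB u t2) (exprNn (u - t2)).
  by move: (_ ^+ m) (_ ^+ m) => x y; ring.
have hV : first_variation t1 t2 L q h = 0.
  by apply: q0; split=> [|i im]; [exact: (gsmooth_gsf sh)|split; [exact: h1|exact: h2]].
rewrite (first_variationE sq sh) in hV.
pose B u := \sum_(1 <= j < m.+1) dot (phi t1 t2 L j q u) (gder I j.-1 h u).
pose S u := \sum_(i < m.+1) dot (A q i u) (gder I i h u).
have dB : cder I B (fun u => S u - dot (f u) (f u)).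
  have := cder_phi_sum t12 L_gsf sq (u := fun j => gder I j h)
    (u' := fun j => gder I j.+1 h) (fun _ h => h) (fun j k _ => cder_jet t12 sh j k).
  apply: cder_eq => // u Iu; rewrite [X in _ + X]big1_seq => [|j]; last first.
    rewrite mem_index_iota => /andP[_ /andP[j1 _]]; rewrite prednK// subrr.
    by rewrite /dot big1// => k _; rewrite [X in _ * X]mxE mulr0.
  rewrite addr0; congr (_ - _); rewrite (gder0 rI sh Iu).
  apply: eq_bigr => k _; rewrite [f u 0 k]mxE [h u 0 k]mxE [f u 0 k]mxE; ring.
have := gint_FTC at1 bt2 ab dB.
have -> : B t1 = 0.
  apply: big1_seq => j; rewrite mem_index_iota => /andP[_ /andP[j1 jm]].
  rewrite h1 ?prednK//; apply: big1 => k _; by rewrite [X in _ * X]mxE mulr0.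
have -> : B t2 = 0.
  apply: big1_seq => j; rewrite mem_index_iota => /andP[_ /andP[j1 jm]].
  rewrite h2 ?prednK//; apply: big1 => k _; by rewrite [X in _ * X]mxE mulr0.
have sff : csmooth I (fun u => dot (f u) (f u)).
  by apply: csmooth_sum => k; exact: csmoothM.
have sS := csmooth_dot_jet sq sh.
rewrite (gintB at1 bt2 ab ((csmooth_snet _ _).2 sS) ((csmooth_snet _ _).2 sff)).
rewrite hV sub0r subr0 => /eqP; rewrite oppr_eq0 => /eqP ff0.
have := gint_sqr_eq0 sf ff0 It.
have wU : w1 t * w2 t \is a GRing.unit by rewrite unitrM; apply/andP; split; exact: unitrX.
move=> ft0; rewrite -[LHS]scale1r -(mulVr wU) -scalerA.
by rewrite [X in _ *: X]ft0 scaler0.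
Qed.

End EulerLagrange.

(** * Functions of two generalized variables *)

Section Products.
Context {R : realType} {rho : gauge R}.
#[local] Opaque gpd gint.
Local Notation gnum := (gnum rho).

Lemma sopen_gprod n (P : set gnum) (Z : set 'rV[gnum]_n) :
  sopen (gset1 P) -> sopen Z -> sopen (gprod P Z).
Proof.
move=> oP oZ x [Px Zx].
have := oZ _ Zx; rewrite sintE => -[K2 h2].
have : sint (gset1 P) (lsubmx x) by exact: oP.
rewrite !sintE => -[K1 h1]; exists (maxn K1 K2) => u v ux uv.
have [||y1 Py1 vy1] := h1 (fun e => lsubmx (u e)) (fun e => lsubmx (v e)).
- by move=> j; rewrite mxE; under eq_fun do rewrite mxE; exact: ux.
- apply: filterS uv => e h; apply: le_trans (gexp_le _ (leq_maxl K1 K2)).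
  apply: le_trans h; apply: rv_norm_le => // j.
  by have := rv_coord_le (v e - u e) (lshift n j); rewrite !mxE.
have [||y2 Zy2 vy2] := h2 (fun e => rsubmx (u e)) (fun e => rsubmx (v e)).
- by move=> j; rewrite mxE; under eq_fun do rewrite mxE; exact: ux.
- apply: filterS uv => e h; apply: le_trans (gexp_le _ (leq_maxr K1 K2)).
  apply: le_trans h; apply: rv_norm_le => // j.
  by have := rv_coord_le (v e - u e) (rshift 1 j); rewrite !mxE.
exists (row_mx y1 y2); first by split; rewrite ?row_mxKl ?row_mxKr.
move=> j; have [j1 ->|j2 ->] := split_ordP j.
  by rewrite row_mxEl; have := vy1 j1; under eq_fun do rewrite mxE.
by rewrite row_mxEr; have := vy2 j2; under eq_fun do rewrite mxE.
Qed.

Definition i_s : 'I_(1 + 1) := lshift 1 0.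
Definition i_t : 'I_(1 + 1) := rshift 1 0.
Definition gpair (s t : gnum) : 'rV[gnum]_(1 + 1) := row_mx s%:M t%:M.

Lemma i_ts : (i_t == i_s) = false.
Proof. exact: eq_rlshift. Qed.

Lemma gpair_s s t : gpair s t 0 i_s = s.
Proof. by rewrite /gpair row_mxEl scalar_rv1. Qed.

Lemma gpair_t s t : gpair s t 0 i_t = t.
Proof. by rewrite /gpair row_mxEr scalar_rv1. Qed.

Lemma gpairK (z : 'rV[gnum]_(1 + 1)) : gpair (z 0 i_s) (z 0 i_t) = z.
Proof.
apply/rowP => j; have [j0 ->|j0 ->] := split_ordP j; rewrite ord1.
  by rewrite -[LHS]/(gpair _ _ 0 i_s) gpair_s.
by rewrite -[LHS]/(gpair _ _ 0 i_t) gpair_t.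
Qed.

Context (P T : set gnum).
Local Notation X := (gprod P (gset1 T)).

Lemma gprod_gpair s t : X (gpair s t) <-> P s /\ T t.
Proof. by rewrite /gprod/= /gpair row_mxKl row_mxKr /gset1/= !scalar_rv1. Qed.

Lemma gprod_coord (z : 'rV[gnum]_(1 + 1)) : X z -> P (z 0 i_s) /\ T (z 0 i_t).
Proof. by rewrite -{1}(gpairK z) gprod_gpair. Qed.

Lemma sgrad_slice f g s : sgrad X f g -> P s ->
  cder T (fun t => f (gpair s t)) (fun t => g i_t (gpair s t)).
Proof.
move=> hf Ps.
have hc j : cder T (fun t => gpair s t 0 j) (fun=> (j == i_t)%:R).
  have [j0 ->|j0 ->] := split_ordP j; rewrite ord1.
    by apply: cder_eq (cder_cst T s) => // t _; rewrite -[RHS]/(gpair _ _ 0 i_s) gpair_s.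
  by apply: cder_eq (cder_id T) => // t _; rewrite -[RHS]/(gpair _ _ 0 i_t) gpair_t.
have E t : \row_j gpair s t 0 j = gpair s t by apply/rowP => j; rewrite mxE.
have := cder_comp hf hc; move=> H; apply: cder_eq (H _) => t Tt; rewrite E//.
  rewrite (@big_split_ord _ _ _ 1 1)/= !big_ord1.
  by rewrite [X in X + _]mulr0 add0r [LHS]mulr1.
by apply/gprod_gpair.
Qed.

End Products.

(** * Infinitesimal invariance and conservation *)

Section Noether.
Context {R : realType} {rho : gauge R} {d m : nat}.
#[local] Opaque gpd gint.
Local Notation gnum := (gnum rho).
Context (t1 t2 : gnum) (t12 : glt t1 t2).
Context (L : gnum -> 'M[gnum]_(m.+1, d) -> gnum).
Hypothesis L_gsf : gsf (lagr_dom (d := d) (m := m) t1 t2) setT (lagr_fun L).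
Context (P T' : set gnum) (S' : set 'rV[gnum]_d).
Context (tau : gnum -> gnum -> gnum) (sigma : gnum -> 'rV[gnum]_d -> 'rV[gnum]_d).
Hypotheses (T'_sub : T' `<=` gitv t1 t2) (T'_open : sopen (gset1 T')) (S'_open : sopen S').
Hypotheses (tau_group : one_parameter_group P (gset1 T') (vtau tau))
  (sigma_group : one_parameter_group P S' sigma).
Local Notation I := (gitv t1 t2).
Local Notation X := (gprod P (gset1 T')).
Local Notation tau_s := (tau_s P T' tau).
Local Notation tau_t := (tau_t P T' tau).

Lemma P_open : sopen (gset1 P).
Proof. by have [[]] := tau_group. Qed.

Lemma P0 : P 0.
Proof. by have [[]] := tau_group. Qed.

Lemma X_regular : regular X.
Proof. exact/sopen_regular/(sopen_gprod P_open T'_open). Qed.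

Lemma T'_regular : regular (gset1 T').
Proof. exact: sopen_regular. Qed.

Lemma sgrad_pair n (f : 'rV[gnum]_(1 + 1) -> 'rV[gnum]_n) alpha k : gsmooth X f ->
  sgrad X (fun z => gpd X alpha f (gpair (z 0 i_s) (z 0 i_t)) 0 k)
    (fun l z => gpd X (l :: alpha) f (gpair (z 0 i_s) (z 0 i_t)) 0 k).
Proof.
move=> sf; apply: sgrad_eq (sgrad_gpd alpha k X_regular sf) => [z _|l z _];
  by rewrite gpairK.
Qed.

Lemma tau_gsmooth : gsmooth X (gfun2 (vtau tau)).
Proof. by have [_ /gsf_gsmooth] := tau_group. Qed.

Lemma gfun2_gpair n (f : gnum -> 'rV[gnum]_1 -> 'rV[gnum]_n) s t :
  gfun2 f (gpair s t) = f s t%:M.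
Proof. by rewrite /gfun2 /gpair row_mxKl row_mxKr scalar_rv1. Qed.

Lemma vtauE s t : vtau tau s t%:M = (tau s t)%:M.
Proof. by rewrite /vtau /gfun1 /gscalar scalar_rv1. Qed.

Lemma sgrad_tau : sgrad X (fun z => tau (z 0 i_s) (z 0 i_t))
  (fun i z => dtau P T' tau i (z 0 i_s) (z 0 i_t)).
Proof.
apply: sgrad_eq (sgrad_pair [::] 0 tau_gsmooth) => // z Xz.
rewrite (gpd_nil X_regular tau_gsmooth) ?gpairK//.
by rewrite -{1}(gpairK z) gfun2_gpair vtauE scalar_rv1.
Qed.

Lemma sgrad_dtau i : sgrad X (fun z => dtau P T' tau i (z 0 i_s) (z 0 i_t))
  (fun l z => gpd X [:: l; i] (gfun2 (vtau tau)) (gpair (z 0 i_s) (z 0 i_t)) 0 0).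
Proof. exact: sgrad_pair tau_gsmooth. Qed.

Lemma tau_in s t : P s -> T' t -> T' (tau s t).
Proof.
move=> Ps Tt; have [_ [_ h] _ _ _] := tau_group.
rewrite -[tau s t]scalar_rv1 -vtauE -gfun2_gpair; apply: h.
by exists (gpair s t) => //; apply/gprod_gpair.
Qed.

Lemma tau0 t : T' t -> tau 0 t = t.
Proof.
move=> Tt; have [_ _ _ h _] := tau_group.
have := h t%:M; rewrite vtauE gset1_scalar => /(_ Tt)/rowP/(_ 0).
by rewrite !scalar_rv1.
Qed.

Lemma cder_tau s : P s -> cder T' (tau s) (tau_t s).
Proof.
move=> Ps; apply: cder_eq (sgrad_slice sgrad_tau Ps) => t _; by rewrite gpair_s gpair_t.
Qed.

Lemma tau_t0 t : T' t -> tau_t 0 t = 1.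
Proof.
move=> Tt; exact: (cder_unique T'_regular (cder_tau P0) (cder_id T') tau0 Tt).
Qed.

(** The chain rule applied to the inverse diffeomorphism composed with
tau(s, .). *)
Lemma tau_t_unit s t : P s -> T' t -> tau_t s t \is a GRing.unit.
Proof.
move=> Ps Tt; have [_ _ /(_ s Ps)[_ [psiV /gsf_gsmooth sV hV]] _ _] := tau_group.
pose g u := psiV u%:M 0 0.
have [g' hg] : csmooth T' g.
  apply/csmooth_snet; have [Om [F sF]] := sV 0; exists Om, F.
  by apply: snet_eq sF => z _; rewrite /g rv1_scalar.
have h := sgrad_curve hg (cder_tau Ps) (fun z Tz => tau_in Ps Tz).
have gK u : T' u -> g (tau s u) = u.
  move=> Tu; rewrite /g -vtauE; have := hV u%:M; rewrite gset1_scalar => /(_ Tu)[-> _].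
  by rewrite scalar_rv1.
have E : g' (tau s t) * tau_t s t = 1.
  exact: (cder_unique (f' := fun t => g' (tau s t) * tau_t s t) T'_regular h (cder_id T') gK Tt).
by apply/unitrP; exists (g' (tau s t)); split; rewrite // mulrC.
Qed.

Section AlongCurve.
Context (q : gnum -> 'rV[gnum]_d).
Hypothesis qS : gsf_curve t1 t2 S' q.
Local Notation E := (dsigma_dtau P T' tau sigma q).
Local Notation eta := (Defs.eta t1 t2 P T' S' tau sigma q).
Local Notation q_smooth := (gsf_gsmooth qS).

(** The derivatives of the transformed curve with respect to transformed time,
as a function of (s, t) jointly: mixed partial derivatives of it can then be
exchanged. *)
Definition sigma_jet i (z : 'rV[gnum]_(1 + 1)) := E i (z 0 i_s) (z 0 i_t).

Lemma sigma_jet_gpair i s t : sigma_jet i (gpair s t) = E i s t.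
Proof. by rewrite /sigma_jet gpair_s gpair_t. Qed.

Lemma q_in t : I t -> S' (q t).
Proof.
move=> It; have [_ h] := qS; apply: h; exists t%:M; first by rewrite gset1_scalar.
by rewrite /gfun1 scalar_rv1.
Qed.

(** Only the s-component of the gradient is made explicit: it is the one that
leads to the generator eta^0. *)
Lemma sgrad_sigma_curve k : exists g,
  sgrad X (fun z => sigma_jet 0 z 0 k) g /\
  forall z, X z -> g i_s z = gpd (gprod P S') [:: lshift d 0] (gfun2 sigma)
    (row_mx (z 0 i_s)%:M (q (z 0 i_t))) 0 k.
Proof.
have rY : regular (gprod P S') by exact/sopen_regular/(sopen_gprod P_open S'_open).
have sS : gsmooth (gprod P S') (gfun2 sigma) by have [_ /gsf_gsmooth] := sigma_group.
pose f (j : 'I_(1 + d)) (z : 'rV[gnum]_(1 + 1)) := row_mx (z 0 i_s)%:M (q (z 0 i_t)) 0 j.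
have hdf0 (j : 'I_(1 + d)) : exists dfj, sgrad X (f j) dfj /\
    forall z, dfj i_s z = (j == lshift d 0)%:R.
  have [j0 ->|j0 ->] := split_ordP j.
    exists (fun l _ => (i_s == l)%:R); rewrite ord1; split=> [|z]; last by rewrite !eqxx.
    by apply: sgrad_eq (sgrad_coord X i_s) => // z _; rewrite /f row_mxEl scalar_rv1.
  have [f' hf'] := (csmooth_gsmooth _ _).2 q_smooth j0.
  have h := sgrad_curve hf' (sgrad_coord X i_t) (fun z Xz => T'_sub (gprod_coord Xz).2).
  exists (fun l z => f' (z 0 i_t) * (i_t == l)%:R); split=> [|z]; last first.
    by rewrite i_ts mulr0 eq_rlshift.
  by apply: sgrad_eq h => // z _; rewrite /f row_mxEr.
have [df hdf] := choice hdf0.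
have fE z : \row_j f j z = row_mx (z 0 i_s)%:M (q (z 0 i_t)) by apply/rowP => j; rewrite mxE.
have fY z : X z -> gprod P S' (row_mx (z 0 i_s)%:M (q (z 0 i_t))).
  move=> Xz; have [Ps Tt] := gprod_coord Xz; split; rewrite ?row_mxKl ?row_mxKr ?scalar_rv1//.
  exact/q_in/T'_sub.
have h := sgrad_comp (sgrad_gpd [::] k rY sS) (fun j => (hdf j).1).
eexists; split.
  apply: sgrad_eq (h _) => [z Xz|l z _|z Xz]; [|by []|by rewrite fE; exact: fY].
  rewrite fE (gpd_nil rY sS (fY _ Xz)) /gfun2 row_mxKl row_mxKr scalar_rv1.
  by [].
move=> z Xz /=; rewrite fE (bigD1 (lshift d 0))//= big1 => [|j jn].
  by rewrite addr0 (hdf _).2 eqxx mulr1.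
by rewrite (hdf _).2 (negbTE jn) mulr0.
Qed.

Lemma gder_slice i s t k : gsmooth X (sigma_jet i) -> P s -> T' t ->
  gder T' 1 (E i s) t 0 k = gpd X [:: i_t] (sigma_jet i) (gpair s t) 0 k.
Proof.
move=> sE Ps Tt; apply: (gder_cder (f' := fun k t => gpd X [:: i_t] (sigma_jet i) (gpair s t) 0 k)) => //.
  exact: T'_regular.
move=> j; apply: cder_eq (sgrad_slice (sgrad_gpd [::] j X_regular sE) Ps) => // u Tu.
rewrite (gpd_nil X_regular sE) ?sigma_jet_gpair//; exact/gprod_gpair.
Qed.

Definition tau_tV (z : 'rV[gnum]_(1 + 1)) : gnum := (tau_t (z 0 i_s) (z 0 i_t))^-1.

Lemma sgrad_tau_tV : sgrad X tau_tV (fun l z =>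
  - (tau_tV z * tau_tV z * gpd X [:: l; i_t] (gfun2 (vtau tau)) (gpair (z 0 i_s) (z 0 i_t)) 0 0)).
Proof.
apply: sgradV (sgrad_dtau i_t) _ => z Xz; have [Ps Tt] := gprod_coord Xz; exact: tau_t_unit.
Qed.

Lemma sigma_jet_gsmooth i : gsmooth X (sigma_jet i).
Proof.
elim: i => [|i ih] k.
  by have [g [[Om [F [sF _]]] _]] := sgrad_sigma_curve k; exists Om, F.
have [Om [F [sF _]]] := sgradM sgrad_tau_tV (sgrad_gpd [:: i_t] k X_regular ih).
exists Om, F; apply: snet_eq sF => z Xz; have [Ps Tt] := gprod_coord Xz.
by rewrite /sigma_jet /= [RHS]mxE (gder_slice k ih Ps Tt) gpairK.
Qed.

Lemma sgrad_sigma_jet i k : sgrad X (fun z => sigma_jet i z 0 k) (fun l z => gpd X [:: l] (sigma_jet i) z 0 k).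
Proof.
apply: sgrad_eq (sgrad_gpd [::] k X_regular (sigma_jet_gsmooth i)) => // z Xz.
by rewrite (gpd_nil X_regular (sigma_jet_gsmooth i)).
Qed.

Lemma sigma0 x : S' x -> sigma 0 x = x.
Proof. by have [_ _ _ h _] := sigma_group; exact: h. Qed.

(** At s = 0 both groups are the identity, in particular the t-derivative of tau is
1. *)
Lemma dsigma_dtau_at0 i t : T' t -> E i 0 t = gder I i q t.
Proof.
elim: i t => [|i ih] t Tt.
  by rewrite (gder0 (gitv_regular t12) q_smooth (T'_sub Tt)) /= sigma0//; exact/q_in/T'_sub.
rewrite /= (tau_t0 Tt) invr1 scale1r; apply/rowP => k.
apply: (gder_cder (f' := fun k t => gder I i.+1 q t 0 k)) => //; first exact: T'_regular.
move=> j; apply: cder_eq (cder_sub T'_sub (cder_jet t12 q_smooth i j)) => // u Tu.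
by rewrite ih.
Qed.

Lemma cder_tau_s0 : cder T' (tau_s 0)
  (fun t => gpd X [:: i_t; i_s] (gfun2 (vtau tau)) (gpair 0 t) 0 0).
Proof.
apply: cder_eq (sgrad_slice (sgrad_dtau i_s) P0) => t _; by rewrite gpair_s gpair_t.
Qed.

Lemma gder_tau_s0 t : T' t -> gder T' 1 (gscalar (tau_s 0)) t 0 0 =
  gpd X [:: i_s; i_t] (gfun2 (vtau tau)) (gpair 0 t) 0 0.
Proof.
move=> Tt; rewrite (gder_scalar T'_regular cder_tau_s0 Tt).
by apply: (sgrad_schwarz _ _ _ X_regular tau_gsmooth); exact/gprod_gpair/(conj P0).
Qed.

Lemma cder_eta_mixed i k :
  (forall t k, T' t -> eta i t 0 k = gpd X [:: i_s] (sigma_jet i) (gpair 0 t) 0 k) ->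
  cder T' (fun t => eta i t 0 k) (fun t => gpd X [:: i_t; i_s] (sigma_jet i) (gpair 0 t) 0 k).
Proof.
move=> h; apply: cder_eq (sgrad_slice (sgrad_gpd [:: i_s] k X_regular (sigma_jet_gsmooth i)) P0) => // t Tt.
by rewrite h.
Qed.

(** The recursive definition of eta^i is the product rule for
E^(i+1) = tau_t^-1 d/dt E^i differentiated in s at s = 0, where tau_t = 1: the
s- and t-derivatives of E^i are exchanged by Schwarz' theorem, and so are those
of tau, which turns the s-derivative of tau_t into the derivative of the
generator of tau. *)
Lemma eta_dsigma i t k : T' t -> eta i t 0 k = gpd X [:: i_s] (sigma_jet i) (gpair 0 t) 0 k.
Proof.
elim: i t k => [|i ih] t k Tt; have Xt : X (gpair 0 t) by exact/gprod_gpair/(conj P0).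
  have [g [hg gE]] := sgrad_sigma_curve k.
  have E1 := sgrad_unique i_s X_regular hg (sgrad_sigma_jet 0 k) (fun _ _ => erefl) Xt.
  by refine (etrans _ E1); rewrite (gE _ Xt) gpair_s gpair_t.
rewrite /= mxE [X in _ + X]mxE [X in - X]mxE.
have hE := sgradM sgrad_tau_tV (sgrad_gpd [:: i_t] k X_regular (sigma_jet_gsmooth i)).
have EE z : X z -> tau_tV z * gpd X [:: i_t] (sigma_jet i) z 0 k = sigma_jet i.+1 z 0 k.
  move=> Xz; have [Ps Tz] := gprod_coord Xz.
  by rewrite /sigma_jet /= [RHS]mxE (gder_slice k (sigma_jet_gsmooth i) Ps Tz) gpairK.
have E1 := sgrad_unique i_s X_regular hE (sgrad_sigma_jet i.+1 k) EE Xt.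
have A1 := etrans (gder_cder k T'_regular (fun j => cder_eta_mixed j ih) Tt)
  (sgrad_schwarz i_t i_s k X_regular (sigma_jet_gsmooth i) Xt).
have A2 : tau_tV (gpair 0 t) = 1 by rewrite /tau_tV gpair_s gpair_t tau_t0// invr1.
have A3 : gder T' 1 (E i 0) t 0 k = gder I i.+1 q t 0 k.
  by rewrite -(dsigma_dtau_at0 i.+1 Tt) /= tau_t0// invr1 scale1r.
have A4 := etrans (esym (gder_slice k (sigma_jet_gsmooth i) P0 Tt)) A3.
have A5 := congr1 (fun w => gpd X [:: i_s; i_t] (gfun2 (vtau tau)) w 0 0) (gpairK (gpair 0 t)).
(* The product rule at s = 0, with v = tau_t^-1 = 1, b = q^(i+1), and x, y the
   mixed derivatives of E^i and tau. *)
have ringE (x y y' b c v : gnum) : v = 1 -> b = c -> y' = y ->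
    x - y * c = v * x + b * - (v * v * y').
  by move=> -> -> ->; ring.
refine (etrans _ E1).
exact: (etrans (congr2 (fun x y => x - y * gder I i.+1 q t 0 k) A1 (gder_tau_s0 Tt))
  (ringE _ _ _ _ _ _ A2 A4 A5)).
Qed.

Lemma cder_eta i k : cder T' (fun t => eta i t 0 k) (fun t => gder T' 1 (fun u => eta i u) t 0 k).
Proof.
have h j := cder_eta_mixed j (fun t k (Tt : T' t) => eta_dsigma i k Tt).
by apply: cder_eq (h k) => // t Tt; rewrite (gder_cder k T'_regular h Tt).
Qed.

Local Notation A i t := (lagr_grad t1 t2 L i t (jet t1 t2 q t)).
Local Notation xi' t := (gder T' 1 (gscalar (tau_s 0)) t 0 0).

(** The left-hand side of the invariance identity does not depend on s; hence the
s-derivative of its right-hand side vanishes at s = 0. *)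
Lemma invariance_derived t : (forall s t, P s -> T' t -> Lq t1 t2 L q t =
    L (tau s t) (\matrix_(i, k) E i s t 0 k) * tau_t s t) -> T' t ->
  lagr_t t1 t2 L t (jet t1 t2 q t) * tau_s 0 t +
  \sum_(i < m.+1) dot (A i t) (eta i t) + Lq t1 t2 L q t * xi' t = 0.
Proof.
move=> inv Tt; have Xt : X (gpair 0 t) by exact/gprod_gpair/(conj P0).
have h1 := sgrad_curve (cder_Lq t12 L_gsf q_smooth) (sgrad_coord X i_t)
  (fun z Xz => T'_sub (gprod_coord Xz).2).
have tau_I z : X z -> I (tau (z 0 i_s) (z 0 i_t)).
  by move=> Xz; have [Ps Tz] := gprod_coord Xz; exact/T'_sub/tau_in.
have h2 := lagr_chain t12 L_gsf [::] sgrad_tau (fun (i : 'I_m.+1) k => sgrad_sigma_jet i k) tau_I.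
have h3 := sgradM h2 (sgrad_dtau i_t).
have EE z : X z -> Lq t1 t2 L q (z 0 i_t) =
    lagr_pd t1 t2 L [::] (tau (z 0 i_s) (z 0 i_t)) (\matrix_(i, k) sigma_jet i z 0 k) *
    tau_t (z 0 i_s) (z 0 i_t).
  move=> Xz; have [Ps Tz] := gprod_coord Xz.
  by rewrite (lagr_pd_nil t12 L_gsf); [exact: inv|exact: tau_I].
have := sgrad_unique i_s X_regular h1 h3 EE Xt.
have jE : \matrix_(i < m.+1, k < d) sigma_jet i (gpair 0 t) 0 k = jet t1 t2 q t.
  by apply/matrixP => i k; rewrite mxE [RHS]mxE sigma_jet_gpair dsigma_dtau_at0.
rewrite jE i_ts gpair_s gpair_t (tau0 Tt) (lagr_pd_nil t12 L_gsf _ (T'_sub Tt)).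
move=> E1.
have A1 := gder_tau_s0 Tt.
have A2 := tau_t0 Tt.
have A3 : \sum_(i < m.+1) dot (A i t) (eta i t) =
    \sum_i \sum_k lagr_pd t1 t2 L [:: rshift 1 (mxvec_index i k)] t (jet t1 t2 q t) *
      gpd X [:: i_s] (sigma_jet i) (gpair 0 t) 0 k.
  apply: eq_bigr => i _; apply: eq_bigr => k _.
  by rewrite (lagr_gradE t1 t2 L) (eta_dsigma i k Tt).
have ringE (z l x x' y y' v a b : gnum) : z * 0 = l * x' + v * (a * b + y') ->
    y = y' -> v = 1 -> x = x' -> a * b + y + l * x = 0.
  by move=> + -> v1 ->; rewrite mulr0 v1 mul1r addrC => <-.
exact: ringE E1 A3 A2 A1.
Qed.

(** By integration by parts, the derivative of the conserved quantity is the
left-hand side of invariance_derived minus the product of phi^0 with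
eta^0 - q' (d tau / ds); both vanish, the second one by the Euler-Lagrange
equation. *)
Lemma cder_noether : (forall s t, P s -> T' t -> Lq t1 t2 L q t =
    L (tau s t) (\matrix_(i, k) E i s t 0 k) * tau_t s t) ->
  weak_extremal t1 t2 L q ->
  cder T' (noether t1 t2 L P T' S' tau sigma q) (fun=> 0).
Proof.
move=> inv qW.
have phi0 t : T' t -> phi t1 t2 L 0 q t = 0.
  move=> Tt; have [u1 u2] := open_sub_gitv_units t12 T'_open T'_sub Tt.
  exact: (euler_lagrange t12 L_gsf qW (T'_sub Tt) u1 u2).
have d1 := cder_phi_sum t12 L_gsf q_smooth T'_sub (fun j k _ => cder_eta j k).
have d2 := cder_phi_sum t12 L_gsf q_smooth T'_sub (u := fun j => gder I j.+1 q)
  (fun j k _ => cder_sub T'_sub (cder_jet t12 q_smooth j.+1 k)).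
have d3 := cder_sub T'_sub (cder_Lq t12 L_gsf q_smooth).
have d4 : cder T' (tau_s 0) (fun t => xi' t).
  apply: cder_eq cder_tau_s0 => // t Tt.
  by rewrite (gder_scalar T'_regular cder_tau_s0 Tt).
pose B t := \sum_(1 <= j < m.+1) dot (phi t1 t2 L j q t) (gder I j q t).
have BE t : \sum_(1 <= j < m.+1) dot (phi t1 t2 L j q t) (gder I j.-1.+1 q t) = B t.
  by apply: eq_big_nat => j /andP[j1 _]; rewrite prednK.
have dot0l (v w : 'rV[gnum]_d) : v = 0 -> dot v w = 0.
  by move=> ->; apply: big1 => k _; rewrite mxE mul0r.
have F1 t : T' t -> \sum_(1 <= j < m.+1) dot (phi t1 t2 L j q t)
    (gder T' 1 (fun u => eta j.-1 u) t - eta j t) = xi' t * B t.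
  move=> Tt; rewrite mulr_sumr; apply: eq_big_nat => -[//|j] _ /=.
  rewrite opprB addrCA subrr addr0 mulr_sumr; apply: eq_bigr => k _.
  by rewrite [X in _ * X]mxE mulrCA.
have F2 t : \sum_(1 <= j < m.+1) dot (phi t1 t2 L j q t)
    (gder I j.-1.+2 q t - gder I j.+1 q t) = 0.
  apply: big1_seq => -[|j]; rewrite mem_index_iota// => _.
  by rewrite subrr; apply: big1 => k _; rewrite [X in _ * X]mxE mulr0.
have ringE (S p0 D1 l b b' x' x la Q p1 D2 : gnum) :
    la * x + S + l * x' = 0 -> p0 = 0 -> p1 = 0 -> D2 = 0 -> b = b' -> D1 = x' * b' ->
    S - p0 + D1 + ((l - b) * x' + x * (la + Q - (Q - p1 + D2))) = 0.
  by move=> h -> -> -> -> ->; rewrite -[RHS]h; ring.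
apply: cder_eq (cderD d1 (cderM (cderB d3 d2) d4)) => t Tt.
  by rewrite BE.
apply: ringE (invariance_derived inv Tt) _ _ _ (BE t) (F1 t Tt).
- exact: dot0l (phi0 t Tt).
- exact: dot0l (phi0 t Tt).
- exact: F2.
Qed.

End AlongCurve.
End Noether.

Theorem theorem53 (R : realType) (rho : gauge R) (d m : nat)
    (d_gt0 : (0 < d)%N) (m_gt0 : (0 < m)%N)
    (t1 t2 : gnum rho) (t12 : glt t1 t2)
    (L : gnum rho -> 'M[gnum rho]_(m.+1, d) -> gnum rho)
    (L_gsf : gsf (lagr_dom (d := d) (m := m) t1 t2) setT (lagr_fun L))
    (P T' : set (gnum rho)) (S' : set 'rV[gnum rho]_d)
    (tau : gnum rho -> gnum rho -> gnum rho)
    (sigma : gnum rho -> 'rV[gnum rho]_d -> 'rV[gnum rho]_d)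
    (T'_sub : T' `<=` gitv t1 t2)
    (T'_open : sopen (gset1 T')) (S'_open : sopen S')
    (tau_group : one_parameter_group P (gset1 T') (vtau tau))
    (sigma_group : one_parameter_group P S' sigma)
    (inv : invariant_action t1 t2 L P T' S' tau sigma) :
  forall q : gnum rho -> 'rV[gnum rho]_d,
    gsf_curve t1 t2 S' q -> weak_extremal t1 t2 L q ->
  forall t : gnum rho, T' t ->
    is_gder T' 1 (gscalar (noether t1 t2 L P T' S' tau sigma q)) t 0.
Proof.
move=> q qS qW t Tt.
have := is_gder_cder T'_open (cder_noether t12 L_gsf T'_sub T'_open S'_open tau_group
  sigma_group qS (inv q qW qS) qW) Tt.
by have -> : gscalar (fun=> 0) t = 0 :> 'rV[gnum rho]_1 by rewrite /gscalar raddf0.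
Qed.
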